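(* Let $\mathcal{D}=\{x\in\mathbb{R}^3:\ x_1^2+x_2^2<1\}$ and let $(u,p)$ be a smooth solution of the stationary Navier-Stokes equations $$u\cdot\nabla u+\nabla p-\Delta u=0,\qquad \nabla\cdot u=0\qquad\text{in }\mathcal{D},$$ subject to the Navier-Hodge-Lions boundary condition $$(\nabla\times u)\times\boldsymbol{n}=0,\qquad u\cdot\boldsymbol{n}=0\qquad\text{on }\partial\mathcal{D}.$$ Suppose that there are constants $C>0$ and $0<\beta<1$ such that $$|\nabla u(x_h,z)|\le C|z|^{\beta}\qquad\text{for all }|x_h|<1,\ |z|\ge1.$$ Then $$u=\frac{\Phi}{\pi}\,\boldsymbol{e_3},$$ where $\Phi$ is the flux of $u$.
   Context: Smooth means smooth up to the boundary; no axial symmetry is assumed. Points are written $x=(x_h,z)$ with $x_h=(x_1,x_2)$ and $z=x_3$; $\boldsymbol{e_3}=(0,0,1)$; $\boldsymbol{n}$ is the unit outer normal on $\partial\mathcal{D}$. Flux: $\Phi=\int_{\Sigma}u(x_h,z)\cdot\boldsymbol{e_3}\,dx_h$ with $\Sigma=\{|x_h|<1\}$; it does not depend on $z$, because $u$ is divergence free and $u\cdot\boldsymbol{n}=0$ on $\partial\mathcal{D}$. *)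

(* Defs.v *)
From HB Require Import structures.
From mathcomp Require Import all_boot all_order all_algebra.
From mathcomp Require Import all_classical all_reals all_analysis.

Set Implicit Arguments.
Unset Strict Implicit.
Unset Printing Implicit Defensive.

Import Order.TTheory GRing.Theory Num.Theory.
Import numFieldNormedType.Exports.

Local Open Scope classical_set_scope.
Local Open Scope ring_scope.

(* A point or vector (x_1, x_2, x_3) of R^3 is a row vector x with x_1 = x 0 0,
   x_2 = x 0 1, x_3 = x 0 2: the column indices live in 'I_3 = Z/3Z. *)
Notation "''R3[' R ]" := 'rV[R]_3 (at level 8, format "''R3[' R ]").

Definition vec3 (R : realType) (a b c : R) : 'R3[R] :=
  \row_(i < 3) [:: a; b; c]`_i.

Definition e3 (R : realType) : 'R3[R] := vec3 0 0 1.

Definition dot (R : realType) (v w : 'R3[R]) : R :=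
  \sum_(i < 3) v 0 i * w 0 i.

(* In cross and curl the index additions are modulo 3. *)
Definition cross (R : realType) (v w : 'R3[R]) : 'R3[R] :=
  \row_(i < 3) (v 0 (i + 1) * w 0 (i + 2) - v 0 (i + 2) * w 0 (i + 1)).

Definition partial (R : realType) (i : 'I_3) (f : 'R3[R] -> R) : 'R3[R] -> R :=
  'D_(delta_mx 0 i) f.

Definition iter_partial (R : realType) (s : seq 'I_3) (f : 'R3[R] -> R) :
  'R3[R] -> R := foldr (@partial R) f s.

Definition component (R : realType) (u : 'R3[R] -> 'R3[R]) (i : 'I_3) :
  'R3[R] -> R := fun x => u x 0 i.

Definition grad (R : realType) (f : 'R3[R] -> R) (x : 'R3[R]) : 'R3[R] :=
  \row_(i < 3) partial i f x.

Definition laplacian (R : realType) (f : 'R3[R] -> R) (x : 'R3[R]) : R :=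
  \sum_(j < 3) partial j (partial j f) x.

Definition vlaplacian (R : realType) (u : 'R3[R] -> 'R3[R]) (x : 'R3[R]) :
  'R3[R] := \row_(i < 3) laplacian (component u i) x.

Definition divergence (R : realType) (u : 'R3[R] -> 'R3[R]) (x : 'R3[R]) : R :=
  \sum_(i < 3) partial i (component u i) x.

Definition curl (R : realType) (u : 'R3[R] -> 'R3[R]) (x : 'R3[R]) : 'R3[R] :=
  \row_(i < 3) (partial (i + 1) (component u (i + 2)) x -
                partial (i + 2) (component u (i + 1)) x).

(* (v . grad) u *)
Definition convection (R : realType) (v u : 'R3[R] -> 'R3[R]) (x : 'R3[R]) :
  'R3[R] := \row_(i < 3) \sum_(j < 3) v x 0 j * partial j (component u i) x.

(* Euclidean (Frobenius) norm of the matrix of first derivatives; the norm of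
   'M[R]_n in the library is the maximum norm. *)
Definition grad_norm (R : realType) (u : 'R3[R] -> 'R3[R]) (x : 'R3[R]) : R :=
  Num.sqrt (\sum_(i < 3) \sum_(j < 3) partial j (component u i) x ^+ 2).

(* C^oo(closure A) for an open set A: f is continuous on the closure, its
   partial derivatives of all orders exist in A, and each of them extends
   continuously to the closure.  Derivatives are only taken at points of A, so
   the values of f outside the closure are irrelevant. *)
Definition smooth_up_to_boundary (R : realType) (A : set 'R3[R])
    (f : 'R3[R] -> R) : Prop :=
  {within closure A, continuous f} /\
  forall s : seq 'I_3,
    (forall x (i : 'I_3), A x ->
       derivable (iter_partial s f) x (delta_mx 0 i)) /\
    exists2 g : 'R3[R] -> R, {within closure A, continuous g} &
      forall x, A x -> g x = iter_partial s f x.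

Definition vsmooth_up_to_boundary (R : realType) (A : set 'R3[R])
    (u : 'R3[R] -> 'R3[R]) : Prop :=
  forall i, smooth_up_to_boundary A (component u i).

Definition cylinder (R : realType) : set 'R3[R] :=
  [set x | x 0 0 ^+ 2 + x 0 1 ^+ 2 < 1].

Definition cylinder_boundary (R : realType) : set 'R3[R] :=
  [set x | x 0 0 ^+ 2 + x 0 1 ^+ 2 = 1].

Definition outer_normal (R : realType) (x : 'R3[R]) : 'R3[R] :=
  vec3 (x 0 0) (x 0 1) 0.

Definition stationary_NS (R : realType) (A : set 'R3[R])
    (u : 'R3[R] -> 'R3[R]) (p : 'R3[R] -> R) : Prop :=
  forall x, A x ->
    convection u u x + grad p x - vlaplacian u x = 0 /\ divergence u x = 0.

(* The boundary value of curl u is its limit from inside the cylinder; that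
   of u is u itself, which is continuous on the closed cylinder. *)
Definition navier_hodge_lions (R : realType) (u : 'R3[R] -> 'R3[R]) : Prop :=
  forall x, cylinder_boundary x ->
    cross (curl u y) (outer_normal x) @[y --> within (@cylinder R) (nbhs x)]
      --> (0 : 'R3[R]) /\
    dot (u x) (outer_normal x) = 0.

Definition unit_disk (R : realType) : set (R * R) :=
  [set q | q.1 ^+ 2 + q.2 ^+ 2 < 1].

Definition flux (R : realType) (u : 'R3[R] -> 'R3[R]) (z : R) : R :=
  \int[(@lebesgue_measure R \x @lebesgue_measure R)%E]_(q in @unit_disk R)
    dot (u (vec3 q.1 q.2 z)) (e3 R).

(* Main.v *)
Require Import Defs.
From HB Require Import structures.
From mathcomp Require Import all_boot all_order all_algebra.
From mathcomp Require Import all_classical all_reals all_analysis.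
From mathcomp Require Import measurable_realfun ring lra.

Set Implicit Arguments.
Unset Strict Implicit.
Unset Printing Implicit Defensive.

Import Order.TTheory GRing.Theory Num.Theory.
Import numFieldNormedType.Exports.

Local Open Scope classical_set_scope.
Local Open Scope ring_scope.

(** The solution is compared with the uniform flow of the same flux. Let [a] be
    the mean of [u_3] over a cross-section, which is the same for all of them
    ([mean_axial_cst]), and [v = u - a e_3]. The claim is that [grad v = 0].

    Multiply the equation by [phi v], where [phi = (1 - (z/Z)^2)^2], and
    integrate over [|z| < Z]. Along the wall [v . n = 0], hence the tangential
    derivatives of [v . n] vanish too; together with the condition on the
    vorticity this turns the boundary integrand into [- phi |v_h|^2], which has
    the good sign ([boundary_work]). Only terms with a derivative of [phi] remain
    on the right ([weighted_energy]):

      [int phi |grad v|^2 <= int phi' v_3 q + (a/2 phi' + 1/2 phi'') |v|^2],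

    with [q = p + |v|^2/2]. Nothing is known about the size of the pressure, so
    [q] has to be replaced by its gradient. Since [v_3] has mean zero on each
    cross-section, it is the planar divergence of an explicit field [W] tangent
    to the circle ([weak_divergence]), and [int phi' v_3 q = - int phi' W . grad q].
    By the equation [grad q = Lap v - om x v - a d_3 v], where [om = curl v];
    one derivative of [Lap v = - curl om] is moved to [W], without a boundary
    term because [om_3 = 0] on the wall ([pressure_flux]). The field [W] is
    controlled by [v_3] ([inv_div_bound], [bogovskii_curl_bound]), and [v] by its
    gradient, thanks to the zero mean of [v_3] ([poincare_mean0]) and to
    [v . n = 0] for [v_h] ([poincare_tangent]). As [phi'] and [phi''] are of
    order [1/Z], the dissipation [D(Z) = int_{|z|<Z} |grad v|^2] satisfies

      [D(Z/2) <= (K/Z) (1 + |a| + sup_{|z|<Z} |v|) D(Z)]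

    ([half_scale_bound]), and [sup |v| <= 4 sup |grad v|] ([velocity_bound]) grows
    at most like [Z^beta]. Since [beta < 1] the factor tends to zero, so that eventually
    [D] gains a factor 16 whenever [Z] doubles; but [D(Z) <= c Z^3], whence
    [D = 0] ([sublinear_gradient_vanishes]). Thus [u] is constant, and axial
    because it is tangent to the wall in two directions ([velocity_axial]); the
    area of the disk then identifies the constant ([flux_cst]).

    The computation takes place in polar coordinates [(r, t, z)], where every
    integral is an iterated integral of a continuous function of one variable
    and the divergence theorem reduces to the fundamental theorem of calculus
    and periodicity. The derivatives of [u] and [p], extended to the closed
    cylinder, are pulled back to functions of [(r, t, z)] ([C1_pullback]). *)

(** * Continuity of explicit formulas *)

Section ContinuousFormulas.
Context {S T U V W : topologicalType}.

Lemma continuous_pair (f : S -> T) (g : S -> U) :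
  continuous f -> continuous g -> continuous (fun x => (f x, g x)).
Proof. move=> cf cg x; exact: (cvg_pair (cf x) (cg x)). Qed.

Lemma continuous_comp1 (f : T -> U) (a : S -> T) :
  continuous f -> continuous a -> continuous (fun x => f (a x)).
Proof. by move=> cf ca x; exact: (continuous_comp (ca x) (cf _)). Qed.

Lemma continuous_fst (f : S -> T * U) :
  continuous f -> continuous (fun x => (f x).1).
Proof. by move=> cf x; apply: (continuous_comp (cf x)); exact: cvg_fst. Qed.

Lemma continuous_snd (f : S -> T * U) :
  continuous f -> continuous (fun x => (f x).2).
Proof. by move=> cf x; apply: (continuous_comp (cf x)); exact: cvg_snd. Qed.

Lemma continuous_cst (c : T) : continuous (fun _ : S => c).
Proof. by move=> x; exact: cvg_cst. Qed.

Lemma continuous_idfun : continuous (fun x : S => x).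
Proof. by move=> x; exact: cvg_id. Qed.

End ContinuousFormulas.

Lemma continuous_comp2 (S T U V : topologicalType) (f : T -> U -> V)
    (a : S -> T) (b : S -> U) :
  continuous (fun q : T * U => f q.1 q.2) -> continuous a -> continuous b ->
  continuous (fun x => f (a x) (b x)).
Proof.
by move=> cf ca cb; exact: (continuous_comp1 cf (continuous_pair ca cb)).
Qed.

Lemma continuous_comp3 (S T U V W : topologicalType) (f : T -> U -> V -> W)
    (a : S -> T) (b : S -> U) (c : S -> V) :
  continuous (fun q : T * U * V => f q.1.1 q.1.2 q.2) ->
  continuous a -> continuous b -> continuous c ->
  continuous (fun x => f (a x) (b x) (c x)).
Proof.
move=> cf ca cb cc.
exact: (continuous_comp1 cf (continuous_pair (continuous_pair ca cb) cc)).
Qed.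

Section ContinuousAlgebra.
Context {R : realType} {S : topologicalType}.
Implicit Types f g : S -> R.

Lemma continuous_add f g :
  continuous f -> continuous g -> continuous (fun x => f x + g x).
Proof. by move=> cf cg x; apply: cvgD; [exact: cf|exact: cg]. Qed.

Lemma continuous_opp f : continuous f -> continuous (fun x => - f x).
Proof. by move=> cf x; apply: cvgN; exact: cf. Qed.

Lemma continuous_mul f g :
  continuous f -> continuous g -> continuous (fun x => f x * g x).
Proof. by move=> cf cg x; apply: cvgM; [exact: cf|exact: cg]. Qed.

Lemma continuous_exp f n : continuous f -> continuous (fun x => f x ^+ n).
Proof.
move=> cf; elim: n => [|n IH].
  by under eq_fun do rewrite expr0; exact: continuous_cst.
by under eq_fun do rewrite exprS; exact: continuous_mul.
Qed.

End ContinuousAlgebra.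

(* The match is on the shape of the body: unification up to conversion would
   unfold integrals and trigonometric functions. *)
Ltac cont := repeat match goal with
  | H : forall x, continuous_at x ?f |- forall x, continuous_at x ?g =>
      constr_eq f g; exact H
  | |- forall x, continuous_at x (fun y => ?f y) => match goal with
      H : forall x, continuous_at x ?g |- _ => constr_eq f g; exact H end
  | |- forall x, continuous_at x (fun y => y) => exact: continuous_idfun
  | |- forall x, continuous_at x (fun y => ?c) => refine (@continuous_cst _ _ c)
  | |- forall x, continuous_at x (fun y => (@?f y).1) => apply: continuous_fst
  | |- forall x, continuous_at x (fun y => (@?f y).2) => apply: continuous_snd
  | |- forall x, continuous_at x (fun y => (@?f y, @?g y)) =>
      apply: continuous_pair
  | |- forall x, continuous_at x (fun y => @?f y + @?g y) =>
      apply: continuous_add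
  | |- forall x, continuous_at x (fun y => - @?f y) => apply: continuous_opp
  | |- forall x, continuous_at x (fun y => @?f y * @?g y) =>
      apply: continuous_mul
  | |- forall x, continuous_at x (fun y => @?f y ^+ _) => apply: continuous_exp
  | |- forall x, continuous_at x ( *%R ?b) =>
      apply: (continuous_mul (f := fun=> b) (g := fun y => y))
  | |- forall x, continuous_at x (+%R ?b) =>
      apply: (continuous_add (f := fun=> b) (g := fun y => y))
  | |- forall x, continuous_at x -%R => apply: (continuous_opp (f := fun y => y))
  | |- forall x, continuous_at x fst => apply: (continuous_fst (f := fun y => y))
  | |- forall x, continuous_at x snd => apply: (continuous_snd (f := fun y => y))
  end.

(** * Integrals of continuous functions *)

Section Integral.
Context {R : realType}.
Notation mu := (@lebesgue_measure R).
Implicit Types (f g F : R -> R) (a b c d x y s t : R).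

(** The integral is oriented, and rescaled to [[0, 1]] so that the endpoints are
    parameters like any other: continuity in them needs no separate argument. *)
Definition int01 f : R := \int[mu]_(t in `[0, 1]) f t.
Definition intg a b f : R := (b - a) * int01 (fun t => f (a + (b - a) * t)).

Lemma continuous_int01_integrable f :
  continuous f -> mu.-integrable `[0, 1] (EFin \o f).
Proof.
move=> cf; apply: continuous_compact_integrable; first exact: segment_compact.
exact: continuous_subspaceT.
Qed.

Lemma int01D f g : continuous f -> continuous g ->
  int01 (fun t => f t + g t) = int01 f + int01 g.
Proof.
by move=> cf cg; rewrite /int01 RintegralD//; exact: continuous_int01_integrable.
Qed.

Lemma int01Z k f : continuous f -> int01 (fun t => k * f t) = k * int01 f.
Proof.
by move=> cf; rewrite /int01 RintegralZl//; exact: continuous_int01_integrable.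
Qed.

Lemma eq_int01 f g : (forall t, 0 <= t <= 1 -> f t = g t) -> int01 f = int01 g.
Proof.
by move=> fg; apply: eq_Rintegral => t; rewrite inE/= in_itv/= => /fg.
Qed.

Lemma int01_ge0 f : (forall t, 0 <= t <= 1 -> 0 <= f t) -> 0 <= int01 f.
Proof. by move=> f0; apply: Rintegral_ge0 => t; rewrite /= in_itv/= => /f0. Qed.

Lemma continuous_affine a b : continuous (fun t : R => a + b * t).
Proof. by cont. Qed.

Lemma continuous_comp_affine f a b : continuous f ->
  continuous (fun t => f (a + b * t)).
Proof. by move=> cf; apply: (continuous_comp1 cf); exact: continuous_affine. Qed.

Lemma intD a b f g : continuous f -> continuous g ->
  intg a b (fun t => f t + g t) = intg a b f + intg a b g.
Proof.
by move=> cf cg; rewrite /intg -mulrDr -int01D//; exact: continuous_comp_affine.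
Qed.

Lemma intZ a b k f : continuous f -> intg a b (fun t => k * f t) = k * intg a b f.
Proof.
move=> cf; rewrite /intg (int01Z k (f := fun t => f (a + (b - a) * t))) 1?mulrCA//.
exact: continuous_comp_affine.
Qed.

Lemma affine_itv a b t : a <= b -> 0 <= t <= 1 -> a <= a + (b - a) * t <= b.
Proof. by move=> ab /andP[t0 t1]; apply/andP; split; nra. Qed.

Lemma eq_int a b f g : a <= b -> (forall t, a <= t <= b -> f t = g t) ->
  intg a b f = intg a b g.
Proof.
move=> ab fg; congr (_ * _); apply: eq_int01 => t t01.
by apply: fg; exact: affine_itv.
Qed.

Lemma int_ge0 a b f : a <= b -> (forall t, a <= t <= b -> 0 <= f t) ->
  0 <= intg a b f.
Proof.
move=> ab f0; apply: mulr_ge0; first by rewrite subr_ge0.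
by apply: int01_ge0 => t t01; apply: f0; exact: affine_itv.
Qed.

Lemma intB a b f g : continuous f -> continuous g ->
  intg a b (fun t => f t - g t) = intg a b f - intg a b g.
Proof.
move=> cf cg; rewrite -[- intg a b g]mulN1r -intZ// -intD//; last first.
  by move=> x; apply: cvgM; [exact: cvg_cst|exact: cg].
by congr (intg a b _); apply/funext => t; rewrite mulN1r.
Qed.

Lemma le_int a b f g : a <= b -> continuous f -> continuous g ->
  (forall t, a <= t <= b -> f t <= g t) -> intg a b f <= intg a b g.
Proof.
move=> ab cf cg fg; rewrite -subr_ge0 -intB//.
by apply: int_ge0 => // t /fg; rewrite subr_ge0.
Qed.

Lemma int_cst a b k : intg a b (fun=> k) = (b - a) * k.
Proof.
rewrite /intg /int01 Rintegral_cst//= lebesgue_measure_itv/= lte_fin ltr01.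
by rewrite -EFinB/= subr0 mulr1.
Qed.

Lemma intxx a f : intg a a f = 0.
Proof. by rewrite /intg subrr mul0r. Qed.

Lemma int01_FTC2 f F : continuous f ->
  (forall x, 0 <= x <= 1 -> {for x, continuous F}) ->
  (forall x, 0 < x < 1 -> is_derive x 1 F (f x)) -> int01 f = F 1 - F 0.
Proof.
move=> cf cF dF; rewrite /int01 /Rintegral.
rewrite (@continuous_FTC2 R f F 0 1)//.
- exact: continuous_subspaceT.
- split.
  + by move=> x; rewrite in_itv/= => /dF[].
  + by apply: cvg_at_right_filter; apply: cF; rewrite lexx ler01.
  + by apply: cvg_at_left_filter; apply: cF; rewrite lexx ler01.
- by move=> x; rewrite in_itv/= => /dF H; rewrite derive1E derive_val.
Qed.

Lemma is_derive_affine a b t : is_derive t (1 : R) (fun t => a + b * t) b.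
Proof.
by apply: is_derive_eq; rewrite add0r mul1r; exact: mulr1.
Qed.

Lemma is_derive_comp_affine F a b t d : is_derive (a + b * t) 1 F d ->
  is_derive t 1 (fun t => F (a + b * t)) (b * d).
Proof.
move=> dF; have da := is_derive_affine a b t.
have := @is_derive1_comp R F (fun t => a + b * t) t d b dF da.
by rewrite mulrC.
Qed.

Lemma is_derive_continuous F x d : is_derive x 1 F d -> {for x, continuous F}.
Proof.
by move=> [dF _]; apply: differentiable_continuous; exact/derivable1_diffP.
Qed.

(** Hypotheses are only made at the points of the segment from [a] to [b],
    described without knowing which endpoint is larger. *)
Lemma int_FTC2_aux a b f F : continuous f ->
  (forall t, 0 <= t <= 1 -> {for a + (b - a) * t, continuous F}) ->
  (forall t, 0 < t < 1 ->
    is_derive (a + (b - a) * t) 1 F (f (a + (b - a) * t))) ->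
  intg a b f = F b - F a.
Proof.
move=> cf cF dF.
rewrite /intg -(int01Z _ (f := fun t => f (a + (b - a) * t))); last first.
  exact: continuous_comp_affine.
rewrite -[in RHS](_ : a + (b - a) * 1 = b); last by ring.
rewrite -[X in _ - F X](_ : a + (b - a) * 0 = a); last by ring.
apply: (@int01_FTC2 _ (fun t => F (a + (b - a) * t))).
- move=> x; apply: cvgM; first exact: cvg_cst.
  exact: continuous_comp_affine.
- move=> x x01; apply: (@continuous_comp _ _ _ (fun t => a + (b - a) * t) F).
    exact: continuous_affine.
  exact: cF.
- by move=> x x01; apply: is_derive_comp_affine; exact: dF.
Qed.

Lemma int_FTC2 a b f F : a <= b -> continuous f ->
  (forall x, a <= x <= b -> {for x, continuous F}) ->
  (forall x, a < x < b -> is_derive x 1 F (f x)) -> intg a b f = F b - F a.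
Proof.
rewrite le_eqVlt => /predU1P[<-|ab] cf cF dF; first by rewrite intxx subrr.
apply: int_FTC2_aux => // t /andP[t0 t1].
- by apply: cF; apply/andP; split; nra.
- by apply: dF; apply/andP; split; nra.
Qed.

(** A form without order between [a] and [b], for primitives that are only
    available on a half-line. *)
Lemma int_FTC2_gt M a b f F : continuous f -> M < a -> M < b ->
  (forall x, M < x -> is_derive x 1 F (f x)) -> intg a b f = F b - F a.
Proof.
move=> cf Ma Mb dF.
have H t : 0 <= t <= 1 -> M < a + (b - a) * t.
  move=> /andP[t0]; rewrite le_eqVlt => /predU1P[->|t1]; first by lra.
  have : 0 < (1 - t) * (a - M) by apply: mulr_gt0; lra.
  have : 0 <= t * (b - M) by apply: mulr_ge0; lra.
  lra.
apply: int_FTC2_aux => // t t01.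
  by apply: is_derive_continuous; apply: dF; exact: H.
by apply: dF; apply: H; lra.
Qed.

Lemma int_FTC2T a b f F : continuous f ->
  (forall x, is_derive x 1 F (f x)) -> intg a b f = F b - F a.
Proof.
move=> cf dF; apply: (@int_FTC2_gt (Num.min a b - 1)) => //.
  by have := ge_min a a b; rewrite lexx/= => H; lra.
by have := ge_min b a b; rewrite lexx orbT/= => H; lra.
Qed.

Lemma primitive_exists f M : continuous f ->
  exists F, forall x, M < x -> is_derive x 1 F (f x).
Proof.
move=> cf; exists (fun x => \int[mu]_(t in `[M, x]) f t) => x Mx.
have [||d e] := @continuous_FTC1_closed R f M x (x + 1) _ _ Mx (cf x).
- by rewrite ltrDl.
- apply: continuous_compact_integrable; first exact: segment_compact.
  exact: continuous_subspaceT.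
- by apply: DeriveDef; [exact: d|rewrite -derive1E].
Qed.

(** Additivity holds in every order of the endpoints, by a common primitive. *)
Lemma int_cat a b c f : continuous f -> intg a b f + intg b c f = intg a c f.
Proof.
move=> cf; pose M := - (`|a| + `|b| + `|c|) - 1.
have [F dF] := primitive_exists M cf.
have NM x : - `|x| <= x by rewrite lerNl -normrN ler_norm.
have [[Ha Hb] Hc] := (NM a, NM b, NM c).
have [[a0 b0] c0] := (normr_ge0 a, normr_ge0 b, normr_ge0 c).
have Ma : M < a by rewrite /M; lra.
have Mb : M < b by rewrite /M; lra.
have Mc : M < c by rewrite /M; lra.
rewrite (int_FTC2_gt cf Ma Mb dF) (int_FTC2_gt cf Mb Mc dF).
by rewrite (int_FTC2_gt cf Ma Mc dF); ring.
Qed.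

Lemma int01E f : int01 f = intg 0 1 f.
Proof.
by rewrite /intg subr0 mul1r; congr int01; apply/funext => t; rewrite add0r mul1r.
Qed.

Lemma int_affine a b f : intg a b f = (b - a) * intg 0 1 (fun t => f (a + (b - a) * t)).
Proof. by rewrite -int01E. Qed.

Lemma continuous_int01 (T : topologicalType) (f : T -> R -> R) :
  continuous (fun q : T * R => f q.1 q.2) -> continuous (fun p => int01 (f p)).
Proof.
move=> cf p0.
have cfp p : continuous (f p) by apply: (continuous_comp2 cf); cont.
apply/cvgrPdist_le => e e0.
have /compact_near_coveringP cpt := @segment_compact R 0 1.
have : \forall p \near p0,
    `[0, 1]%classic `<=` (fun t => `|f p0 t - f p t| <= e).
  apply: (cpt T (nbhs p0) (fun p t => `|f p0 t - f p t| <= e)) => t _.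
  have c1 : continuous (fun q : R * T => f p0 q.1 - f q.2 q.1).
    apply: continuous_add; first by apply: (continuous_comp1 (cfp p0)); cont.
    by apply: continuous_opp; apply: (continuous_comp2 cf); cont.
  have := c1 (t, p0); rewrite /continuous_at/= subrr => /cvgr0Pnorm_le/(_ e e0).
  exact.
apply: filterS => p H.
have cd : continuous (fun t => f p0 t - f p t) by cont; exact: cfp.
have -> : int01 (f p0) - int01 (f p) = intg 0 1 (fun t => f p0 t - f p t).
  by rewrite intB// -!int01E.
rewrite ler_norml; apply/andP; split.
  rewrite (_ : - e = intg 0 1 (fun=> - e)); last by rewrite int_cst; ring.
  apply: le_int => // [|t t01]; first exact: continuous_cst.
  by have := H t; rewrite /= in_itv/= => /(_ t01); rewrite ler_norml => /andP[].
rewrite (_ : e = intg 0 1 (fun=> e)); last by rewrite int_cst; ring.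
apply: le_int => // [|t t01]; first exact: continuous_cst.
by have := H t; rewrite /= in_itv/= => /(_ t01); rewrite ler_norml => /andP[].
Qed.

Lemma continuous_int (T : topologicalType) (f : T -> R -> R) (a b : T -> R) :
  continuous (fun q : T * R => f q.1 q.2) -> continuous a -> continuous b ->
  continuous (fun p => intg (a p) (b p) (f p)).
Proof.
move=> cf ca cb; apply: continuous_mul; first by cont.
apply: (continuous_int01 (f := fun p t => f p (a p + (b p - a p) * t))).
apply: (continuous_comp2 (a := fun q => q.1)
  (b := fun q : T * R => a q.1 + (b q.1 - a q.1) * q.2) cf); first by cont.
have ca1 : continuous (fun q : T * R => a q.1) by apply: continuous_comp1; cont.
have cb1 : continuous (fun q : T * R => b q.1) by apply: continuous_comp1; cont.
by cont.
Qed.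

(** Hadamard's form of differentiability: increments that are multiples of a
    continuous factor. All derivatives of integrals below are read off from
    such a factorization. *)
Lemma is_derive_of_factor F g x : (forall z, F z - F x = g z * (z - x)) ->
  continuous g -> is_derive x 1 F (g x).
Proof.
by move=> H c; apply/is_derive1_caratheodory; exists g; split=> //; exact: c.
Qed.

Lemma int01_pt (T : Type) (f : R -> T -> R) x (p : T) :
  int01 (fun t => f (x + (x - x) * t) p) = f x p.
Proof.
by under [X in int01 X]eq_fun do rewrite subrr mul0r addr0; rewrite int01E int_cst; ring.
Qed.

Lemma int_FTC1 a f x : continuous f -> is_derive x 1 (fun x => intg a x f) (f x).
Proof.
move=> cf; pose g z := int01 (fun t => f (x + (z - x) * t)).
have cg : continuous g.
  apply: (continuous_int01 (f := fun z t => f (x + (z - x) * t))).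
  by apply: continuous_comp1; cont.
have <- : g x = f x by exact: (int01_pt (fun x _ => f x) x tt).
apply: is_derive_of_factor => //.
by move=> z; rewrite -(@int_cat a x z)// [LHS]addrC addKr /intg mulrC.
Qed.

(** Differentiation under the integral sign: the increment of [f s] is the factor
    [z - y] times a mean of [k s], which is continuous in [z] and [s] jointly. *)
Lemma is_derive_int (f k : R -> R -> R) a b y :
  continuous (fun q : R * R => f q.1 q.2) ->
  continuous (fun q : R * R => k q.1 q.2) ->
  (forall s y, is_derive y 1 (f s) (k s y)) ->
  is_derive y 1 (fun y => intg a b (f ^~ y)) (intg a b (k ^~ y)).
Proof.
move=> cf ck dk.
pose h z s := int01 (fun t => k s (y + (z - y) * t)).
have ch : continuous (fun q : R * R => h q.1 q.2).
  apply: (continuous_int01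
    (f := fun (q : R * R) t => k q.2 (y + (q.1 - y) * t))).
  by apply: (continuous_comp2 ck); cont.
have cf1 z : continuous (f ^~ z) by apply: (continuous_comp2 cf); cont.
have ck2 s : continuous (k s) by apply: (continuous_comp2 ck); cont.
have <- : h y = k ^~ y.
  by apply/funext => s; rewrite -[RHS](int01_pt (fun x s => k s x)).
apply: (is_derive_of_factor (g := fun z => intg a b (h z))).
  move=> z; rewrite -intB// mulrC -intZ; last first.
    by apply: (continuous_comp2 ch); cont.
  congr (intg a b _); apply/funext => s.
  by rewrite -(@int_FTC2T y z (k s)).
by apply: continuous_int => //; exact: continuous_cst.
Qed.

(** Fubini for continuous functions: both sides, as functions of [b], vanish at
    [a] and have the same derivative. *)
Lemma int_swap (f : R -> R -> R) a b c d :
  continuous (fun q : R * R => f q.1 q.2) ->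
  intg a b (fun s => intg c d (f s)) = intg c d (fun t => intg a b (f ^~ t)).
Proof.
move=> cf; pose K x := intg c d (fun t => intg a x (f ^~ t)).
have dK x : is_derive x 1 K (intg c d (f x)).
  apply: (@is_derive_int (fun t x => intg a x (f ^~ t)) (fun t x => f x t)).
  - apply: (continuous_int (f := fun (q : R * R) s => f s q.1)
      (a := fun=> a) (b := snd)); last by move=> q; exact: cvg_snd.
      by apply: (continuous_comp2 cf); cont.
    exact: continuous_cst.
  - by apply: (continuous_comp2 cf); cont.
  - by move=> s y; apply: int_FTC1; apply: (continuous_comp2 cf); cont.
rewrite (@int_FTC2T _ _ _ K)//; last first.
  by apply: continuous_int => //; exact: continuous_cst.
rewrite /K; under [X in _ - intg _ _ X]eq_fun do rewrite intxx.
by rewrite int_cst mulr0 subr0.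
Qed.

(** The primitive [x |-> int_a^x f] is nondecreasing between two zeros. *)
Lemma int_eq0 a b f : a < b -> continuous f -> (forall t, a <= t <= b -> 0 <= f t) ->
  intg a b f = 0 -> forall t, a < t < b -> f t = 0.
Proof.
move=> ab cf f0 if0.
have I0 x : a <= x <= b -> intg a x f = 0.
  move=> /andP[ax xb]; apply/eqP; rewrite eq_le; apply/andP; split; last first.
    by apply: int_ge0 => // t /andP[? tx]; apply: f0; lra.
  rewrite -if0 -(@int_cat a x b)// lerDl.
  by apply: int_ge0 => // t /andP[? tx]; apply: f0; lra.
move=> t /andP[a_t tb].
have d1 := int_FTC1 a t cf.
have d2 : is_derive t 1 (fun x => intg a x f) 0.
  apply: (near_eq_is_derive (f := cst 0)).
  near=> x; rewrite I0//; apply/andP; split; apply: ltW; near: x.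
    exact: lt_nbhsr.
  exact: lt_nbhsl.
by rewrite -(@derive_val _ _ _ _ _ _ _ d1) (@derive_val _ _ _ _ _ _ _ d2).
Unshelve. all: by end_near.
Qed.

End Integral.

(* Conversion must not see through the integral down to measure theory. *)
Global Opaque intg int01.

Section DeriveFormulas.
Context {R : realType}.
Implicit Types (f g : R -> R) (x a b d k : R).

Lemma derive_eq f x a b : is_derive x 1 f a -> a = b -> is_derive x 1 f b.
Proof. by move=> + <-. Qed.

Lemma is_derive_unique f x a b :
  is_derive x 1 f a -> is_derive x 1 f b -> a = b.
Proof.
by move=> df dg; rewrite -(@derive_val _ _ _ _ _ _ _ df) (@derive_val _ _ _ _ _ _ _ dg).
Qed.

End DeriveFormulas.

(* Differentiates a formula by instance search, then compares by [ring]. *)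
Ltac deriv := apply: derive_eq; rewrite /GRing.scale/=; ring.

Section Weighted.
Context {R : realType}.
Implicit Types (f g w : R -> R) (a b : R).

(** Cauchy-Schwarz with a weight, from the sign of the integral of
    [w (f - l g)^2] for every real [l]. *)
Lemma int_cauchy_schwarz a b w f g : a <= b ->
  continuous w -> continuous f -> continuous g ->
  (forall t, a <= t <= b -> 0 <= w t) ->
  intg a b (fun t => w t * (f t * g t)) ^+ 2 <=
  intg a b (fun t => w t * f t ^+ 2) * intg a b (fun t => w t * g t ^+ 2).
Proof.
move=> ab cw cf cg w0.
set B := intg a b (fun t => w t * (f t * g t)).
set A := intg a b (fun t => w t * f t ^+ 2).
set D := intg a b (fun t => w t * g t ^+ 2).
have Q l : 0 <= A + ((- (2 * l)) * B + l ^+ 2 * D).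
  have cA : continuous (fun t => w t * f t ^+ 2) by cont.
  have cB : continuous (fun t => w t * (f t * g t)) by cont.
  have cD : continuous (fun t => w t * g t ^+ 2) by cont.
  have cBl : continuous (fun t => - (2 * l) * (w t * (f t * g t))) by cont.
  have cDl : continuous (fun t => l ^+ 2 * (w t * g t ^+ 2)) by cont.
  rewrite -(intZ a b (- (2 * l)) cB) -(intZ a b (l ^+ 2) cD) -(intD a b cBl cDl).
  rewrite -(intD a b cA (continuous_add cBl cDl)).
  apply: int_ge0 => // t t01.
  rewrite (_ : _ + _ = w t * (f t - l * g t) ^+ 2); last by ring.
  by apply: mulr_ge0; [exact: w0|exact: sqr_ge0].
have D0 : 0 <= D.
  by apply: int_ge0 => // t t01; apply: mulr_ge0; [exact: w0|exact: sqr_ge0].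
have [D00|Dn0] := eqVneq D 0.
  have [->|Bn0] := eqVneq B 0; first by rewrite expr0n/= D00 mulr0.
  have := Q ((A + 1) / (2 * B)).
  rewrite D00 mulr0 addr0 (_ : - _ * B = - (A + 1)); last by field.
  lra.
have := Q (B / D).
rewrite (_ : _ + _ = A - B ^+ 2 / D); last by field.
by rewrite subr_ge0 ler_pdivrMr// lt_def Dn0.
Qed.

Lemma int_sqr_le a b w f : a <= b -> continuous w -> continuous f ->
  (forall t, a <= t <= b -> 0 <= w t) ->
  intg a b (fun t => w t * f t) ^+ 2 <=
  intg a b w * intg a b (fun t => w t * f t ^+ 2).
Proof.
move=> ab cw cf w0.
have c1 : continuous (fun _ : R => 1 : R) by exact: continuous_cst.
have := int_cauchy_schwarz ab cw c1 cf w0.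
rewrite (_ : (fun t => w t * (1 * f t)) = (fun t => w t * f t)); last first.
  by apply/funext => t; rewrite mul1r.
rewrite (_ : (fun t => w t * 1 ^+ 2) = w)//.
by apply/funext => t; rewrite expr1n mulr1.
Qed.

End Weighted.

(** * Polar calculus *)

Section Polar.
Context {R : realType}.
Notation tau := (2 * pi : R).
Notation fun3 := (R -> R -> R -> R).
Implicit Types (f g h X Y : fun3) (r t z k : R).

(** Fields are functions of the clamped radius, hence continuous on all of
    [R^3]; no domain has to be carried along in continuity statements. *)
Definition clamp01 (r : R) : R := Num.max 0 (Num.min r 1).

Lemma continuous_clamp01 : continuous clamp01.
Proof.
move=> x; apply: (@continuous_max R _ (cst 0) (fun r => Num.min r 1)).
  exact: cvg_cst.
by apply: (@continuous_min R _ id (cst 1)); [exact: cvg_id|exact: cvg_cst].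
Qed.

Lemma clamp01_id r : 0 <= r <= 1 -> clamp01 r = r.
Proof. by move=> /andP[r0 r1]; rewrite /clamp01 (min_idPl r1) (max_idPr r0). Qed.

Lemma clamp01_itv r : 0 <= clamp01 r <= 1.
Proof.
rewrite /clamp01 le_max lexx/= ge_max ler01/=.
by rewrite ge_min lexx orbT.
Qed.

Lemma clamp01_ge1 r : 1 <= r -> clamp01 r = 1.
Proof. by move=> r1; rewrite /clamp01 (min_idPr r1) (max_idPr ler01). Qed.

Lemma is_derive_clamp01 r : 0 < r < 1 -> is_derive r 1 clamp01 1.
Proof.
move=> /andP[r0 r1]; apply: (near_eq_is_derive (f := id)).
near=> x; rewrite clamp01_id//; apply/andP; split; apply: ltW; near: x.
  exact: lt_nbhsr.
exact: lt_nbhsl.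
Unshelve. all: by end_near.
Qed.

Definition C0 f := continuous (fun q : R * R * R => f q.1.1 q.1.2 q.2).

Lemma C0_comp (S : topologicalType) f (a b c : S -> R) : C0 f ->
  continuous a -> continuous b -> continuous c ->
  continuous (fun x => f (a x) (b x) (c x)).
Proof. exact: continuous_comp3. Qed.

(** [X1], [X2], [X3] are the Cartesian derivatives of [X], written in polar
    coordinates. The radial derivative is asked for only where the clamped radius
    is differentiable; in [t] and [z] the formulas persist along the wall. *)
Record C1 X X1 X2 X3 : Prop := {
  C1_C0 : C0 X ; C1_C0x : C0 X1 ; C1_C0y : C0 X2 ; C1_C0z : C0 X3 ;
  C1_r : forall r t z, 0 < r < 1 ->
    is_derive r 1 (fun r => X r t z) (cos t * X1 r t z + sin t * X2 r t z) ;
  C1_t : forall r t z, is_derive t 1 (fun t => X r t z)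
    (clamp01 r * (cos t * X2 r t z - sin t * X1 r t z)) ;
  C1_z : forall r t z, is_derive z 1 (X r t) (X3 r t z) ;
  C1_tau : forall r z, X r tau z = X r 0 z }.

Lemma C0_add f g : C0 f -> C0 g -> C0 (fun r t z => f r t z + g r t z).
Proof. exact: continuous_add. Qed.
Lemma C0_mul f g : C0 f -> C0 g -> C0 (fun r t z => f r t z * g r t z).
Proof. exact: continuous_mul. Qed.
Lemma C0_opp f : C0 f -> C0 (fun r t z => - f r t z).
Proof. exact: continuous_opp. Qed.
Lemma C0_exp f n : C0 f -> C0 (fun r t z => f r t z ^+ n).
Proof. exact: continuous_exp. Qed.
Lemma C0_cst k : C0 (fun _ _ _ => k).
Proof. exact: continuous_cst. Qed.
Lemma C0_fr (a : R -> R) : continuous a -> C0 (fun r _ _ => a r).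
Proof. by move=> ca; rewrite /C0; apply: continuous_comp1 => //; cont. Qed.
Lemma C0_ft (a : R -> R) : continuous a -> C0 (fun _ t _ => a t).
Proof. by move=> ca; rewrite /C0; apply: continuous_comp1 => //; cont. Qed.
Lemma C0_fz (a : R -> R) : continuous a -> C0 (fun _ _ z => a z).
Proof. by move=> ca; rewrite /C0; apply: continuous_comp1 => //; cont. Qed.

End Polar.

(* As with [cont], the match is on the shape of the body. *)
Ltac c0 := repeat match goal with
  | |- C0 (fun r t z => ?k) => refine (@C0_cst _ k)
  | |- C0 (fun r t z => @?a r) => refine (@C0_fr _ a _)
  | |- C0 (fun r t z => @?a t) => refine (@C0_ft _ a _)
  | |- C0 (fun r t z => @?a z) => refine (@C0_fz _ a _)
  | |- C0 (fun r t z => @?f r t z + @?g r t z) => refine (@C0_add _ f g _ _)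
  | |- C0 (fun r t z => @?f r t z * @?g r t z) => refine (@C0_mul _ f g _ _)
  | |- C0 (fun r t z => - @?f r t z) => refine (@C0_opp _ f _)
  | |- C0 (fun r t z => @?f r t z ^+ ?n) => refine (@C0_exp _ f n _)
  | |- C0 (fun r t z => ?X r t z) =>
      match goal with H : C0 ?Y |- _ => constr_eq X Y; exact H end
  | H : C0 ?X |- C0 ?Y => constr_eq X Y; exact H
  | |- forall x, continuous_at x (fun y => cos y) => exact: continuous_cos
  | |- forall x, continuous_at x (fun y => sin y) => exact: continuous_sin
  | |- forall x, continuous_at x (fun y => clamp01 y) => exact: continuous_clamp01
  | |- forall x, continuous_at x cos => exact: continuous_cos
  | |- forall x, continuous_at x sin => exact: continuous_sin
  | |- forall x, continuous_at x clamp01 => exact: continuous_clamp01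
  | |- forall x, continuous_at x _ => progress cont
  end.

Section Slice.
Context {R : realType}.
Notation tau := (2 * pi : R).
Notation fun3 := (R -> R -> R -> R).
Implicit Types (f g h X Y : fun3) (r t z k Z : R).

(** The Jacobian [r] is left to the integrand. *)
Definition slice f z := intg 0 1 (fun r => intg 0 tau (fun t => f r t z)).
Definition vol Z f := intg (- Z) Z (slice f).

Lemma tau_gt0 : 0 < tau.
Proof. by apply: mulr_gt0 => //; exact: pi_gt0. Qed.

Lemma tau_ge0 : 0 <= tau.
Proof. exact/ltW/tau_gt0. Qed.

Lemma C0_r f t z : C0 f -> continuous (fun r => f r t z).
Proof. by move=> cf; apply: (C0_comp cf); cont. Qed.
Lemma C0_t f r z : C0 f -> continuous (fun t => f r t z).
Proof. by move=> cf; apply: (C0_comp cf); cont. Qed.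
Lemma C0_z f r t : C0 f -> continuous (fun z => f r t z).
Proof. by move=> cf; apply: (C0_comp cf); cont. Qed.
Lemma C0_rt f z : C0 f -> continuous (fun q : R * R => f q.1 q.2 z).
Proof. by move=> cf; apply: (C0_comp cf); cont. Qed.

Lemma continuous_ring f : C0 f ->
  continuous (fun q : R * R => intg 0 tau (fun t => f q.1 t q.2)).
Proof.
move=> cf; apply: (continuous_int (f := fun (q : R * R) t => f q.1 t q.2)).
- by apply: (C0_comp cf); cont.
- exact: continuous_cst.
- exact: continuous_cst.
Qed.

Lemma continuous_ring_r f z : C0 f ->
  continuous (fun r => intg 0 tau (fun t => f r t z)).
Proof.
move=> cf; apply: (continuous_comp2
  (f := fun r z => intg 0 tau (fun t => f r t z)) (continuous_ring cf)); cont.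
Qed.

Lemma continuous_slice f : C0 f -> continuous (slice f).
Proof.
move=> cf.
apply: (continuous_int (f := fun z r => intg 0 tau (fun t => f r t z))).
- apply: (continuous_comp2 (f := fun r z => intg 0 tau (fun t => f r t z))
    (continuous_ring cf)); cont.
- exact: continuous_cst.
- exact: continuous_cst.
Qed.

Lemma eq_slice f g z :
  (forall r t, 0 <= r <= 1 -> 0 <= t <= tau -> f r t z = g r t z) ->
  slice f z = slice g z.
Proof.
move=> fg; apply: eq_int => // r r01; apply: eq_int; first exact: tau_ge0.
by move=> t t01; exact: fg.
Qed.

Lemma sliceD f g z : C0 f -> C0 g ->
  slice (fun r t z => f r t z + g r t z) z = slice f z + slice g z.
Proof.
move=> cf cg; rewrite /slice -intD; [|exact: continuous_ring_r..].
by congr (intg 0 1 _); apply/funext => r; rewrite intD//; exact: C0_t.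
Qed.

Lemma sliceZ k f z : C0 f -> slice (fun r t z => k * f r t z) z = k * slice f z.
Proof.
move=> cf; rewrite /slice -intZ; last exact: continuous_ring_r.
by congr (intg 0 1 _); apply/funext => r; rewrite intZ//; exact: C0_t.
Qed.

Lemma slice_ge0 f z :
  (forall r t, 0 <= r <= 1 -> 0 <= t <= tau -> 0 <= f r t z) -> 0 <= slice f z.
Proof.
move=> f0; apply: int_ge0 => // r r01; apply: int_ge0; first exact: tau_ge0.
by move=> t t01; exact: f0.
Qed.

Lemma sliceN f z : C0 f -> slice (fun r t z => - f r t z) z = - slice f z.
Proof.
move=> cf; rewrite -[RHS]mulN1r -(sliceZ (-1) z cf).
by apply: eq_slice => r t _ _; rewrite mulN1r.
Qed.

Lemma le_slice f g z : C0 f -> C0 g ->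
  (forall r t, 0 <= r <= 1 -> 0 <= t <= tau -> f r t z <= g r t z) ->
  slice f z <= slice g z.
Proof.
move=> cf cg fg; rewrite -subr_ge0 -sliceN// -sliceD//; last exact: C0_opp.
by apply: slice_ge0 => r t r01 t01; rewrite subr_ge0; exact: fg.
Qed.

Lemma slice_swap f z : C0 f ->
  slice f z = intg 0 tau (fun t => intg 0 1 (fun r => f r t z)).
Proof. by move=> cf; apply: (int_swap (f := fun r t => f r t z)); exact: C0_rt. Qed.

Lemma volD Z f g : C0 f -> C0 g ->
  vol Z (fun r t z => f r t z + g r t z) = vol Z f + vol Z g.
Proof.
move=> cf cg; rewrite /vol -intD; [|exact: continuous_slice..].
by congr (intg _ _ _); apply/funext => z; exact: sliceD.
Qed.

Lemma volZ Z k f : C0 f -> vol Z (fun r t z => k * f r t z) = k * vol Z f.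
Proof.
move=> cf; rewrite /vol -intZ; last exact: continuous_slice.
by congr (intg _ _ _); apply/funext => z; exact: sliceZ.
Qed.

Lemma eq_vol Z f g : 0 <= Z -> (forall r t z, 0 <= r <= 1 -> 0 <= t <= tau ->
  - Z <= z <= Z -> f r t z = g r t z) -> vol Z f = vol Z g.
Proof.
move=> Z0 fg; apply: eq_int => [|z zZ]; first by lra.
by apply: eq_slice => r t r01 t01; exact: fg.
Qed.

Lemma le_vol Z f g : 0 <= Z -> C0 f -> C0 g ->
  (forall r t z, 0 <= r <= 1 -> 0 <= t <= tau -> - Z <= z <= Z ->
    f r t z <= g r t z) -> vol Z f <= vol Z g.
Proof.
move=> Z0 cf cg fg; apply: le_int; [lra|exact: continuous_slice..|].
by move=> z zZ; apply: le_slice => // r t r01 t01; exact: fg.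
Qed.

Lemma vol_ge0 Z f : 0 <= Z -> (forall r t z, 0 <= r <= 1 -> 0 <= t <= tau ->
  - Z <= z <= Z -> 0 <= f r t z) -> 0 <= vol Z f.
Proof.
move=> Z0 f0; apply: int_ge0 => [|z zZ]; first by lra.
by apply: slice_ge0 => r t r01 t01; exact: f0.
Qed.

(** The three one-dimensional integrations by parts, in their raw form. *)
Lemma slice_dt X Y z : C0 Y ->
  (forall r t, 0 <= r <= 1 -> is_derive t 1 (fun t => X r t z) (Y r t z)) ->
  (forall r, 0 <= r <= 1 -> X r tau z = X r 0 z) -> slice Y z = 0.
Proof.
move=> cY dX Xp; rewrite -(mulr0 (1 - 0)) -(int_cst 0 1 0).
apply: eq_int => // r r01.
rewrite (_ : intg 0 tau _ = X r tau z - X r 0 z); first by rewrite Xp ?subrr.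
apply: (@int_FTC2T _ 0 tau _ (fun t => X r t z)); first exact: C0_t.
by move=> t; exact: dX.
Qed.

Lemma slice_dr X Y z : C0 X -> C0 Y ->
  (forall r t, 0 < r < 1 -> is_derive r 1 (fun r => X r t z) (Y r t z)) ->
  slice Y z = intg 0 tau (fun t => X 1 t z - X 0 t z).
Proof.
move=> cX cY dX; rewrite slice_swap//; congr (intg 0 _ _); apply/funext => t.
apply: (@int_FTC2 _ 0 1 _ (fun r => X r t z)) => //.
- exact: C0_r.
- by move=> r _; exact: C0_r.
Qed.

Lemma vol_dz Z X Y : C0 X -> C0 Y ->
  (forall r t z, is_derive z 1 (X r t) (Y r t z)) ->
  (forall r t, X r t Z = 0) -> (forall r t, X r t (- Z) = 0) -> vol Z Y = 0.
Proof.
move=> cX cY dX XZ XNZ.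
have dS z : is_derive z 1 (slice X) (slice Y z).
  apply: (@is_derive_int R (fun r z => intg 0 tau (fun t => X r t z))
    (fun r z => intg 0 tau (fun t => Y r t z))); [exact: continuous_ring..|].
  move=> r {}z; apply: (@is_derive_int R (fun t z => X r t z) (fun t z => Y r t z)).
  - by apply: (C0_comp cX); cont.
  - by apply: (C0_comp cY); cont.
  - by [].
rewrite (_ : vol Z Y = slice X Z - slice X (- Z)); last first.
  by apply: int_FTC2T => //; exact: continuous_slice.
have s0 z : (forall r t, X r t z = 0) -> slice X z = 0.
  move=> X0; rewrite /slice (@eq_int _ 0 1 _ (fun=> 0))// ?int_cst ?mulr0// => r _.
  by rewrite (@eq_int _ 0 tau _ (fun=> 0)) ?int_cst ?mulr0 ?tau_ge0.
by rewrite !s0// subrr.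
Qed.

(** Divergence theorem on a cross-section: the radial part integrates to the
    boundary circle, the angular part to zero by periodicity. *)
Lemma slice_div X X1 X2 X3 Y Y1 Y2 Y3 z : C1 X X1 X2 X3 -> C1 Y Y1 Y2 Y3 ->
  slice (fun r t z => r * (X1 r t z + Y2 r t z)) z =
  intg 0 tau (fun t => cos t * X 1 t z + sin t * Y 1 t z).
Proof.
move=> [cX cX1 cX2 cX3 Xr Xt Xz Xp] [cY cY1 cY2 cY3 Yr Yt Yz Yp].
pose A r t z := r * (cos t * X r t z + sin t * Y r t z).
pose A' r t z := cos t * X r t z + sin t * Y r t z +
  r * (cos t * (cos t * X1 r t z + sin t * X2 r t z) +
       sin t * (cos t * Y1 r t z + sin t * Y2 r t z)).
pose B r t z := cos t * Y r t z - sin t * X r t z.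
pose B' r t z := - sin t * Y r t z - cos t * X r t z +
  clamp01 r * (cos t * (cos t * Y2 r t z - sin t * Y1 r t z) -
       sin t * (cos t * X2 r t z - sin t * X1 r t z)).
have cA : C0 A by rewrite /A; c0.
have cA' : C0 A' by rewrite /A'; c0.
have cB' : C0 B' by rewrite /B'; c0.
rewrite (@eq_slice _ (fun r t z => A' r t z + B' r t z)); last first.
  move=> r t r01 t01; rewrite /A' /B' clamp01_id//.
  rewrite -[LHS]mul1r -(cos2Dsin2 t); ring.
rewrite sliceD// [X in _ + X](_ : _ = 0) ?addr0; last first.
  apply: (slice_dt (X := B)) => // [r t r01|r r01].
    rewrite /B /B'.
    by deriv.
  by rewrite /B Yp Xp mulr_natl cos2pi sin2pi cos0 sin0.
rewrite (_ : slice A' z = intg 0 tau (fun t => A 1 t z - A 0 t z)); last first.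
  apply: slice_dr => // r t r01; rewrite /A /A'.
  by have dX := Xr r t z r01; have dY := Yr r t z r01; deriv.
by congr (intg 0 _ _); apply/funext => t; rewrite /A mul1r mul0r subr0.
Qed.

End Slice.

(** * Fields on the closed cylinder *)

Section C1Closure.
Context {R : realType}.
Notation tau := (2 * pi : R).
Notation fun3 := (R -> R -> R -> R).
Implicit Types (X Y : fun3) (r t z k : R).

Lemma C1_cst k : C1 (fun _ _ _ => k) (fun _ _ _ => 0) (fun _ _ _ => 0)
  (fun _ _ _ => 0).
Proof.
split; try by c0.
- by move=> r t z _; deriv.
- by move=> r t z; deriv.
- by move=> r t z; deriv.
Qed.

Lemma C1_add X X1 X2 X3 Y Y1 Y2 Y3 : C1 X X1 X2 X3 -> C1 Y Y1 Y2 Y3 ->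
  C1 (fun r t z => X r t z + Y r t z) (fun r t z => X1 r t z + Y1 r t z)
     (fun r t z => X2 r t z + Y2 r t z) (fun r t z => X3 r t z + Y3 r t z).
Proof.
move=> [cX cX1 cX2 cX3 Xr Xt Xz Xp] [cY cY1 cY2 cY3 Yr Yt Yz Yp].
split; try by c0.
- by move=> r t z r01; have dX := Xr r t z r01; have dY := Yr r t z r01; deriv.
- by move=> r t z; deriv.
- by move=> r t z; deriv.
- by move=> r z; rewrite Xp Yp.
Qed.

Lemma C1_opp X X1 X2 X3 : C1 X X1 X2 X3 ->
  C1 (fun r t z => - X r t z) (fun r t z => - X1 r t z)
     (fun r t z => - X2 r t z) (fun r t z => - X3 r t z).
Proof.
move=> [cX cX1 cX2 cX3 Xr Xt Xz Xp].
split; try by c0.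
- by move=> r t z r01; have dX := Xr r t z r01; deriv.
- by move=> r t z; deriv.
- by move=> r t z; deriv.
- by move=> r z; rewrite Xp.
Qed.

Lemma C1_mul X X1 X2 X3 Y Y1 Y2 Y3 : C1 X X1 X2 X3 -> C1 Y Y1 Y2 Y3 ->
  C1 (fun r t z => X r t z * Y r t z)
     (fun r t z => X1 r t z * Y r t z + X r t z * Y1 r t z)
     (fun r t z => X2 r t z * Y r t z + X r t z * Y2 r t z)
     (fun r t z => X3 r t z * Y r t z + X r t z * Y3 r t z).
Proof.
move=> [cX cX1 cX2 cX3 Xr Xt Xz Xp] [cY cY1 cY2 cY3 Yr Yt Yz Yp].
split; try by c0.
- by move=> r t z r01; have dX := Xr r t z r01; have dY := Yr r t z r01; deriv.
- by move=> r t z; deriv.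
- by move=> r t z; deriv.
- by move=> r z; rewrite Xp Yp.
Qed.

Lemma C1_x : C1 (fun r t _ => clamp01 r * cos t) (fun _ _ _ => 1)
  (fun _ _ _ => 0) (fun _ _ _ => 0).
Proof.
split; try by c0.
- by move=> r t z r01; have dc := is_derive_clamp01 r01; deriv.
- by move=> r t z; deriv.
- by move=> r t z; deriv.
- by move=> r z; rewrite mulr_natl cos2pi cos0.
Qed.

Lemma C1_y : C1 (fun r t _ => clamp01 r * sin t) (fun _ _ _ => 0)
  (fun _ _ _ => 1) (fun _ _ _ => 0).
Proof.
split; try by c0.
- by move=> r t z r01; have dc := is_derive_clamp01 r01; deriv.
- by move=> r t z; deriv.
- by move=> r t z; deriv.
- by move=> r z; rewrite mulr_natl sin2pi sin0.
Qed.

Lemma C1_fz (a a' : R -> R) : continuous a -> continuous a' ->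
  (forall z, is_derive z 1 a (a' z)) ->
  C1 (fun _ _ z => a z) (fun _ _ _ => 0) (fun _ _ _ => 0) (fun _ _ z => a' z).
Proof.
move=> ca ca' da; split; try by c0.
- by move=> r t z _; deriv.
- by move=> r t z; deriv.
Qed.

Lemma C1_eq X X1 X2 X3 Y1 Y2 Y3 : C1 X X1 X2 X3 ->
  (forall r t z, X1 r t z = Y1 r t z) -> (forall r t z, X2 r t z = Y2 r t z) ->
  (forall r t z, X3 r t z = Y3 r t z) -> C1 X Y1 Y2 Y3.
Proof.
move=> H e1 e2 e3; suff [<- <- <-] : [/\ X1 = Y1, X2 = Y2 & X3 = Y3] by [].
by split; do 3 apply/funext => ?.
Qed.

End C1Closure.

(** * Inverting the divergence on a cross-section *)

Section Bogovskii.
Context {R : realType}.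
Notation tau := (2 * pi : R).
Notation fun3 := (R -> R -> R -> R).
Implicit Types (f g h q : fun3) (r t z k : R).

(** [r^2 radial_mean f] is the primitive of [r f] along a ray. Subtracting the
    value at [r = 1] makes the radial field [r N e_r], [N = ray_defect f], vanish
    on the circle, at the price of a divergence depending on the angle only, which
    the rotating field [2 r G e_t], [G = angular_primitive f], compensates. *)
Definition radial_mean f r t z := intg 0 1 (fun s => s * f (s * r) t z).
Definition ray_defect f r t z := radial_mean f r t z - radial_mean f 1 t z.
Definition angular_primitive f t z := intg 0 t (fun a => radial_mean f 1 a z).

Definition inv_div_x f r t z := r *
  (cos t * ray_defect f r t z - 2 * sin t * angular_primitive f t z).
Definition inv_div_y f r t z := r *
  (sin t * ray_defect f r t z + 2 * cos t * angular_primitive f t z).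

Lemma C0_radial_mean f : C0 f -> C0 (radial_mean f).
Proof.
move=> cf; apply: (continuous_int
  (f := fun (q : R * R * R) s => s * f (s * q.1.1) q.1.2 q.2)).
- by apply: continuous_mul; [cont|apply: (C0_comp cf); cont].
- exact: continuous_cst.
- exact: continuous_cst.
Qed.

Lemma C0_ray_defect f : C0 f -> C0 (ray_defect f).
Proof.
move=> cf; apply: C0_add; first exact: C0_radial_mean.
by apply: C0_opp; apply: (C0_comp (C0_radial_mean cf)); cont.
Qed.

Lemma C0_angular_primitive f : C0 f -> C0 (fun _ t z => angular_primitive f t z).
Proof.
move=> cf; apply: (continuous_int
  (f := fun (q : R * R * R) a => radial_mean f 1 a q.2)).
- by apply: (C0_comp (C0_radial_mean cf)); cont.
- exact: continuous_cst.
- by cont.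
Qed.

Lemma radial_mean_dt f g r t z : C0 f -> C0 g ->
  (forall r t z, is_derive t 1 (fun t => f r t z) (g r t z)) ->
  is_derive t 1 (fun t => radial_mean f r t z) (radial_mean g r t z).
Proof.
move=> cf cg df; apply: (is_derive_int (f := fun s t => s * f (s * r) t z)
  (k := fun s t => s * g (s * r) t z)).
- by apply: continuous_mul; [cont|apply: (C0_comp cf); cont].
- by apply: continuous_mul; [cont|apply: (C0_comp cg); cont].
Qed.

Lemma radial_mean_dz f g r t z : C0 f -> C0 g ->
  (forall r t z, is_derive z 1 (f r t) (g r t z)) ->
  is_derive z 1 (radial_mean f r t) (radial_mean g r t z).
Proof.
move=> cf cg df; apply: (is_derive_int (f := fun s z => s * f (s * r) t z)
  (k := fun s z => s * g (s * r) t z)).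
- by apply: continuous_mul; [cont|apply: (C0_comp cf); cont].
- by apply: continuous_mul; [cont|apply: (C0_comp cg); cont].

Qed.

Lemma angular_primitive_dt f t z : C0 f ->
  is_derive t 1 (angular_primitive f ^~ z) (radial_mean f 1 t z).
Proof.
move=> cf; apply: int_FTC1; apply: (C0_comp (C0_radial_mean cf)); cont.
Qed.

Lemma angular_primitive_dz f g t z : C0 f -> C0 g ->
  (forall r t z, is_derive z 1 (f r t) (g r t z)) ->
  is_derive z 1 (angular_primitive f t) (angular_primitive g t z).
Proof.
move=> cf cg df; apply: (is_derive_int (f := fun a z => radial_mean f 1 a z)
  (k := fun a z => radial_mean g 1 a z)).
- by apply: (C0_comp (C0_radial_mean cf)); cont.
- by apply: (C0_comp (C0_radial_mean cg)); cont.
- by move=> a {}z; exact: radial_mean_dz.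
Qed.

Lemma radial_meanE f r t z : C0 f ->
  r ^+ 2 * radial_mean f r t z = intg 0 r (fun s => s * f s t z).
Proof.
move=> cf; rewrite int_affine subr0 expr2 -mulrA; congr (_ * _).
have c : continuous (fun s : R => s * f (s * r) t z).
  by apply: continuous_mul; [cont|apply: (C0_comp cf); cont].
rewrite -(intZ 0 1 r c); congr (intg _ _ _); apply/funext => s.
by rewrite add0r mulrA [s * r]mulrC.
Qed.

Lemma radial_mean_dr f r t z : C0 f ->
  is_derive r 1 (fun r => r ^+ 2 * radial_mean f r t z) (r * f r t z).
Proof.
move=> cf; rewrite (_ : (fun r => _) = fun r => intg 0 r (fun s => s * f s t z)).
  apply: (@int_FTC1 _ 0 (fun s => s * f s t z)).
  by apply: continuous_mul; [cont|apply: (C0_comp cf); cont].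
by apply/funext => r'; exact: radial_meanE.
Qed.

Lemma angular_primitive0 f z : angular_primitive f 0 z = 0.
Proof. exact: intxx. Qed.

Lemma radial_mean1E f t z : radial_mean f 1 t z = intg 0 1 (fun r => r * f r t z).
Proof.
by congr (intg _ _ _); apply/funext => s; rewrite mulr1.
Qed.

Lemma angular_primitive_tau f z : C0 f ->
  slice (fun r t z => r * f r t z) z = 0 -> angular_primitive f tau z = 0.
Proof.
move=> cf; rewrite slice_swap; last by c0.
move=> <-; congr (intg _ _ _); apply/funext => t; exact: radial_mean1E.
Qed.

Lemma C0_inv_div_x f : C0 f -> C0 (inv_div_x f).
Proof.
move=> cf; have cN := C0_ray_defect cf; have cG := C0_angular_primitive cf.
by rewrite /inv_div_x; c0.
Qed.

Lemma C0_inv_div_y f : C0 f -> C0 (inv_div_y f).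
Proof.
move=> cf; have cN := C0_ray_defect cf; have cG := C0_angular_primitive cf.
by rewrite /inv_div_y; c0.
Qed.

Lemma inv_div_dz f g r t z : C0 f -> C0 g ->
  (forall r t z, is_derive z 1 (f r t) (g r t z)) ->
  is_derive z 1 (inv_div_x f r t) (inv_div_x g r t z) /\
  is_derive z 1 (inv_div_y f r t) (inv_div_y g r t z).
Proof.
move=> cf cg df.
have d1 := radial_mean_dz r t z cf cg df.
have d2 := radial_mean_dz 1 t z cf cg df.
have d3 := angular_primitive_dz t z cf cg df.
by split; rewrite /inv_div_x /inv_div_y /ray_defect; deriv.
Qed.

(** With [N] and [G] as above, [W = r N e_r + 2 r G e_t] is single-valued because
    [f] has mean zero, is tangent to the circle, and satisfies
    [div W = (f - 2 radial_mean f 1) + 2 radial_mean f 1 = f]. The identity is the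
    weak form of this: [A'] and [B'] below are the radial and angular parts of
    [r div (q W)]. *)
Lemma weak_divergence f f1 f2 f3 q q1 q2 q3 z : C1 f f1 f2 f3 -> C1 q q1 q2 q3 ->
  slice (fun r t z => r * f r t z) z = 0 ->
  slice (fun r t z => r * (q r t z * f r t z)) z =
  - slice (fun r t z => r *
      (q1 r t z * inv_div_x f r t z + q2 r t z * inv_div_y f r t z)) z.
Proof.
rewrite /inv_div_x /inv_div_y.
move=> [cf cf1 cf2 cf3 fr ft fz fp] [cq cq1 cq2 cq3 qr qt qz qp] f0.
set N := ray_defect f; set G := angular_primitive f.
have cN : C0 N := C0_ray_defect cf.
have cG : C0 (fun _ t z => G t z) := C0_angular_primitive cf.
have cP1 : C0 (fun _ t z => radial_mean f 1 t z).
  by apply: (C0_comp (C0_radial_mean cf)); cont.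
pose A r t z := q r t z * (r ^+ 2 * N r t z).
pose A' r t z := (cos t * q1 r t z + sin t * q2 r t z) * (r ^+ 2 * N r t z) +
  q r t z * (r * f r t z - 2 * r * radial_mean f 1 t z).
pose B r t z := q r t z * (2 * r * G t z).
pose B' r t z := clamp01 r * (cos t * q2 r t z - sin t * q1 r t z) * (2 * r * G t z) +
  q r t z * (2 * r * radial_mean f 1 t z).
have cA : C0 A by rewrite /A; c0.
have cA' : C0 A' by rewrite /A'; c0.
have cB' : C0 B' by rewrite /B'; c0.
have HA : slice A' z = 0.
  rewrite (_ : slice A' z = intg 0 tau (fun t => A 1 t z - A 0 t z)); last first.
    apply: slice_dr => // r t r01; rewrite /A /A'.
    have dq := qr r t z r01.
    rewrite (_ : (fun r => _) = fun r => q r t z *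
      (r ^+ 2 * radial_mean f r t z - r ^+ 2 * radial_mean f 1 t z)); last first.
      by apply/funext => x; rewrite /N /ray_defect; ring.
    have dP := radial_mean_dr r t z cf.
    apply: derive_eq; rewrite /GRing.scale/= /N /ray_defect; ring.
  transitivity (intg 0 tau (fun=> 0 : R)); last by rewrite int_cst mulr0.
  congr (intg _ _ _); apply/funext => t.
  by rewrite /A /N /ray_defect; ring.
have HB : slice B' z = 0.
  apply: (slice_dt (X := B)) => [|r t r01|r r01]; first exact: cB'.
    by rewrite /B /B'; have dG := angular_primitive_dt t z cf; deriv.
  by rewrite /B /G angular_primitive_tau// angular_primitive0 !mulr0.
apply/eqP; rewrite -subr_eq0 opprK -[X in _ == X](addr0 0) -[in X in _ == X + _]HA.
rewrite -[in X in _ == _ + X]HB; apply/eqP.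
rewrite -(sliceD z cA' cB') -sliceD; [|c0..].
apply: eq_slice => r t r01 t01; rewrite /A' /B' clamp01_id//; ring.
Qed.

End Bogovskii.

Section BogovskiiBounds.
Context {R : realType}.
Notation tau := (2 * pi : R).
Notation fun3 := (R -> R -> R -> R).
Implicit Types (f g h q w : fun3) (r t z k : R).

Definition angular_derivative (f1 f2 : fun3) : fun3 :=
  fun r t z => clamp01 r * (cos t * f2 r t z - sin t * f1 r t z).

(** The analogous identity for the planar curl [4 G - d_t N] of [W]; since the
    component of [W] along the circle need not vanish, [w] has to. Here [d_t N] is the ray defect
    of the angular derivative of [f]. *)
Lemma weak_curl f f1 f2 f3 w w1 w2 w3 z : C1 f f1 f2 f3 -> C1 w w1 w2 w3 ->
  slice (fun r t z => r * f r t z) z = 0 -> (forall t z, w 1 t z = 0) ->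
  slice (fun r t z => r *
      (w2 r t z * inv_div_x f r t z - w1 r t z * inv_div_y f r t z)) z =
  slice (fun r t z => r * (w r t z * (4 * angular_primitive f t z -
     ray_defect (angular_derivative f1 f2) r t z))) z.
Proof.
rewrite /inv_div_x /inv_div_y.
move=> [cf cf1 cf2 cf3 fr ft fz fp] [cw cw1 cw2 cw3 wr wt wz wp] f0 w0.
set N := ray_defect f; set G := angular_primitive f.
set Nt := ray_defect (angular_derivative f1 f2).
have cft : C0 (angular_derivative f1 f2) by rewrite /angular_derivative; c0.
have cN : C0 N := C0_ray_defect cf.
have cNt : C0 Nt := C0_ray_defect cft.
have cG : C0 (fun _ t z => G t z) := C0_angular_primitive cf.
pose A r t z := w r t z * (r * N r t z).
pose A' r t z := angular_derivative w1 w2 r t z * (r * N r t z) +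
  w r t z * (r * Nt r t z).
pose B r t z := - 2 * r ^+ 2 * G t z * w r t z.
pose B' r t z := - 4 * r * G t z * w r t z -
  2 * r ^+ 2 * G t z * (cos t * w1 r t z + sin t * w2 r t z).
have cA' : C0 A' by rewrite /A' /angular_derivative; c0.
have cB : C0 B by rewrite /B; c0.
have cB' : C0 B' by rewrite /B'; c0.
have HA : slice A' z = 0.
  apply: (slice_dt (X := A)) => [|r t r01|r r01]; first exact: cA'.
    have dN : is_derive t 1 (fun t => N r t z) (Nt r t z).
      have d1 := radial_mean_dt r t z cf cft ft.
      have d2 := radial_mean_dt 1 t z cf cft ft.
      by rewrite /N /Nt /ray_defect; deriv.
    by rewrite /A /A' /angular_derivative; deriv.
  have Np r' : radial_mean f r' tau z = radial_mean f r' 0 z.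
    by congr (intg _ _ _); apply/funext => s; rewrite fp.
  by rewrite /A wp /N /ray_defect !Np.
have HB : slice B' z = 0.
  rewrite (_ : slice B' z = intg 0 tau (fun t => B 1 t z - B 0 t z)); last first.
    apply: slice_dr => [||r t r01]; [exact: cB|exact: cB'|rewrite /B /B'].
    by have dw := wr r t z r01; deriv.
  transitivity (intg 0 tau (fun=> 0 : R)); last by rewrite int_cst mulr0.
  congr (intg _ _ _); apply/funext => t.
  by rewrite /B w0; ring.
rewrite -[RHS]add0r -[in RHS]HA -[in RHS](addr0 (slice A' z)) -[in RHS]HB.
rewrite -(sliceD z cA' cB') -sliceD; [|c0..].
by apply: eq_slice => r t r01 t01; rewrite /A' /B' /angular_derivative clamp01_id//; ring.
Qed.

(** The energy of [f] on the ray of angle [t]; it controls the means of [f] over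
    all segments of that ray. *)
Definition ray_energy f t z := intg 0 1 (fun s => s * f s t z ^+ 2).

Lemma C0_ray_energy f : C0 f -> C0 (fun _ t z => ray_energy f t z).
Proof.
move=> cf; apply: (continuous_int
  (f := fun (q : R * R * R) s => s * f s q.1.2 q.2 ^+ 2)).
- by apply: continuous_mul; [cont|apply: continuous_exp; apply: (C0_comp cf); cont].
- exact: continuous_cst.
- exact: continuous_cst.
Qed.

Lemma slice_ray_energy f z : C0 f ->
  slice (fun _ t z => ray_energy f t z) z =
  slice (fun r t z => r * f r t z ^+ 2) z.
Proof.
move=> cf; rewrite [RHS]slice_swap; last by c0.
by rewrite /slice int_cst subr0 mul1r.
Qed.

Lemma int_id01 : intg 0 1 (fun s : R => s) = 1 / 2.
Proof.
rewrite (_ : intg _ _ _ = (fun s : R => s * s / 2) 1 - (fun s : R => s * s / 2) 0).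
  by field.
apply: (@int_FTC2T _ 0 1 _ (fun s : R => s * s / 2)) => [|x]; first by cont.
by apply: derive_eq; rewrite /GRing.scale/=; field.
Qed.

Lemma radial_mean_sqr_le f r t z : C0 f ->
  radial_mean f r t z ^+ 2 <=
  1 / 2 * radial_mean (fun r t z => f r t z ^+ 2) r t z.
Proof.
move=> cf; rewrite -int_id01; apply: int_sqr_le => //; first by cont.
  by apply: (C0_comp cf); cont.
by move=> s /andP[].
Qed.

Lemma radial_mean_sqr_energy f r t z : C0 f -> 0 <= r <= 1 ->
  r ^+ 2 * radial_mean (fun r t z => f r t z ^+ 2) r t z <= ray_energy f t z.
Proof.
move=> cf /andP[r0 r1]; rewrite radial_meanE; last by c0.
have c : continuous (fun s : R => s * f s t z ^+ 2).
  by apply: continuous_mul; [cont|apply: continuous_exp; exact: C0_r].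
rewrite /ray_energy -(int_cat 0 r 1 c) lerDl; apply: int_ge0 => // s /andP[rs _].
by rewrite mulr_ge0 ?sqr_ge0// (le_trans r0).
Qed.

Lemma radial_mean_bound f r t z : C0 f -> 0 <= r <= 1 ->
  (r * radial_mean f r t z) ^+ 2 <= 1 / 2 * ray_energy f t z.
Proof.
move=> cf r01; rewrite exprMn.
have h1 := radial_mean_sqr_le r t z cf.
have h2 := radial_mean_sqr_energy t z cf r01.
have : 0 <= r ^+ 2 by exact: sqr_ge0.
nra.
Qed.

(** A tangential derivative carries a factor [r], which gains the power that the
    mean over the ray would otherwise lose at the axis. *)
Lemma radial_mean_tangential_bound h r t z : C0 h -> 0 <= r <= 1 ->
  radial_mean (fun r t z => clamp01 r * h r t z) r t z ^+ 2 <=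
  1 / 2 * ray_energy h t z.
Proof.
move=> ch r01.
have c1 : C0 (fun r t z => clamp01 r * h r t z) by c0.
apply: (le_trans (radial_mean_sqr_le r t z c1)).
apply: ler_wpM2l => //.
apply: le_trans (radial_mean_sqr_energy t z ch r01).
have c2 : continuous (fun s : R => s * h (s * r) t z ^+ 2).
  apply: continuous_mul; [cont|apply: continuous_exp]; apply: (C0_comp ch); cont.
rewrite /radial_mean -(intZ 0 1 (r ^+ 2) c2); apply: le_int => //.
- apply: continuous_mul; [cont|apply: continuous_exp]; apply: (C0_comp c1); cont.
- by apply: continuous_mul; [exact: continuous_cst|exact: c2].
move=> s /andP[s0 s1]; move/andP: r01 => [r0 r1].
rewrite clamp01_id; last by apply/andP; split; nra.
set x := h (s * r) t z.
rewrite (_ : _ * _ = r ^+ 2 * (s * x ^+ 2) * s ^+ 2); last by ring.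
have x2 := sqr_ge0 x; have r2 := sqr_ge0 r.
by rewrite ler_piMr ?expr_le1//; apply: mulr_ge0 => //; exact: mulr_ge0.
Qed.

Lemma angular_primitive_bound f t z : C0 f -> 0 <= t <= tau ->
  angular_primitive f t z ^+ 2 <=
  tau / 2 * slice (fun r t z => r * f r t z ^+ 2) z.
Proof.
move=> cf /andP[t0 ttau]; set P1 := fun a => radial_mean f 1 a z.
have cP1 : continuous P1 by apply: (C0_comp (C0_radial_mean cf)); cont.
have c1 : continuous (fun _ : R => 1 : R) by exact: continuous_cst.
have := int_sqr_le t0 c1 cP1 (fun _ _ => ler01).
rewrite (_ : (fun t => 1 * P1 t) = P1); last by apply/funext => x; rewrite mul1r.
rewrite (_ : (fun t => 1 * P1 t ^+ 2) = fun t => P1 t ^+ 2); last first.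
  by apply/funext => x; rewrite mul1r.
rewrite int_cst mulr1 subr0 => /le_trans; apply.
have cP2 : continuous (fun a => P1 a ^+ 2) by cont.
have H1 : intg 0 t (fun a => P1 a ^+ 2) <= intg 0 tau (fun a => P1 a ^+ 2).
  rewrite -(int_cat 0 t tau cP2) lerDl; apply: int_ge0 => // a _; exact: sqr_ge0.
have H0 : 0 <= intg 0 t (fun a => P1 a ^+ 2).
  by apply: int_ge0 => // a _; exact: sqr_ge0.
have ce : continuous (fun a => ray_energy f a z).
  exact: (@C0_t _ _ 0 z (C0_ray_energy cf)).
have H2 : intg 0 tau (fun a => P1 a ^+ 2) <=
    1 / 2 * slice (fun r t z => r * f r t z ^+ 2) z.
  rewrite -slice_ray_energy// /slice int_cst subr0 [1 * intg _ _ _]mul1r -(intZ 0 tau _ ce).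
  apply: le_int => //; [exact: tau_ge0|by cont|move=> a _].
  have := @radial_mean_bound f 1 a z cf; rewrite mul1r; apply.
  by rewrite ler01 lexx.
apply: le_trans (_ : tau * intg 0 tau (fun a => P1 a ^+ 2) <= _).
  exact: (ler_pM t0 H0 ttau H1).
rewrite (_ : tau / 2 * _ = tau *
  (1 / 2 * slice (fun r t z => r * f r t z ^+ 2) z)); last by field.
exact: (ler_wpM2l tau_ge0 H2).
Qed.

Definition inv_div_const : R := 2 + tau ^+ 2 / 2.
Notation K1 := inv_div_const.

Lemma slice_cst k z : slice (fun _ _ _ => k) z = tau * k.
Proof. by rewrite /slice !int_cst !subr0 mul1r. Qed.

Lemma ray_defect_bound f r t z : C0 f -> 0 <= r <= 1 ->
  (r * ray_defect f r t z) ^+ 2 <= 2 * ray_energy f t z.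
Proof.
move=> cf r01; rewrite /ray_defect.
have h1 := radial_mean_bound t z cf r01.
have := @radial_mean_bound f 1 t z cf.
rewrite lexx ler01 mul1r => /(_ isT) h2.
set P := radial_mean f r t z in h1 *; set P1 := radial_mean f 1 t z in h2 *.
have h3 : (r * P1) ^+ 2 <= P1 ^+ 2.
  move/andP: r01 => [r0 r1].
  by rewrite exprMn ler_piMl ?sqr_ge0// expr_le1.
have : 0 <= (r * P + r * P1) ^+ 2 by exact: sqr_ge0.
rewrite mulrBr !expr2 in h1 h2 h3 *; lra.
Qed.

Lemma bogovskii_bound f z : C0 f ->
  slice (fun r t z => r * ((r * ray_defect f r t z) ^+ 2 +
                           (r * angular_primitive f t z) ^+ 2)) z <=
  K1 * slice (fun r t z => r * f r t z ^+ 2) z.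
Proof.
move=> cf; have cN := C0_ray_defect cf; have cG := C0_angular_primitive cf.
set S := slice (fun r t z => r * f r t z ^+ 2) z.
have ce := C0_ray_energy cf.
rewrite (_ : K1 * S = slice (fun _ t z => 2 * ray_energy f t z + tau / 2 * S) z).
  apply: le_slice; [c0|c0|] => r t r01 t01.
  have h1 := ray_defect_bound t z cf r01.
  have h2 := angular_primitive_bound z cf t01.
  rewrite -/S in h2; move/andP: r01 => [r0 r1].
  have h3 : (r * angular_primitive f t z) ^+ 2 <= angular_primitive f t z ^+ 2.
    by rewrite exprMn ler_piMl ?sqr_ge0// expr_le1.
  apply: (@le_trans _ _ (1 * ((r * ray_defect f r t z) ^+ 2 +
                           (r * angular_primitive f t z) ^+ 2))); last by lra.
  by apply: ler_wpM2r => //; rewrite addr_ge0// sqr_ge0.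
rewrite sliceD; [|by c0|by c0].
by rewrite slice_cst (sliceZ _ z ce) (slice_ray_energy z cf) -/S /inv_div_const; field.
Qed.

Lemma inv_div_bound f z : C0 f ->
  slice (fun r t z => r * (inv_div_x f r t z ^+ 2 + inv_div_y f r t z ^+ 2)) z <=
  4 * K1 * slice (fun r t z => r * f r t z ^+ 2) z.
Proof.
move=> cf; have cN := C0_ray_defect cf; have cG := C0_angular_primitive cf.
have cx := C0_inv_div_x cf; have cy := C0_inv_div_y cf.
rewrite -mulrA; apply: le_trans (ler_wpM2l (ler0n _ 4) (bogovskii_bound z cf)).
rewrite -sliceZ; last by c0.
apply: le_slice; [c0|c0|] => r t /andP[r0 r1] _.
rewrite /inv_div_x /inv_div_y.
set n := ray_defect f r t z; set g := angular_primitive f t z.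
rewrite (_ : _ + _ = (cos t ^+ 2 + sin t ^+ 2) * ((r * n) ^+ 2 + 4 * (r * g) ^+ 2)).
  rewrite cos2Dsin2 mul1r [leRHS]mulrCA; apply: (ler_wpM2l r0).
  by have := sqr_ge0 (r * n); lra.
by ring.
Qed.

Lemma bogovskii_curl_bound f f1 f2 z : C0 f -> C0 f1 -> C0 f2 ->
  slice (fun r t z => r * (4 * angular_primitive f t z -
     ray_defect (angular_derivative f1 f2) r t z) ^+ 2) z <=
  16 * tau ^+ 2 * slice (fun r t z => r * f r t z ^+ 2) z +
  4 * slice (fun r t z => r * (f1 r t z ^+ 2 + f2 r t z ^+ 2)) z.
Proof.
move=> cf cf1 cf2; pose h : fun3 := fun r t z => cos t * f2 r t z - sin t * f1 r t z.
have ch : C0 h by rewrite /h; c0.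
have cft : C0 (angular_derivative f1 f2) by rewrite /angular_derivative; c0.
have cN := C0_ray_defect cft; have cG := C0_angular_primitive cf.
set S := slice (fun r t z => r * f r t z ^+ 2) z.
have ce := C0_ray_energy ch.
apply: (@le_trans _ _
    (slice (fun _ t z => 16 * tau * S + 4 * ray_energy h t z) z)).
  apply: le_slice; [c0|c0|] => r t r01 t01.
  have h1 := radial_mean_tangential_bound t z ch r01.
  have h01 : 0 <= (1 : R) <= 1 by rewrite ler01 lexx.
  have h1' := radial_mean_tangential_bound t z ch h01.
  have h2 := angular_primitive_bound z cf t01.
  rewrite -/S in h2; move/andP: r01 => [r0 r1].
  rewrite /ray_defect.
  set P := radial_mean _ r t z in h1 *; set P1 := radial_mean _ 1 t z in h1' *.
  set G := angular_primitive f t z in h2 *.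
  apply: (@le_trans _ _ (1 * (4 * G - (P - P1)) ^+ 2)).
    by apply: ler_wpM2r => //; exact: sqr_ge0.
  have e1 : 0 <= (4 * G + (P - P1)) ^+ 2 by exact: sqr_ge0.
  have e2 : 0 <= (P + P1) ^+ 2 by exact: sqr_ge0.
  rewrite !expr2 in h1 h1' h2 e1 e2 *; lra.
rewrite sliceD; [|by c0|by c0].
rewrite slice_cst (sliceZ _ z ce) (slice_ray_energy z ch).
rewrite (_ : tau * (16 * tau * S) = 16 * tau ^+ 2 * S); last by ring.
rewrite lerD2l; apply: ler_wpM2l; first exact: ler0n.
apply: le_slice; [c0|c0|] => r t /andP[r0 r1] t01.
apply: ler_wpM2l => //; rewrite /h.
have cs := cos2Dsin2 t.
have : 0 <= (sin t * f2 r t z + cos t * f1 r t z) ^+ 2 by exact: sqr_ge0.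
rewrite -[X in _ -> _ <= X]mul1r -cs; lra.
Qed.

Lemma young_neg2 (a b x y l : R) : 0 < l ->
  - (a * x + b * y) <= l * (a ^+ 2 + b ^+ 2) + (4 * l)^-1 * (x ^+ 2 + y ^+ 2).
Proof.
move=> l0; rewrite -subr_ge0.
rewrite (_ : _ - _ = l * ((a + x / (2 * l)) ^+ 2 + (b + y / (2 * l)) ^+ 2)).
  by apply: mulr_ge0; [exact: ltW|apply: addr_ge0; exact: sqr_ge0].
by field; rewrite gt_eqF.
Qed.

(** Poincare inequality for a function with zero mean on each cross-section,
    dual to the solvability of [div W = f]. *)
Lemma poincare_mean0 f f1 f2 f3 z : C1 f f1 f2 f3 ->
  slice (fun r t z => r * f r t z) z = 0 ->
  slice (fun r t z => r * f r t z ^+ 2) z <=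
  4 * K1 * slice (fun r t z => r * (f1 r t z ^+ 2 + f2 r t z ^+ 2)) z.
Proof.
move=> Cf f0; have := weak_divergence Cf Cf f0; rewrite /inv_div_x /inv_div_y.
have K10 : 0 < K1 by rewrite /inv_div_const ltr_pwDl// divr_ge0// sqr_ge0.
case: Cf => cf cf1 cf2 cf3 _ _ _ _.
have cN := C0_ray_defect cf; have cG := C0_angular_primitive cf.
rewrite (_ : (fun r t z => r * (f r t z * f r t z)) =
   (fun r t z => r * f r t z ^+ 2)); last first.
  by do 3 apply/funext => ?; rewrite expr2.
set S := slice (fun r t z => r * f r t z ^+ 2) z.
set D := slice (fun r t z => r * (f1 r t z ^+ 2 + f2 r t z ^+ 2)) z.
rewrite -sliceN; last by c0.
move=> Sle.
suff : S <= 2 * K1 * D + (2 * K1)^-1 * slice (fun r t z => r *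
    ((r * ray_defect f r t z) ^+ 2 + (r * angular_primitive f t z) ^+ 2)) z.
  have := bogovskii_bound z cf; rewrite -/S => b le.
  have : (2 * K1)^-1 * slice (fun r t z => r * ((r * ray_defect f r t z) ^+ 2 +
    (r * angular_primitive f t z) ^+ 2)) z <= (2 * K1)^-1 * (K1 * S).
    by rewrite ler_wpM2l// invr_ge0 mulr_ge0// ltW.
  rewrite [X in _ <= X -> _](_ : _ = S / 2); last by field; rewrite gt_eqF.
  lra.
rewrite Sle -!sliceZ -?sliceD; [|c0..].
apply: le_slice; [c0|c0|] => r t /andP[r0 r1] t01.
set N := ray_defect f r t z; set G := angular_primitive f t z.
set a := f1 r t z; set b := f2 r t z.
rewrite [leRHS](_ : _ = r * (2 * K1 * (a ^+ 2 + b ^+ 2) +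
  (2 * K1)^-1 * ((r * N) ^+ 2 + (r * G) ^+ 2))); last by ring.
rewrite -mulrN; apply: ler_wpM2l => //.
set n := r * N; set g := r * G.
apply: (le_trans (young_neg2 a b _ _ (mulr_gt0 (ltr0n _ 2) K10))).
rewrite lerD2l (_ : (4 * (2 * K1))^-1 = (2 * K1)^-1 / 4); last first.
  by field; rewrite gt_eqF.
rewrite -mulrA; apply: ler_wpM2l; first by rewrite invr_ge0 mulr_ge0// ltW.
rewrite [X in _ * X](_ : _ = (cos t ^+ 2 + sin t ^+ 2) * (n ^+ 2 + 4 * g ^+ 2)).
  by rewrite cos2Dsin2; have := sqr_ge0 n; lra.
by rewrite /n /g; ring.
Qed.

End BogovskiiBounds.

(** * The energy inequality *)

Section DivergenceTheorem.
Context {R : realType}.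
Implicit Types (X Y W : R -> R -> R -> R) (r t z Z : R).

(** The flux through the end sections vanishes, and the flux through the wall has
    a sign. *)
Lemma vol_div_le0 X X1 X2 X3 Y Y1 Y2 Y3 W W1 W2 W3 Z :
  C1 X X1 X2 X3 -> C1 Y Y1 Y2 Y3 -> C1 W W1 W2 W3 -> 0 <= Z ->
  (forall r t, W r t Z = 0) -> (forall r t, W r t (- Z) = 0) ->
  (forall t z, - Z <= z <= Z -> cos t * X 1 t z + sin t * Y 1 t z <= 0) ->
  vol Z (fun r t z => r * (X1 r t z + Y2 r t z + W3 r t z)) <= 0.
Proof.
move=> CX CY CW Z0 WZ WNZ bd.
have [[cX1 cY2] [cW cW3]] := (C1_C0x CX, C1_C0y CY, (C1_C0 CW, C1_C0z CW)).
rewrite (_ : vol Z _ = vol Z (fun r t z => r * (X1 r t z + Y2 r t z)) +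
  vol Z (fun r t z => r * W3 r t z)); last first.
  by rewrite -volD; [apply: (eq_vol Z0) => r t z _ _ _; ring|c0|c0].
rewrite [X in _ + X](_ : _ = 0) ?addr0; last first.
  apply: (vol_dz (X := fun r t z => r * W r t z)); [c0|c0| | |] => r t => [z||].
  - by have dW := C1_z CW r t z; deriv.
  - by rewrite WZ mulr0.
  - by rewrite WNZ mulr0.
have c0' : continuous (fun _ : R => 0 : R) by exact: continuous_cst.
rewrite -[leRHS](mulr0 (Z - - Z)) -(int_cst (- Z) Z 0).
apply: le_int => [|||z zZ]; [lra|apply: continuous_slice; c0|exact: c0'|].
rewrite (slice_div z CX CY) -[leRHS](mulr0 (2 * pi - 0)) -(int_cst 0 (2 * pi) 0).
have [cX cY] := (C1_C0 CX, C1_C0 CY).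
apply: le_int => [|||t _]; [exact: tau_ge0| |exact: c0'|exact: bd].
apply: continuous_add; apply: continuous_mul.
- exact: continuous_cos.
- by apply: (C0_comp cX); cont.
- exact: continuous_sin.
- by apply: (C0_comp cY); cont.
Qed.

Lemma le_vol_scale (F : R -> R -> R -> R) Z1 Z2 : 0 <= Z1 <= Z2 -> C0 F ->
  (forall r t z, 0 <= r <= 1 -> 0 <= F r t z) -> vol Z1 F <= vol Z2 F.
Proof.
move=> /andP[Z10 Z12] cF F0; have cS := continuous_slice cF.
have S0 z : 0 <= slice F z by apply: slice_ge0 => r t r01 _; exact: F0.
rewrite /vol -(int_cat (- Z2) (- Z1) Z2 cS) -(int_cat (- Z1) Z1 Z2 cS).
have arith (x y w : R) : 0 <= x -> 0 <= w -> y <= x + (y + w) by lra.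
have p1 : 0 <= intg (- Z2) (- Z1) (slice F).
  by apply: int_ge0 => [|z _]; [rewrite lerN2|exact: S0].
have p2 : 0 <= intg Z1 Z2 (slice F).
  by apply: int_ge0 => [|z _]; [exact: Z12|exact: S0].
exact: (arith _ _ _ p1 p2).
Qed.

End DivergenceTheorem.

Section EnergyArithmetic.
Context {R : realType}.

Lemma young_abs (x k b c : R) : `|x| <= k ->
  x * (b * c) <= k / 2 * (b ^+ 2 + c ^+ 2).
Proof.
move=> xk; apply: (le_trans (ler_norm _)); rewrite !normrM.
apply: (@le_trans _ _ (k * (`|b| * `|c|))).
  by apply: ler_wpM2r => //; apply: mulr_ge0.
rewrite -mulrA; apply: ler_wpM2l; first exact: le_trans xk.
rewrite -(real_normK (num_real b)) -(real_normK (num_real c)).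
have := sqr_ge0 (`|b| - `|c|); rewrite !expr2; lra.
Qed.

Lemma vorticity_le_grad (b11 b12 b13 b21 b22 b23 b31 b32 b33 : R) :
  3 * ((b32 - b23) ^+ 2 + (b13 - b31) ^+ 2 + (b21 - b12) ^+ 2) +
    b13 ^+ 2 + b23 ^+ 2 <=
  2 * (10 * (b11 ^+ 2 + b12 ^+ 2 + b13 ^+ 2 + b21 ^+ 2 + b22 ^+ 2 + b23 ^+ 2 +
    b31 ^+ 2 + b32 ^+ 2 + b33 ^+ 2)).
Proof.
have := sqr_ge0 (b32 + b23); have := sqr_ge0 (b13 + b31).
have := sqr_ge0 (b21 + b12); have := sqr_ge0 b11; have := sqr_ge0 b22.
have := sqr_ge0 b33; have := sqr_ge0 b12; have := sqr_ge0 b21.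
have := sqr_ge0 b13; have := sqr_ge0 b31; have := sqr_ge0 b23.
have := sqr_ge0 b32; rewrite !expr2; lra.
Qed.

(** Every product in the weighted energy flux has a coefficient bounded by
    [k (1 + |a| + m)], so that Young's inequality applies to each of them in turn. *)
Lemma energy_density_bound (k m a f1 f2 u1 u2 u3 o1 o2 o3 h X Y X' Y' b13 b23 q sp : R) :
  0 <= k -> 0 <= m -> `|f1| <= k -> `|f2| <= k ->
  `|u1| <= m -> `|u2| <= m -> `|u3| <= m -> 0 <= sp ->
  3 * (o1 ^+ 2 + o2 ^+ 2 + o3 ^+ 2) + b13 ^+ 2 + b23 ^+ 2 <= 2 * q ->
  f1 * (o3 * h) + o2 * (f2 * X + f1 * X') - o1 * (f2 * Y + f1 * Y') -
    f1 * ((- a * b13 + u2 * o3 - u3 * o2) * X + (- a * b23 - u1 * o3 + u3 * o1) * Y)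
    + (a / 2 * f1 + 1 / 2 * f2) * sp <=
  k * (1 + `|a| + m) *
    (q + h ^+ 2 + 4 * (X ^+ 2 + Y ^+ 2) + (X' ^+ 2 + Y' ^+ 2) + 2 * sp).
Proof.
move=> k0 m0 w1 w2 wu1 wu2 wu3 sp0 omega.
set A := 1 + `|a| + m.
have a0 := normr_ge0 a.
have ka0 : 0 <= k * `|a| by exact: mulr_ge0.
have km0 : 0 <= k * m by exact: mulr_ge0.
have kAE : k * A = k + k * `|a| + k * m by rewrite /A !mulrDr mulr1.
have kA0 : 0 <= k * A by lra.
have g1 : `|f1| <= k * A by lra.
have g2 : `|f2| <= k * A by lra.
have nrm (b d : R) : `|b| <= d -> k * d <= k * A -> `|f1 * b| <= k * A.
  by move=> cd le; rewrite normrM; apply: le_trans le; apply: ler_pM.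
have g3 : `|f1 * a| <= k * A by apply: (nrm _ `|a|) => //; lra.
have g4 : `|- (f1 * u2)| <= k * A by rewrite normrN; apply: (nrm _ m) => //; lra.
have g5 : `|f1 * u3| <= k * A by apply: (nrm _ m) => //; lra.
have g6 : `|f1 * u1| <= k * A by apply: (nrm _ m) => //; lra.
have g7 : `|- (f1 * u3)| <= k * A by rewrite normrN.
have g8 : `|- f1| <= k * A by rewrite normrN.
have g9 : `|- f2| <= k * A by rewrite normrN.
have g10 : a / 2 * f1 + 1 / 2 * f2 <= k * A.
  have := le_trans (ler_norm _) g3; have := le_trans (ler_norm _) g2; lra.
have := ler_wpM2r sp0 g10; have := ler_wpM2l kA0 omega.
have := mulr_ge0 kA0 (sqr_ge0 h); have := mulr_ge0 kA0 (sqr_ge0 X').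
have := mulr_ge0 kA0 (sqr_ge0 Y'); have := mulr_ge0 kA0 (sqr_ge0 X).
have := mulr_ge0 kA0 (sqr_ge0 Y); have := mulr_ge0 kA0 sp0.
have := young_abs o3 h g1; have := young_abs o2 X g2.
have := young_abs o2 X' g1; have := young_abs o1 Y g9.
have := young_abs o1 Y' g8; have := young_abs b13 X g3.
have := young_abs o3 X g4; have := young_abs o2 X g5.
have := young_abs b23 Y g3; have := young_abs o3 Y g6.
have := young_abs o1 Y g7; clear.
move: (k * A) => c; lra.
Qed.

Lemma energy_const_bound (T K S S3 n1 n2 n3 n4 n6 : R) :
  n4 <= 24 * S -> n1 <= 16 * T * S3 + 4 * S -> n2 <= 4 * K * S3 ->
  n3 <= 4 * K * n6 -> S3 <= 4 * K * S -> n6 <= S -> 0 <= K -> 0 <= T -> 0 <= S ->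
  10 * S + n1 + 4 * n2 + n3 + 2 * (n4 + S3) <=
  (64 + (16 * T + 16 * K + 2) * (4 * K) + 8 * K) * S.
Proof.
move=> h4 h1 h2 h3 hS h6 K0 T0 S0.
have := ler_wpM2l (mulr_ge0 (ler0n R 16) K0) hS.
have := ler_wpM2l (mulr_ge0 (ler0n R 16) T0) hS.
have := ler_wpM2l (mulr_ge0 (ler0n R 4) K0) h6.
have := mulr_ge0 K0 S0.
lra.
Qed.

(** The constants are chosen so that the two parts of the factor add up to less
    than [9/256 = 9/16 * 1/16]: [b = 1 + |a|] is beaten by the size of [Z], and the
    velocity bound [4 mu] by the sublinearity of [mu]. *)
Lemma small_factor (K b Z mu : R) : 1 <= K -> 0 < Z -> 400 * (b * K) <= Z ->
  mu <= (2000 * K)^-1 * (2 * Z) -> 8 / (2 * Z) * (b + 4 * mu) * K <= 9 / 256.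
Proof.
move=> K1 Z0 bZ mZ; have K0 : 0 < K by exact: lt_le_trans K1.
have mK : mu * K <= 1000^-1 * Z.
  have := ler_wpM2r (ltW K0) mZ.
  by rewrite (_ : (2000 * K)^-1 * (2 * Z) * K = 1000^-1 * Z)//; field; rewrite gt_eqF.
rewrite (_ : 8 / (2 * Z) * (b + 4 * mu) * K = (4 * (b * K) + 16 * (mu * K)) / Z).
  by rewrite ler_pdivrMr//; lra.
by field; rewrite gt_eqF.
Qed.

(** [9/16] is the value of the cut-off [(1 - (z/Z)^2)^2] at [|z| = Z/2]. *)
Lemma gain16 (c y1 y2 : R) : 0 <= y2 -> c <= 9 / 256 ->
  9 / 16 * y1 <= c * y2 -> 16 * y1 <= y2.
Proof. by move=> y0 /(ler_wpM2r y0) h1 h2; lra. Qed.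

End EnergyArithmetic.

Section Doubling.
Context {R : realType}.

Lemma ler_natr_exp2 n : n%:R <= 2 ^+ n :> R.
Proof. by rewrite -natrX ler_nat ltnW// ltn_expl. Qed.

(** A nonnegative function that gains a factor [16] at each doubling of the scale
    but grows at most cubically (a factor [8]) must vanish. *)
Lemma doubling_vanish (Y : R -> R) (c Z1 : R) : 0 < Z1 ->
  (forall Z, Z1 <= Z -> 0 <= Y Z) ->
  (forall Z, Z1 <= Z -> 16 * Y Z <= Y (2 * Z)) ->
  (forall Z, Z1 <= Z -> Y Z <= c * Z ^+ 3) ->
  forall Z, Z1 <= Z -> Y Z = 0.
Proof.
move=> Z10 Y0 Yd Yc Z ZZ1; apply/eqP; rewrite eq_le Y0// andbT leNgt.
apply/negP => YZ0.
have iter n : 16 ^+ n * Y Z <= Y (2 ^+ n * Z) /\ Z1 <= 2 ^+ n * Z.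
  elim: n => [|n [IH1 IH2]]; first by rewrite !expr0 !mul1r.
  split.
    rewrite !exprS -!mulrA; apply: le_trans (Yd _ IH2).
    by apply: ler_wpM2l.
  apply: (le_trans IH2); rewrite exprS -mulrA.
  have : 0 <= 2 ^+ n * Z by rewrite mulr_ge0// (le_trans (ltW Z10)).
  lra.
have key n : n%:R * Y Z <= c * Z ^+ 3.
  have [h1 h2] := iter n; have := le_trans h1 (Yc _ h2).
  have e8 : (8 : R) = 2 ^+ 3 by ring.
  rewrite (_ : 16 ^+ n = 8 ^+ n * 2 ^+ n :> R); last first.
    by rewrite -exprMn; congr (_ ^+ _); ring.
  rewrite exprMn -exprM mulnC exprM -e8 (mulrCA c) -mulrA.
  have p8 : 0 < (8 : R) ^+ n by rewrite exprn_gt0.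
  rewrite ler_pM2l// => le; apply: le_trans le.
  by apply: ler_wpM2r; [exact: ltW|exact: ler_natr_exp2].
have := archi_boundP (normr_ge0 (c * Z ^+ 3 / Y Z)).
move=> /(le_lt_trans (ler_norm _)); rewrite ltr_pdivrMr// ltNge.
by rewrite key.
Qed.

End Doubling.

Section Oscillation.
Context {R : realType}.
Implicit Types (X : R -> R -> R -> R) (r t : R).
Variables (M z0 : R).
Hypothesis M0 : 0 <= M.

(** Points are compared through the axis, where the angle is irrelevant. *)
Lemma radial_oscillation X X1 X2 X3 r t t' : C1 X X1 X2 X3 ->
  (forall r, 0 <= r <= 1 -> `|X1 r t z0| <= M /\ `|X2 r t z0| <= M) ->
  0 <= r <= 1 -> `|X r t z0 - X 0 t' z0| <= 2 * M.
Proof.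
move=> [cX cX1 cX2 cX3 Xr Xt Xz Xp] XM /andP[r0 r1].
have c0' : continuous (fun _ : R => 0 : R) by exact: continuous_cst.
have -> : X 0 t' z0 = X 0 t z0.
  have dX (x : R) : is_derive x 1 (fun t => X 0 t z0) 0.
    by have := Xt 0 x z0; rewrite clamp01_id ?lexx ?ler01// mul0r.
  have := int_FTC2T t t' c0' dX; rewrite int_cst mulr0 => /esym/eqP.
  by rewrite subr_eq0 => /eqP.
pose D r := cos t * X1 r t z0 + sin t * X2 r t z0.
have cD : continuous D.
  rewrite /D; apply: continuous_add; apply: continuous_mul;
    [exact: continuous_cst|exact: C0_r|exact: continuous_cst|exact: C0_r].
have <- : intg 0 r D = X r t z0 - X 0 t z0.
  apply: (@int_FTC2 _ 0 r D (fun r => X r t z0)) => //.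
    by move=> x _; exact: C0_r.
  by move=> x /andP[x0 xr]; apply: Xr; rewrite x0 (lt_le_trans xr).
have DM x : 0 <= x <= r -> `|D x| <= 2 * M.
  move=> /andP[x0 xr]; have x01 : 0 <= x <= 1 by rewrite x0 (le_trans xr).
  have [h1 h2] := XM x x01; rewrite /D (le_trans (ler_normD _ _))// !normrM.
  have hc := ler_pM (normr_ge0 _) (normr_ge0 _) (cos_max t) h1.
  have hs := ler_pM (normr_ge0 _) (normr_ge0 _) (sin_max t) h2.
  by rewrite mul1r in hc hs; lra.
have cst k : continuous (fun _ : R => k : R) by exact: continuous_cst.
rewrite ler_norml; apply/andP; split.
  apply: (@le_trans _ _ (intg 0 r (fun=> - (2 * M)))).
    by rewrite int_cst; have := ler_piMl M0 r1; lra.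
  by apply: le_int => // x /DM; rewrite ler_norml => /andP[].
apply: (@le_trans _ _ (intg 0 r (fun=> 2 * M))).
  by apply: le_int => // x /DM; rewrite ler_norml => /andP[].
by rewrite int_cst; have := ler_piMl M0 r1; lra.
Qed.

Lemma oscillation X X1 X2 X3 r t r' t' : C1 X X1 X2 X3 ->
  (forall r, 0 <= r <= 1 -> `|X1 r t z0| <= M /\ `|X2 r t z0| <= M) ->
  (forall r, 0 <= r <= 1 -> `|X1 r t' z0| <= M /\ `|X2 r t' z0| <= M) ->
  0 <= r <= 1 -> 0 <= r' <= 1 -> `|X r t z0 - X r' t' z0| <= 4 * M.
Proof.
move=> CX XM XM' r01 r'01.
have h1 := radial_oscillation t CX XM r01.
have h2 := radial_oscillation t CX XM' r'01.
rewrite (_ : _ - _ = (X r t z0 - X 0 t z0) - (X r' t' z0 - X 0 t z0)); last by ring.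
apply: (le_trans (ler_normB _ _)); lra.
Qed.

End Oscillation.

Section Energy.
Context {R : realType}.
Notation tau := (2 * pi : R).
Notation fun3 := (R -> R -> R -> R).
Implicit Types (r t z : R).
(* [vij] stands for [d_j v_i] and [vijk] for [d_k d_j v_i]. The velocity is
   [v + a e_3], where [v_3] has zero mean on each cross-section. *)
Variables (v1 v2 v3 v11 v12 v13 v21 v22 v23 v31 v32 v33 : fun3).
Variables (v111 v112 v113 v121 v122 v123 v131 v132 v133 : fun3).
Variables (v211 v212 v213 v221 v222 v223 v231 v232 v233 : fun3).
Variables (v311 v312 v313 v321 v322 v323 v331 v332 v333 : fun3).
Variables (p p1 p2 p3 : fun3) (a : R).
Hypotheses (Cv1 : C1 v1 v11 v12 v13) (Cv2 : C1 v2 v21 v22 v23)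
  (Cv3 : C1 v3 v31 v32 v33) (Cp : C1 p p1 p2 p3).
Hypotheses (Cv11 : C1 v11 v111 v112 v113) (Cv12 : C1 v12 v121 v122 v123)
  (Cv13 : C1 v13 v131 v132 v133) (Cv21 : C1 v21 v211 v212 v213)
  (Cv22 : C1 v22 v221 v222 v223) (Cv23 : C1 v23 v231 v232 v233)
  (Cv31 : C1 v31 v311 v312 v313) (Cv32 : C1 v32 v321 v322 v323)
  (Cv33 : C1 v33 v331 v332 v333).
Hypothesis div0 : forall r t z, 0 <= r <= 1 ->
  v11 r t z + v22 r t z + v33 r t z = 0.
Hypothesis div1 : forall r t z, 0 <= r <= 1 ->
  v111 r t z + v212 r t z + v313 r t z = 0.
Hypothesis div2 : forall r t z, 0 <= r <= 1 ->
  v121 r t z + v222 r t z + v323 r t z = 0.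
Hypothesis ns1 : forall r t z, 0 <= r <= 1 ->
  v1 r t z * v11 r t z + v2 r t z * v12 r t z + v3 r t z * v13 r t z
  + a * v13 r t z + p1 r t z = v111 r t z + v122 r t z + v133 r t z.
Hypothesis ns2 : forall r t z, 0 <= r <= 1 ->
  v1 r t z * v21 r t z + v2 r t z * v22 r t z + v3 r t z * v23 r t z
  + a * v23 r t z + p2 r t z = v211 r t z + v222 r t z + v233 r t z.
Hypothesis ns3 : forall r t z, 0 <= r <= 1 ->
  v1 r t z * v31 r t z + v2 r t z * v32 r t z + v3 r t z * v33 r t z
  + a * v33 r t z + p3 r t z = v311 r t z + v322 r t z + v333 r t z.
Hypothesis impermeable : forall t z, cos t * v1 1 t z + sin t * v2 1 t z = 0.
Hypothesis curl3_bd : forall t z, v21 1 t z = v12 1 t z.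
Hypothesis curl_bd : forall t z,
  (v32 1 t z - v23 1 t z) * sin t = (v13 1 t z - v31 1 t z) * cos t.
Hypothesis flux0 : forall z, slice (fun r t z => r * v3 r t z) z = 0.

Let c1 := C1_C0 Cv1. Let c2 := C1_C0 Cv2. Let c3 := C1_C0 Cv3.
Let c11 := C1_C0 Cv11. Let c12 := C1_C0 Cv12. Let c13 := C1_C0 Cv13.
Let c21 := C1_C0 Cv21. Let c22 := C1_C0 Cv22. Let c23 := C1_C0 Cv23.
Let c31 := C1_C0 Cv31. Let c32 := C1_C0 Cv32. Let c33 := C1_C0 Cv33.

Definition grad2 : fun3 := fun r t z =>
  v11 r t z ^+ 2 + v12 r t z ^+ 2 + v13 r t z ^+ 2 +
  v21 r t z ^+ 2 + v22 r t z ^+ 2 + v23 r t z ^+ 2 +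
  v31 r t z ^+ 2 + v32 r t z ^+ 2 + v33 r t z ^+ 2.
Definition speed2 : fun3 := fun r t z =>
  v1 r t z ^+ 2 + v2 r t z ^+ 2 + v3 r t z ^+ 2.
(** The total head pressure of [v], Bernoulli's quantity: in the energy balance
    [p] and [|v|^2/2] are transported together. *)
Definition head : fun3 := fun r t z => p r t z + 1 / 2 * speed2 r t z.
Definition head_grad (pk u1 u2 u3 : fun3) : fun3 := fun r t z =>
  pk r t z + v1 r t z * u1 r t z + v2 r t z * u2 r t z + v3 r t z * u3 r t z.

Lemma C0_grad2 : C0 grad2.
Proof. by rewrite /grad2; c0. Qed.

Lemma C0_speed2 : C0 speed2.
Proof. by rewrite /speed2; c0. Qed.

Lemma C1_speed2 : C1 (fun r t z => 1 / 2 * speed2 r t z)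
  (head_grad (fun _ _ _ => 0) v11 v21 v31)
  (head_grad (fun _ _ _ => 0) v12 v22 v32)
  (head_grad (fun _ _ _ => 0) v13 v23 v33).
Proof.
have C := C1_mul (C1_cst (1 / 2)) (C1_add (C1_add (C1_mul Cv1 Cv1)
  (C1_mul Cv2 Cv2)) (C1_mul Cv3 Cv3)).
by apply: (C1_eq C) => r t z; rewrite /head_grad; field.
Qed.

Lemma C1_head : C1 head (head_grad p1 v11 v21 v31) (head_grad p2 v12 v22 v32)
  (head_grad p3 v13 v23 v33).
Proof.
by apply: (C1_eq (C1_add Cp C1_speed2)) => r t z; rewrite /head_grad; ring.
Qed.

(** [x . v_h], which on the wall is the normal velocity. *)
Definition normal_flow : fun3 := fun r t z =>
  clamp01 r * cos t * v1 r t z + clamp01 r * sin t * v2 r t z.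

Lemma C1_normal_flow : C1 normal_flow
  (fun r t z => v1 r t z + clamp01 r * cos t * v11 r t z + clamp01 r * sin t * v21 r t z)
  (fun r t z => v2 r t z + clamp01 r * cos t * v12 r t z + clamp01 r * sin t * v22 r t z)
  (fun r t z => clamp01 r * cos t * v13 r t z + clamp01 r * sin t * v23 r t z).
Proof.
apply: (C1_eq (C1_add (C1_mul C1_x Cv1) (C1_mul C1_y Cv2))) => r t z; ring.
Qed.

Lemma normal_flow1 t z : normal_flow 1 t z = 0.
Proof. by rewrite /normal_flow clamp01_ge1// !mul1r. Qed.

(** Because the normal velocity vanishes all along the boundary, so do its
    tangential derivatives. With the condition on the vorticity this gives
    [v . d_n v = - |v_h|^2]: the curvature of the wall helps. *)
Lemma boundary_work t z :
  cos t * head_grad (fun _ _ _ => 0) v11 v21 v31 1 t z +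
  sin t * head_grad (fun _ _ _ => 0) v12 v22 v32 1 t z =
  - (v1 1 t z ^+ 2 + v2 1 t z ^+ 2).
Proof.
case: C1_normal_flow => _ _ _ _ _ dt dz _.
have e0 := impermeable t z; have e4 := curl3_bd t z; have e5 := curl_bd t z.
have c0 : is_derive t 1 (fun t => normal_flow 1 t z) 0.
  rewrite (_ : (fun t => _) = cst 0); first exact: is_derive_cst.
  by apply/funext => t'; exact: normal_flow1.
have d0 : is_derive z 1 (normal_flow 1 t) 0.
  rewrite (_ : normal_flow 1 t = cst 0); first exact: is_derive_cst.
  by apply/funext => z'; exact: normal_flow1.
have e1 := is_derive_unique (dt 1 t z) c0.
have e2 := is_derive_unique (dz 1 t z) d0.
rewrite clamp01_ge1// !mul1r in e1 e2.
have cs := cos2Dsin2 t.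
rewrite /head_grad; move: e0 e1 e2 e4 e5 cs.
set c := cos t; set s := sin t.
set x1 := v1 1 t z; set x2 := v2 1 t z; set x3 := v3 1 t z.
set x11 := v11 1 t z; set x12 := v12 1 t z; set x13 := v13 1 t z.
set x21 := v21 1 t z; set x22 := v22 1 t z; set x23 := v23 1 t z.
set x31 := v31 1 t z; set x32 := v32 1 t z.
move=> e0 e1 e2 e4 e5 cs.
pose w := c * x2 - s * x1.
have f1 : x1 = - s * w.
  by rewrite /w -[LHS]mul1r -cs; transitivity (- s * (c * x2 - s * x1) + c * (c * x1 + s * x2)); [ring|rewrite e0; ring].
have f2 : x2 = c * w.
  by rewrite /w -[LHS]mul1r -cs; transitivity (c * (c * x2 - s * x1) + s * (c * x1 + s * x2)); [ring|rewrite e0; ring].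
have e3 : c * x31 + s * x32 = 0.
  by rewrite -e2; transitivity (c * x31 + (x32 - x23) * s + s * x23); [ring|rewrite e5; ring].
transitivity (x1 * (c * x11 + s * x12) + x2 * (c * x21 + s * x22)
  + x3 * (c * x31 + s * x32)); first by ring.
rewrite e3 mulr0 addr0 f1 f2 e4.
transitivity (w * (c * (x2 + c * x12 + s * x22) - s * (x1 + c * x11 + s * x21)
  - (c * x2 - s * x1) )); first by rewrite e4; ring.
rewrite e1 -/w; transitivity (- ((c ^+ 2 + s ^+ 2) * w ^+ 2)); last by ring.
by rewrite cs; ring.
Qed.

Section Weight.
Variables (phi phi' phi'' : R -> R) (Z : R).
Hypotheses (cphi : continuous phi) (cphi' : continuous phi')
  (cphi'' : continuous phi'').
Hypotheses (dphi : forall z, is_derive z 1 phi (phi' z))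
  (dphi' : forall z, is_derive z 1 phi' (phi'' z)).
Hypotheses (phiZ : phi Z = 0) (phiNZ : phi (- Z) = 0) (phi'Z : phi' Z = 0)
  (phi'NZ : phi' (- Z) = 0).
Hypotheses (Z0 : 0 <= Z) (phi0 : forall z, - Z <= z <= Z -> 0 <= phi z).

Let Cphi := C1_fz cphi cphi' dphi.
Let Cphi' := C1_fz cphi' cphi'' dphi'.

(** The fields [CX1], [CX2], [CX3] in the proof are the components of
    [phi grad |v|^2/2 - phi q v], corrected by [- (a phi + phi') |v|^2/2] in the
    axial direction; the divergence of this field is the difference of the two
    integrands. *)
Lemma weighted_energy :
  vol Z (fun r t z => r * (phi z * grad2 r t z)) <=
  vol Z (fun r t z => r * (phi' z * (v3 r t z * head r t z) +
    a / 2 * phi' z * speed2 r t z + 1 / 2 * phi'' z * speed2 r t z)).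
Proof.
have [csp cgr] := (C0_speed2, C0_grad2).
have ch : C0 head := C1_C0 C1_head.
have [[cp1 cp2] cp3] := (C1_C0x Cp, C1_C0y Cp, C1_C0z Cp).
have CX1 := C1_mul Cphi (C1_add (C1_add (C1_add (C1_mul Cv1 Cv11) (C1_mul Cv2 Cv21))
  (C1_mul Cv3 Cv31)) (C1_opp (C1_mul Cv1 C1_head))).
have CX2 := C1_mul Cphi (C1_add (C1_add (C1_add (C1_mul Cv1 Cv12) (C1_mul Cv2 Cv22))
  (C1_mul Cv3 Cv32)) (C1_opp (C1_mul Cv2 C1_head))).
have CX3 := C1_add (C1_mul Cphi (C1_add (C1_add (C1_add (C1_add (C1_mul Cv1 Cv13)
  (C1_mul Cv2 Cv23)) (C1_mul Cv3 Cv33)) (C1_opp (C1_mul Cv3 C1_head)))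
  (C1_opp (C1_mul (C1_cst a) C1_speed2))))
  (C1_opp (C1_mul Cphi' C1_speed2)).
have := vol_div_le0 CX1 CX2 CX3 Z0.
set D := (X in _ -> _ -> _ -> vol Z X <= 0) => H.
have {}H : vol Z D <= 0.
  apply: H => [r t|r t|t z zZ].
  - by rewrite phiZ phi'Z; ring.
  - by rewrite phiNZ phi'NZ; ring.
  - have := boundary_work t z; rewrite /head_grad !add0r => bw.
    have im := impermeable t z.
    rewrite (_ : _ + _ = phi z * ((cos t * (v1 1 t z * v11 1 t z +
      v2 1 t z * v21 1 t z + v3 1 t z * v31 1 t z) + sin t * (v1 1 t z * v12 1 t z +
      v2 1 t z * v22 1 t z + v3 1 t z * v32 1 t z)) -
      (cos t * v1 1 t z + sin t * v2 1 t z) * head 1 t z)); last by ring.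
    rewrite im bw mul0r subr0; apply: mulr_ge0_le0; first exact: phi0.
    by rewrite oppr_le0 addr_ge0// sqr_ge0.
rewrite (_ : vol Z _ = vol Z D + vol Z (fun r t z => r * (phi' z * (v3 r t z * head r t z) +
    a / 2 * phi' z * speed2 r t z + 1 / 2 * phi'' z * speed2 r t z))).
  by rewrite gerDr.
rewrite -volD; last by c0.
  2: by apply: C0_mul; [c0|apply: C0_add; [apply: C0_add;
    [exact: (C1_C0x CX1)|exact: (C1_C0y CX2)]|exact: (C1_C0z CX3)]].
apply: (eq_vol Z0) => r t z r01 _ _.
rewrite /D /grad2 /head_grad.
have e1 : p1 r t z = v111 r t z + v122 r t z + v133 r t z -
  (v1 r t z * v11 r t z + v2 r t z * v12 r t z + v3 r t z * v13 r t z
  + a * v13 r t z) by rewrite -(ns1 t z r01); ring.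
have e2 : p2 r t z = v211 r t z + v222 r t z + v233 r t z -
  (v1 r t z * v21 r t z + v2 r t z * v22 r t z + v3 r t z * v23 r t z
  + a * v23 r t z) by rewrite -(ns2 t z r01); ring.
have e3 : p3 r t z = v311 r t z + v322 r t z + v333 r t z -
  (v1 r t z * v31 r t z + v2 r t z * v32 r t z + v3 r t z * v33 r t z
  + a * v33 r t z) by rewrite -(ns3 t z r01); ring.
have e4 : v33 r t z = - (v11 r t z + v22 r t z).
  by apply/eqP; rewrite -addr_eq0 addrC div0.
rewrite e1 e2 e3 e4 /speed2.
by field.
Qed.

Notation Wx := (inv_div_x v3).
Notation Wy := (inv_div_y v3).
Definition om1 : fun3 := fun r t z => v32 r t z - v23 r t z.
Definition om2 : fun3 := fun r t z => v13 r t z - v31 r t z.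
Definition om3 : fun3 := fun r t z => v21 r t z - v12 r t z.

(** The pressure flux, after the pressure gradient has been traded against the
    field [W] with [div W = v3] and the second derivatives of [v] have been moved
    to [W] by the identity [- Lap v = curl (curl v)]. *)
Lemma pressure_flux :
  vol Z (fun r t z => r * (phi' z * (v3 r t z * head r t z))) =
  vol Z (fun r t z => r * (
    phi' z * (om3 r t z * (4 * angular_primitive v3 t z -
      ray_defect (angular_derivative v31 v32) r t z)) +
    om2 r t z * (phi'' z * Wx r t z + phi' z * inv_div_x v33 r t z) -
    om1 r t z * (phi'' z * Wy r t z + phi' z * inv_div_y v33 r t z) -
    phi' z * ((- a * v13 r t z + v2 r t z * om3 r t z - v3 r t z * om2 r t z) * Wx r t z
      + (- a * v23 r t z - v1 r t z * om3 r t z + v3 r t z * om1 r t z) * Wy r t z))).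
Proof.
have Com3 : C1 om3 (fun r t z => v211 r t z - v121 r t z)
    (fun r t z => v212 r t z - v122 r t z) (fun r t z => v213 r t z - v123 r t z).
  by apply: (C1_eq (C1_add Cv21 (C1_opp Cv12))).
have co1 : C0 om1 by rewrite /om1; c0.
have co2 : C0 om2 by rewrite /om2; c0.
have co3 : C0 om3 by rewrite /om3; c0.
have cx := C0_inv_div_x c3; have cy := C0_inv_div_y c3.
have cxz := C0_inv_div_x c33; have cyz := C0_inv_div_y c33.
have cft : C0 (angular_derivative v31 v32) by rewrite /angular_derivative; c0.
have cN := C0_ray_defect cft; have cG := C0_angular_primitive c3.
have [[c133 c313] [c233 c323]] := ((C1_C0z Cv13, C1_C0z Cv31),
  (C1_C0z Cv23, C1_C0z Cv32)).
have [[c211 c121] [c212 c122]] := ((C1_C0x Cv21, C1_C0x Cv12),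
  (C1_C0y Cv21, C1_C0y Cv12)).
have ch := C1_C0 C1_head.
have [ch1 ch2] := (C1_C0x C1_head, C1_C0y C1_head).
(* the axial part of [curl (curl v)], integrated by parts in [z] *)
have zpart : vol Z (fun r t z => r * (
    (v133 r t z - v313 r t z) * (phi' z * Wx r t z) -
    (v323 r t z - v233 r t z) * (phi' z * Wy r t z) +
    (om2 r t z * (phi'' z * Wx r t z + phi' z * inv_div_x v33 r t z) -
    om1 r t z * (phi'' z * Wy r t z + phi' z * inv_div_y v33 r t z)))) = 0.
  apply: (vol_dz (X := fun r t z => r * (om2 r t z * (phi' z * Wx r t z) -
    om1 r t z * (phi' z * Wy r t z)))) => [| |r t z|r t|r t].
  - by c0.
  - by c0.
  - have [dx dy] := inv_div_dz r t z c3 c33 (C1_z Cv3).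
    have [[d13 d31] [d32 d23]] := ((C1_z Cv13 r t z, C1_z Cv31 r t z),
      (C1_z Cv32 r t z, C1_z Cv23 r t z)).
    move: dx dy; rewrite /om1 /om2.
    move: (Wx) (Wy) (inv_div_x v33) (inv_div_y v33) => X Y X' Y' dx dy.
    by move: (dphi' z) d13 d31 d32 d23 dx dy; clear => *; deriv.
  - by rewrite phi'Z; ring.
  - by rewrite phi'NZ; ring.
have hpart : vol Z (fun r t z => r * (phi' z * (v3 r t z * head r t z))) =
  vol Z (fun r t z => r * (phi' z * (om3 r t z * (4 * angular_primitive v3 t z -
      ray_defect (angular_derivative v31 v32) r t z)) -
    ((v133 r t z - v313 r t z) * (phi' z * Wx r t z) -
    (v323 r t z - v233 r t z) * (phi' z * Wy r t z)) -
    phi' z * ((- a * v13 r t z + v2 r t z * om3 r t z - v3 r t z * om2 r t z) * Wx r t z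
      + (- a * v23 r t z - v1 r t z * om3 r t z + v3 r t z * om1 r t z) * Wy r t z))).
  congr (intg _ _ _); apply/funext => z.
  have om3_bd t' z' : om3 1 t' z' = 0 by rewrite /om3 curl3_bd subrr.
  have wc := weak_curl Cv3 Com3 (flux0 z) om3_bd.
  have wd := weak_divergence Cv3 C1_head (flux0 z).
  transitivity (phi' z * slice (fun r t z => r * (head r t z * v3 r t z)) z).
    rewrite -sliceZ; last by c0.
    by apply: eq_slice => r t _ _; ring.
  rewrite wd.
  pose L r t z := (- a * v13 r t z + v2 r t z * om3 r t z - v3 r t z * om2 r t z) * Wx r t z
      + (- a * v23 r t z - v1 r t z * om3 r t z + v3 r t z * om1 r t z) * Wy r t z.
  pose M r t z := (v133 r t z - v313 r t z) * Wx r t z -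
    (v323 r t z - v233 r t z) * Wy r t z.
  have cL : C0 L by rewrite /L; c0.
  have cM : C0 M by rewrite /M; c0.
  pose B r t z := r * ((v212 r t z - v122 r t z) * Wx r t z -
    (v211 r t z - v121 r t z) * Wy r t z).
  have cB : C0 B by rewrite /B; c0.
  transitivity (phi' z * (slice B z - slice (fun r t z => r * (M r t z + L r t z)) z)).
    congr (_ * _); rewrite -!sliceN; [|by c0|by c0]; rewrite -sliceD; [|by c0|by c0].
    apply: eq_slice => r t r01 _; rewrite /B /M /L /head_grad /om1 /om2 /om3.
    have e1 : p1 r t z = v111 r t z + v122 r t z + v133 r t z -
      (v1 r t z * v11 r t z + v2 r t z * v12 r t z + v3 r t z * v13 r t z
      + a * v13 r t z) by rewrite -(ns1 t z r01); ring.
    have e2 : p2 r t z = v211 r t z + v222 r t z + v233 r t z -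
      (v1 r t z * v21 r t z + v2 r t z * v22 r t z + v3 r t z * v23 r t z
      + a * v23 r t z) by rewrite -(ns2 t z r01); ring.
    have e3 : v111 r t z = - (v212 r t z + v313 r t z).
      by apply/eqP; rewrite -addr_eq0 addrA div1.
    have e4 : v222 r t z = - v121 r t z - v323 r t z.
      by rewrite -[RHS]addr0 -(div2 t z r01); ring.
    rewrite e1 e2 e3 e4; ring.
  rewrite /B wc mulrBr -!sliceZ; [|by c0|by c0]; rewrite -sliceN; last by c0.
  rewrite -sliceD; [|by c0|by c0].
  by apply: eq_slice => r t _ _; rewrite /M /L; ring.
rewrite hpart -[LHS]addr0 -[in LHS]zpart -volD; [|by c0|by c0].
by apply: (eq_vol Z0) => r t z _ _ _; ring.
Qed.

(** Integrate the divergence of [(x . v_h) v_h], whose flux through the circle is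
    zero since [x . v_h] vanishes there: its zeroth-order part is [|v_h|^2], the
    rest is [|v_h|] times a first derivative. *)
Lemma poincare_tangent z :
  slice (fun r t z => r * (v1 r t z ^+ 2 + v2 r t z ^+ 2)) z <=
  24 * slice (fun r t z => r * grad2 r t z) z.
Proof.
have cg := C0_grad2.
have cn := C1_C0 C1_normal_flow.
have := slice_div z (C1_mul C1_normal_flow Cv1) (C1_mul C1_normal_flow Cv2).
rewrite [X in _ = X -> _](_ : _ = 0); last first.
  transitivity (intg 0 tau (fun=> 0 : R)); last by rewrite int_cst mulr0.
  congr (intg _ _ _); apply/funext => t; rewrite normal_flow1; ring.
set D := (X in slice X z = 0 -> _) => D0.
have cD : C0 D by rewrite /D; c0.
rewrite -[leRHS]addr0 -[X in _ <= _ + X](mulr0 2) -D0 -(sliceZ 2 z cD).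
rewrite -sliceZ; last by c0.
rewrite -sliceD; [|by c0..].
apply: le_slice; [by c0..|] => r t r01 _; rewrite /D /grad2 /normal_flow.
rewrite clamp01_id//; move/andP: r01 => [r0 r1].
have r2 : r ^+ 2 <= 1 by rewrite expr_le1.
have cs := cos2Dsin2 t.
have [cc ss] := (sqr_ge0 (cos t), sqr_ge0 (sin t)).
have x1 : (r * cos t) ^+ 2 <= 1.
  by rewrite exprMn; apply: mulr_ile1 => //; rewrite ?sqr_ge0 -?cs ?lerDl ?lerDr.
have y1 : (r * sin t) ^+ 2 <= 1.
  by rewrite exprMn; apply: mulr_ile1 => //; rewrite ?sqr_ge0 -?cs ?lerDl ?lerDr.
move: x1 y1; set x := r * cos t; set y := r * sin t => x1 y1.
rewrite [leRHS](_ : _ = r * (24 * grad2 r t z + 2 *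
  ((v1 r t z + x * v11 r t z + y * v21 r t z) * v1 r t z +
   (v2 r t z + x * v12 r t z + y * v22 r t z) * v2 r t z +
   (x * v1 r t z + y * v2 r t z) * (v11 r t z + v22 r t z)))); last first.
  by rewrite /grad2; ring.
apply: ler_wpM2l => //; rewrite /grad2 -subr_ge0.
move: (v1 r t z) (v2 r t z) (v11 r t z) (v12 r t z) (v13 r t z) (v21 r t z)
  (v22 r t z) (v23 r t z) (v31 r t z) (v32 r t z) (v33 r t z).
move=> b1 b2 b11 b12 b13 b21 b22 b23 b31 b32 b33.
have sq3 (e f g : R) : (e + f + g) ^+ 2 <= 3 * (e ^+ 2 + f ^+ 2 + g ^+ 2).
  have := sqr_ge0 (e - f); have := sqr_ge0 (f - g); have := sqr_ge0 (e - g).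
  by rewrite !expr2; lra.
have shrink (e b : R) : e ^+ 2 <= 1 -> (e * b) ^+ 2 <= b ^+ 2.
  by move=> e1; rewrite exprMn ler_piMl ?sqr_ge0.
have h1 := sq3 (x * (2 * b11)) (y * b21) (x * b22).
have h2 := sq3 (x * b12) (y * (2 * b22)) (y * b11).
have h3 := shrink x (2 * b11) x1; have h4 := shrink y b21 y1.
have h5 := shrink x b22 x1; have h6 := shrink x b12 x1.
have h7 := shrink y (2 * b22) y1; have h8 := shrink y b11 y1.
have g1 := sqr_ge0 (b1 + (x * (2 * b11) + y * b21 + x * b22)).
have g2 := sqr_ge0 (b2 + (x * b12 + y * (2 * b22) + y * b11)).
have := sqr_ge0 b11; have := sqr_ge0 b12; have := sqr_ge0 b13.
have := sqr_ge0 b21; have := sqr_ge0 b22; have := sqr_ge0 b23.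
have := sqr_ge0 b31; have := sqr_ge0 b32; have := sqr_ge0 b33.
rewrite !expr2 in h1 h2 h3 h4 h5 h6 h7 h8 g1 g2 *.
lra.
Qed.

(** The sum of the constants of the Poincare inequalities and of the bounds on
    [W], with the multiplicities of [energy_density_bound]. *)
Definition energy_const : R := let K := @inv_div_const R in
  64 + (16 * tau ^+ 2 + 16 * K + 2) * (4 * K) + 8 * K.

(** [k] bounds the derivatives of the weight and [m] the velocity; every term on
    the right of [weighted_energy] is then quadratic in quantities controlled by
    the gradient on the same cross-section. *)
Lemma energy_bound (k m : R) : 0 <= k -> 0 <= m ->
  (forall z, - Z <= z <= Z -> `|phi' z| <= k /\ `|phi'' z| <= k) ->
  (forall r t z, 0 <= r <= 1 -> 0 <= t <= tau -> - Z <= z <= Z ->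
    [/\ `|v1 r t z| <= m, `|v2 r t z| <= m & `|v3 r t z| <= m]) ->
  vol Z (fun r t z => r * (phi z * grad2 r t z)) <=
  k * (1 + `|a| + m) * energy_const * vol Z (fun r t z => r * grad2 r t z).
Proof.
move=> k0 m0 phik vm; apply: (le_trans weighted_energy).
have cg := C0_grad2; have csp := C0_speed2.
have ch : C0 head := C1_C0 C1_head.
have co1 : C0 om1 by rewrite /om1; c0.
have co2 : C0 om2 by rewrite /om2; c0.
have co3 : C0 om3 by rewrite /om3; c0.
have cx := C0_inv_div_x c3; have cy := C0_inv_div_y c3.
have cxz := C0_inv_div_x c33; have cyz := C0_inv_div_y c33.
have cft : C0 (angular_derivative v31 v32) by rewrite /angular_derivative; c0.
have cN := C0_ray_defect cft; have cG := C0_angular_primitive c3.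
pose H r t z := 4 * angular_primitive v3 t z -
  ray_defect (angular_derivative v31 v32) r t z.
have cH : C0 H by rewrite /H; c0.
set A := 1 + `|a| + m.
have a0 := normr_ge0 a.
have A1 : 1 <= A by rewrite /A; lra.
rewrite (_ : vol Z _ =
  vol Z (fun r t z => r * (phi' z * (v3 r t z * head r t z))) +
  vol Z (fun r t z => r * ((a / 2 * phi' z + 1 / 2 * phi'' z) * speed2 r t z))); last first.
  by rewrite -volD; [apply: (eq_vol Z0) => r t z _ _ _; field|c0|c0].
rewrite pressure_flux -volD; [|by c0|by c0].
pose Q1 r t z := 10 * grad2 r t z.
pose Q2 r t z := H r t z ^+ 2.
pose Q3 r t z := 4 * (Wx r t z ^+ 2 + Wy r t z ^+ 2).
pose Q4 r t z := inv_div_x v33 r t z ^+ 2 + inv_div_y v33 r t z ^+ 2.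
pose Q5 r t z := 2 * speed2 r t z.
apply: (@le_trans _ _ (vol Z (fun r t z => k * A * (r * (
  Q1 r t z + Q2 r t z + Q3 r t z + Q4 r t z + Q5 r t z))))).
  apply: (le_vol Z0); [by c0|by rewrite /Q1 /Q2 /Q3 /Q4 /Q5; c0|].
  move=> r t z r01 t01 zZ; rewrite -mulrDr [leRHS]mulrCA; apply: ler_wpM2l.
    by move/andP: r01 => [].
  have [f1 f2] := phik z zZ; have [w1 w2 w3] := vm r t z r01 t01 zZ.
  have sp0 : 0 <= speed2 r t z by rewrite /speed2 !addr_ge0// sqr_ge0.
  have om := vorticity_le_grad (v11 r t z) (v12 r t z) (v13 r t z) (v21 r t z)
    (v22 r t z) (v23 r t z) (v31 r t z) (v32 r t z) (v33 r t z).
  exact: (energy_density_bound a (H r t z) (Wx r t z) (Wy r t z)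
    (inv_div_x v33 r t z) (inv_div_y v33 r t z) k0 m0 f1 f2 w1 w2 w3 sp0 om).
rewrite volZ; last by rewrite /Q1 /Q2 /Q3 /Q4 /Q5; c0.
rewrite -!mulrA; apply: ler_wpM2l => //; apply: ler_wpM2l; first by lra.
rewrite -volZ; last by c0.
apply: le_int; [by rewrite (le_trans _ Z0)// oppr_le0|apply: continuous_slice; rewrite /Q1 /Q2 /Q3 /Q4 /Q5; c0
  |apply: continuous_slice; c0|move=> z zZ].
rewrite sliceZ; last by c0.
set S := slice (fun r t z => r * grad2 r t z) z.
have b3 := poincare_mean0 Cv3 (flux0 z).
have bt := poincare_tangent z; rewrite -/S in bt.
have bc := bogovskii_curl_bound z c3 (C1_C0x Cv3) (C1_C0y Cv3).
have bw := inv_div_bound z c3; have bwz := inv_div_bound z c33.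
set S3 := slice (fun r t z => r * v3 r t z ^+ 2) z in b3 bc bw.
have s33 : slice (fun r t z => r * v33 r t z ^+ 2) z <= S.
  apply: le_slice; [by c0..|] => r t /andP[r0 _] _; apply: ler_wpM2l => //.
  by rewrite /grad2 lerDr !addr_ge0// sqr_ge0.
have s3h : slice (fun r t z => r * (v31 r t z ^+ 2 + v32 r t z ^+ 2)) z <= S.
  apply: le_slice; [by c0..|] => r t /andP[r0 _] _; apply: ler_wpM2l => //.
  rewrite /grad2 -subr_ge0 [X in 0 <= X](_ : _ = v11 r t z ^+ 2 + v12 r t z ^+ 2 +
    v13 r t z ^+ 2 + v21 r t z ^+ 2 + v22 r t z ^+ 2 + v23 r t z ^+ 2 +
    v33 r t z ^+ 2); last by ring.
  by rewrite !addr_ge0// sqr_ge0.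
rewrite (_ : slice _ z = 10 * S + slice (fun r t z => r * Q2 r t z) z +
  4 * slice (fun r t z => r * (Wx r t z ^+ 2 + Wy r t z ^+ 2)) z +
  slice (fun r t z => r * Q4 r t z) z +
  2 * (slice (fun r t z => r * (v1 r t z ^+ 2 + v2 r t z ^+ 2)) z + S3)); last first.
  pose T1 r t z := r * grad2 r t z; pose T2 r t z := r * Q2 r t z.
  pose T3 r t z := r * (Wx r t z ^+ 2 + Wy r t z ^+ 2).
  pose T4 r t z := r * Q4 r t z.
  pose T5 r t z := r * (v1 r t z ^+ 2 + v2 r t z ^+ 2).
  pose T6 r t z := r * v3 r t z ^+ 2.
  have cT1 : C0 T1 by rewrite /T1; c0.
  have cT2 : C0 T2 by rewrite /T2 /Q2; c0.
  have cT3 : C0 T3 by rewrite /T3; c0.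
  have cT4 : C0 T4 by rewrite /T4 /Q4; c0.
  have cT5 : C0 T5 by rewrite /T5; c0.
  have cT6 : C0 T6 by rewrite /T6; c0.
  rewrite (@eq_slice _ _ (fun r t z => 10 * T1 r t z + T2 r t z + 4 * T3 r t z +
    T4 r t z + 2 * (T5 r t z + T6 r t z))) => [|r t _ _]; last first.
    by rewrite /Q1 /Q3 /Q5 /speed2 /T1 /T2 /T3 /T4 /T5 /T6; ring.
  move: cT1 cT2 cT3 cT4 cT5 cT6; rewrite -/T2 -/T3 -/T4 -/T5 /S /S3 -/T1 -/T6.
  move: (T1) (T2) (T3) (T4) (T5) (T6) => U1 U2 U3 U4 U5 U6; clear => *.
  rewrite sliceD; [|by c0..]; rewrite sliceD; [|by c0..].
  rewrite sliceD; [|by c0..]; rewrite sliceD; [|by c0..].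
  rewrite sliceZ//; rewrite sliceZ//; rewrite sliceZ; last by c0.
  by rewrite sliceD.
have K0 : 0 <= @inv_div_const R.
  by rewrite /inv_div_const addr_ge0// divr_ge0// sqr_ge0.
have tt0 : 0 <= tau ^+ 2 by exact: sqr_ge0.
have S3le : S3 <= 4 * @inv_div_const R * S.
  apply: (le_trans b3); apply: ler_wpM2l s3h; exact: mulr_ge0.
have S0 : 0 <= S.
  apply: slice_ge0 => r t /andP[r0 _] _; apply: mulr_ge0 => //; rewrite /grad2.
  by rewrite !addr_ge0// sqr_ge0.
have bc' := le_trans bc (lerD (lexx _) (ler_wpM2l (ler0n R 4) s3h)).
exact: (energy_const_bound bt bc' bw bwz S3le s33 K0 tt0 S0).
Qed.

End Weight.

(** * From the gradient to the dissipation *)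

Section SupBound.
Variables (M z0 : R).
Hypothesis gradM : forall r t, 0 <= r <= 1 -> 0 <= t <= tau ->
  grad2 r t z0 <= M ^+ 2.
Hypothesis M0 : 0 <= M.

Lemma grad_entry_le r t (b : R) : 0 <= r <= 1 -> 0 <= t <= tau ->
  b ^+ 2 <= grad2 r t z0 -> `|b| <= M.
Proof.
move=> r01 t01 bg; rewrite -(ler_pXn2r (n := 2)) ?nnegrE//.
by rewrite real_normK ?num_real//; apply: le_trans bg (gradM r01 t01).
Qed.

(** On each cross-section the oscillation of [v] is at most [4 M]. Each component
    has a zero or a zero mean there: by impermeability [v_1] vanishes at angle [0]
    and [v_2] at angle [pi/2] of the wall. *)
Lemma velocity_bound r t : 0 <= r <= 1 -> 0 <= t <= tau ->
  [/\ `|v1 r t z0| <= 4 * M, `|v2 r t z0| <= 4 * M & `|v3 r t z0| <= 4 * M].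
Proof.
move=> r01 t01.
have r1 : 0 <= (1 : R) <= 1 by rewrite ler01 lexx.
have pi0 := pi_gt0 R.
have t0 : 0 <= (0 : R) <= tau by rewrite lexx tau_ge0.
have t2 : 0 <= (pi / 2 : R) <= tau by apply/andP; split; lra.
have entries r' t' : 0 <= t' <= tau -> 0 <= r' <= 1 -> [/\ `|v11 r' t' z0| <= M, `|v12 r' t' z0| <= M,
    `|v21 r' t' z0| <= M, `|v22 r' t' z0| <= M & `|v31 r' t' z0| <= M /\ `|v32 r' t' z0| <= M].
  move=> t'01 r'01; have G := fun b => @grad_entry_le r' t' b r'01 t'01.
  rewrite /grad2 in G.
  have g11 := sqr_ge0 (v11 r' t' z0); have g12 := sqr_ge0 (v12 r' t' z0).
  have g13 := sqr_ge0 (v13 r' t' z0); have g21 := sqr_ge0 (v21 r' t' z0).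
  have g22 := sqr_ge0 (v22 r' t' z0); have g23 := sqr_ge0 (v23 r' t' z0).
  have g31 := sqr_ge0 (v31 r' t' z0); have g32 := sqr_ge0 (v32 r' t' z0).
  have g33 := sqr_ge0 (v33 r' t' z0).
  split; try split; apply: G; lra.
split.
- have XM t' : 0 <= t' <= tau -> forall r', 0 <= r' <= 1 ->
    `|v11 r' t' z0| <= M /\ `|v12 r' t' z0| <= M by move=> t'01 r' /(entries _ _ t'01)[].
  have := oscillation M0 Cv1 (XM _ t01) (XM _ t0) r01 r1.
  have := impermeable 0 z0; rewrite cos0 sin0 mul1r mul0r addr0 => ->.
  by rewrite subr0.
- have XM t' : 0 <= t' <= tau -> forall r', 0 <= r' <= 1 ->
    `|v21 r' t' z0| <= M /\ `|v22 r' t' z0| <= M by move=> t'01 r' /(entries _ _ t'01)[].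
  have := oscillation M0 Cv2 (XM _ t01) (XM _ t2) r01 r1.
  have := impermeable (pi / 2) z0; rewrite cos_pihalf sin_pihalf mul1r mul0r add0r => ->.
  by rewrite subr0.
- have XM t' : 0 <= t' <= tau -> forall r', 0 <= r' <= 1 ->
    `|v31 r' t' z0| <= M /\ `|v32 r' t' z0| <= M.
    by move=> t'01 r' /(entries _ _ t'01)[_ _ _ _ []].
  have osc r' t' : 0 <= r' <= 1 -> 0 <= t' <= tau ->
      `|v3 r t z0 - v3 r' t' z0| <= 4 * M.
    by move=> r'01 t'01; exact: (oscillation M0 Cv3 (XM _ t01) (XM _ t'01)).
  have mean k : slice (fun r _ _ => r * k) z0 = pi * k.
    rewrite /slice (_ : (fun r => _) = fun r => tau * k * r); last first.
      by apply/funext => x; rewrite int_cst; ring.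
    by rewrite intZ; [rewrite int_id01; field|exact: continuous_idfun].
  have up : pi * v3 r t z0 <= pi * (4 * M).
    rewrite -!mean -[leRHS]add0r -(flux0 z0) -sliceD; [|by c0..].
    apply: le_slice; [by c0..|] => x y /andP[x0 x1] y01.
    rewrite -mulrDr; apply: ler_wpM2l => //.
    have := osc x y; rewrite x0 x1 => /(_ isT y01); rewrite ler_norml => /andP[_]; lra.
  have lo : pi * (- v3 r t z0) <= pi * (4 * M).
    rewrite -!mean -[leRHS]subr0 -(flux0 z0) -sliceN -?sliceD; [|by c0..].
    apply: le_slice; [by c0..|] => x y /andP[x0 x1] y01.
    rewrite -mulrN -mulrDr; apply: ler_wpM2l => //.
    have := osc x y; rewrite x0 x1 => /(_ isT y01); rewrite ler_norml => /andP[+ _]; lra.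
  move: up lo; rewrite !ler_pM2l ?pi_gt0// => up lo.
  by rewrite ler_norml up andbT lerNl.
Qed.

End SupBound.

Definition dissipation (Z : R) := vol Z (fun r t z => r * grad2 r t z).

Lemma grad2_ge0 r t z : 0 <= grad2 r t z.
Proof. by rewrite /grad2 !addr_ge0// sqr_ge0. Qed.

Lemma dissipation_ge0 Z : 0 <= Z -> 0 <= dissipation Z.
Proof.
move=> Z0; apply: vol_ge0 => // r t z /andP[r0 _] _ _.
by apply: mulr_ge0 => //; exact: grad2_ge0.
Qed.

(** [energy_bound] for the weight [(1 - (z/Z)^2)^2], which is at least [9/16] for
    [|z| <= Z/2] and has first and second derivatives at most [8/Z]. *)
Lemma half_scale_bound (Z m : R) : 1 <= Z -> 0 <= m ->
  (forall r t z, 0 <= r <= 1 -> 0 <= t <= tau -> - Z <= z <= Z ->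
    [/\ `|v1 r t z| <= m, `|v2 r t z| <= m & `|v3 r t z| <= m]) ->
  9 / 16 * dissipation (Z / 2) <=
  8 / Z * (1 + `|a| + m) * energy_const * dissipation Z.
Proof.
move=> Z1 m0 vm; have Z0 : 0 < Z by exact: lt_le_trans Z1.
have Zn0 : Z != 0 by rewrite gt_eqF.
have cg := C0_grad2.
pose q z := 1 - (z / Z) ^+ 2.
have q01 z : - Z <= z <= Z -> 0 <= q z <= 1.
  move=> /andP[z1 z2]; have : (z / Z) ^+ 2 <= 1.
    by rewrite exprMn exprVn ler_pdivrMr ?exprn_gt0// mul1r; nra.
  by have := sqr_ge0 (z / Z); rewrite /q => ? ?; apply/andP; split; lra.
pose f z := q z * q z; pose f' z := - 4 / Z * ((z / Z) * q z).
pose f'' z := - 4 / (Z * Z) * (1 - 3 * (z / Z) ^+ 2).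
have cq : continuous q by rewrite /q; cont.
have cf : continuous f by rewrite /f; cont.
have cf' : continuous f' by rewrite /f'; cont.
have cf'' : continuous f'' by rewrite /f''; cont.
have df z : is_derive z 1 f (f' z).
  by rewrite /f /f' /q; apply: derive_eq; rewrite /GRing.scale/=; field.
have df' z : is_derive z 1 f' (f'' z).
  by rewrite /f' /f'' /q; apply: derive_eq; rewrite /GRing.scale/=; field.
have f1 : f Z = 0 by rewrite /f /q; field.
have f2 : f (- Z) = 0 by rewrite /f /q; field.
have f3 : f' Z = 0 by rewrite /f' /q; field.
have f4 : f' (- Z) = 0 by rewrite /f' /q; field.
have f0 z : - Z <= z <= Z -> 0 <= f z by move=> _; rewrite /f -expr2; exact: sqr_ge0.
have k0 : 0 <= 8 / Z by rewrite divr_ge0// ltW.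
have bounds z : - Z <= z <= Z -> `|f' z| <= 8 / Z /\ `|f'' z| <= 8 / Z.
  move=> zZ; have /andP[q0 q1] := q01 z zZ.
  have wle : `|z / Z| <= 1.
    by rewrite normrM normfV (gtr0_norm Z0) ler_pdivrMr// mul1r ler_norml.
  have w2 : (z / Z) ^+ 2 <= 1 by move: q0; rewrite /q; lra.
  have iZ : 0 <= Z^-1 by rewrite invr_ge0 ltW.
  have iZ1 : Z^-1 <= 1 by rewrite invf_le1.
  split; rewrite /f' /f'' normrM.
    rewrite (_ : - 4 / Z = - (4 / Z)); last by ring.
    rewrite normrN (ger0_norm (mulr_ge0 (ler0n R 4) iZ)).
    have le1 : `|z / Z * q z| <= 1.
      by rewrite normrM (ger0_norm q0); apply: mulr_ile1.
    by have := ler_wpM2l (mulr_ge0 (ler0n R 4) iZ) le1; lra.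
  rewrite (_ : - 4 / (Z * Z) = - (4 / (Z * Z))); last by ring.
  have iZZ0 : 0 <= (Z * Z)^-1 by rewrite invr_ge0 mulr_ge0// ltW.
  rewrite normrN (ger0_norm (mulr_ge0 (ler0n R 4) iZZ0)).
  have le2 : `|1 - 3 * (z / Z) ^+ 2| <= 2.
    by have := sqr_ge0 (z / Z); rewrite ler_norml => ?; apply/andP; split; lra.
  have iZZ : Z^-1 * Z^-1 <= Z^-1 by rewrite ler_piMl.
  rewrite invfM.
  by have := ler_wpM2l (mulr_ge0 (ler0n R 4) (mulr_ge0 iZ iZ)) le2; lra.
apply: le_trans (energy_bound cf cf' cf'' df df' f1 f2 f3 f4 (ltW Z0) f0 k0 m0 bounds vm).
have cF : C0 (fun r t z => r * (f z * grad2 r t z)) by c0.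
apply: le_trans (le_vol_scale (Z1 := Z / 2) _ cF _); last 2 first.
- by apply/andP; split; lra.
- move=> r t z /andP[r0 _]; apply: mulr_ge0 => //; apply: mulr_ge0.
    by rewrite /f -expr2; exact: sqr_ge0.
  exact: grad2_ge0.
rewrite -volZ; last by c0.
apply: le_vol; [lra|by c0|by c0|] => r t z /andP[r0 _] _ zZ.
rewrite mulrCA; apply: ler_wpM2l => //; apply: ler_wpM2r; first exact: grad2_ge0.
have w4 : (z / Z) ^+ 2 <= 1 / 4.
  rewrite exprMn exprVn ler_pdivrMr ?exprn_gt0// -subr_ge0.
  rewrite (_ : _ - _ = (Z / 2 - z) * (z - - (Z / 2))); last by field.
  by move/andP: zZ => [z1 z2]; apply: mulr_ge0; rewrite subr_ge0.
have : 3 / 4 <= q z by rewrite /q; lra.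
by rewrite /f; nra.
Qed.

(** A velocity gradient of sublinear growth has no dissipation: by
    [half_scale_bound] the dissipation would otherwise gain a large factor at
    every doubling of the length, faster than its growth allows. *)
Theorem sublinear_gradient_vanishes (m : R -> R) :
  (forall Z, 1 <= Z -> 0 <= m Z) ->
  (forall Z r t z, 1 <= Z -> 0 <= r <= 1 -> 0 <= t <= tau -> - Z <= z <= Z ->
    grad2 r t z <= m Z ^+ 2) ->
  (forall e, 0 < e -> exists2 Z0, 1 <= Z0 & forall Z, Z0 <= Z -> m Z <= e * Z) ->
  forall r t z, 0 < r < 1 -> 0 < t < tau -> grad2 r t z = 0.
Proof.
move=> m0 gm mlim r t z r01 t01.
have cg := C0_grad2.
set K := energy_const.
have K0 : 1 <= K.
  have K10 : 0 <= @inv_div_const R.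
    by rewrite /inv_div_const addr_ge0// divr_ge0// sqr_ge0.
  have T0 := sqr_ge0 tau; rewrite /K /energy_const.
  have := mulr_ge0 T0 K10; have := mulr_ge0 K10 K10; nra.
have hsb := half_scale_bound; rewrite -/K in hsb.
clearbody K.
have Kp : 0 < 2000 * K by lra.
have e0 : 0 < (2000 * K)^-1 by rewrite invr_gt0.
have e1 : (2000 * K)^-1 <= 1 by rewrite invf_le1//; lra.
have [Z0 Z01 mZ] := mlim _ e0.
pose Z1 := Z0 + 400 * (1 + `|a|) * K.
have a0 := normr_ge0 a.
have aK : 0 <= (1 + `|a|) * K by rewrite mulr_ge0//; lra.
have Z1Z0 : Z0 <= Z1 by rewrite /Z1 -mulrA; lra.
have Z11 : 1 <= Z1 by exact: le_trans Z1Z0.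
have vb Z : 1 <= Z -> forall r t z, 0 <= r <= 1 -> 0 <= t <= tau -> - Z <= z <= Z ->
    [/\ `|v1 r t z| <= 4 * m Z, `|v2 r t z| <= 4 * m Z & `|v3 r t z| <= 4 * m Z].
  move=> Z1' r' t' z' r'01 t'01 zZ; apply: velocity_bound => //; last exact: m0.
  by move=> x y x01 y01; exact: gm.
have D0 Z : Z1 <= Z -> dissipation Z = 0.
  apply: (doubling_vanish (c := 2 * tau)) => [|{}Z ZZ1|{}Z ZZ1|{}Z ZZ1].
  - by lra.
  - by apply: dissipation_ge0; lra.
  - have Z20 : 1 <= 2 * Z by lra.
    have m4 : 0 <= 4 * m (2 * Z) by rewrite mulr_ge0// m0.
    have Zp : 0 < Z by lra.
    have DZ0 : 0 <= dissipation (2 * Z) by exact: dissipation_ge0 (le_trans ler01 Z20).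
    have mm : m (2 * Z) <= (2000 * K)^-1 * (2 * Z) by apply: mZ; lra.
    have aZ : 400 * ((1 + `|a|) * K) <= Z by move: ZZ1; rewrite /Z1 -mulrA; lra.
    have := hsb _ _ Z20 m4 (vb _ Z20).
    rewrite (_ : 2 * Z / 2 = Z); last by field.
    exact: gain16 DZ0 (small_factor K0 Zp aZ mm).
  - have Zp : 1 <= Z by lra.
    have mle : m Z <= Z.
      apply: (le_trans (mZ Z (le_trans Z1Z0 ZZ1))).
      by rewrite ler_piMl// (le_trans ler01 Zp).
    have m2 : m Z ^+ 2 <= Z ^+ 2 by rewrite ler_pXn2r ?nnegrE ?m0//; lra.
    apply: (@le_trans _ _ (vol Z (fun _ _ _ => Z ^+ 2))).
      apply: le_vol; [lra|by c0|by c0|] => x y w x01 y01 wZ.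
      have := gm Z x y w Zp x01 y01 wZ; have := grad2_ge0 x y w.
      move/andP: x01 => [x0 x1]; move: (grad2 x y w) => g g0 gle.
      by apply: (@le_trans _ _ g); [rewrite ler_piMl|exact: le_trans m2].
    rewrite /vol (_ : slice _ = fun=> tau * Z ^+ 2); last first.
      by apply/funext => w; rewrite slice_cst.
    by rewrite int_cst exprS; lra.
pose Z := Z1 + `|z|.
have ZZ1 : Z1 <= Z by rewrite /Z lerDl.
have zb : - Z < z < Z.
  have := ler_norm z; have := ler_norm (- z); rewrite normrN /Z => h1 h2.
  by apply/andP; split; lra.
have ZNZ : - Z < Z by have /andP[h1 h2] := zb; exact: lt_trans h2.
have cF : C0 (fun r t z => r * grad2 r t z) by c0.
have s0 : slice (fun r t z => r * grad2 r t z) z = 0.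
  apply: (int_eq0 ZNZ (continuous_slice cF) _ (D0 Z ZZ1)) => // w _.
  by apply: slice_ge0 => x y /andP[x0 _] _; apply: mulr_ge0 => //; exact: grad2_ge0.
have s1 : intg 0 tau (fun t => r * grad2 r t z) = 0.
  have ring0 x : 0 <= x <= 1 -> 0 <= intg 0 tau (fun t => x * grad2 x t z).
    move=> /andP[x0 _]; apply: int_ge0 => [|y _]; first exact: tau_ge0.
    by apply: mulr_ge0 => //; exact: grad2_ge0.
  exact: (int_eq0 ltr01 (@continuous_ring_r _ _ z cF) ring0 s0 r01).
have /andP[r0 _] := r01.
have point0 y : 0 <= y <= tau -> 0 <= r * grad2 r y z.
  by move=> _; apply: mulr_ge0; [exact: ltW|exact: grad2_ge0].
have /eqP := int_eq0 tau_gt0 (@C0_t _ _ r z cF) point0 s1 t01.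
by rewrite mulf_eq0 gt_eqF//= => /eqP.
Qed.

End Energy.

(** * Mixed derivatives and the chain rule in two directions *)

Section TwoDirections.
Context {R : realType} {V : normedModType R}.
Implicit Types (f g : V -> R) (x v w : V) (s : R).

Lemma is_derive_line f x v s d : is_derive (x + s *: v) v f d ->
  is_derive s 1 (fun s => f (x + s *: v)) d.
Proof.
pose q := fun h => h^-1 *: ((f \o shift (x + s *: v)) (h *: v) - f (x + s *: v)).
have E : (fun h => h^-1 *: (((fun s => f (x + s *: v)) \o shift s) (h *: 1) -
    f (x + s *: v))) = q.
  apply/funext => h; rewrite /q /=; congr (_ *: (f _ - _)).
  by rewrite [h *: 1]mulr1 scalerDl addrCA.
move=> [df dE]; split; first by rewrite /derivable E.
by rewrite /derive E.
Qed.

(** Clamping the coordinates turns functions near a point of [A] into continuous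
    functions on the whole plane. *)
Definition clampd (d s : R) : R := Num.max (- d) (Num.min s d).

Lemma continuous_clampd d : continuous (clampd d).
Proof.
move=> x; apply: (@continuous_max R _ (cst (- d)) (fun r => Num.min r d)).
  exact: cvg_cst.
by apply: (@continuous_min R _ id (cst d)); [exact: cvg_id|exact: cvg_cst].
Qed.

Lemma clampd_le d s : 0 <= d -> `|clampd d s| <= d.
Proof.
move=> d0; rewrite ler_norml /clampd le_max lexx/= ge_max ge_min lexx orbT andbT.
lra.
Qed.

Lemma clampd_id d s : `|s| <= d -> clampd d s = s.
Proof.
by rewrite ler_norml => /andP[s1 s2]; rewrite /clampd (min_idPl s2) (max_idPr s1).
Qed.

Variables (A : set V) (v w : V).
Hypothesis openA : open A.

Lemma square_in_open x : A x -> exists2 d, 0 < d &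
  forall a b : R, `|a| <= d -> `|b| <= d -> A (x + a *: v + b *: w).
Proof.
move=> Ax.
have /nbhs_ballP[e /= e0 eA] : nbhs x A by exact: open_nbhs_nbhs.
pose n := `|v| + `|w| + 1.
have n0 : 0 < n by rewrite /n ltr_wpDl// addr_ge0.
exists (e / (2 * n)) => [|a b ad bd]; first by rewrite divr_gt0// mulr_gt0.
apply: eA; rewrite -ball_normE/= opprD opprD addrA addrA subrr add0r -opprD normrN.
apply: (le_lt_trans (ler_normD _ _)); rewrite !normrZ.
have h1 : `|a| * `|v| <= e / (2 * n) * `|v| by apply: ler_wpM2r.
have h2 : `|b| * `|w| <= e / (2 * n) * `|w| by apply: ler_wpM2r.
apply: (le_lt_trans (lerD h1 h2)); rewrite -mulrDr.
rewrite mulrAC -mulrA gtr_pMr// ltr_pdivrMr ?mulr_gt0// mul1r /n.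
have := normr_ge0 v; have := normr_ge0 w; lra.
Qed.

Definition on_square g x d (a b : R) := g (x + clampd d a *: v + clampd d b *: w).

Lemma continuous_on_square g x d : (forall x, A x -> {for x, continuous g}) ->
  0 <= d -> (forall a b : R, `|a| <= d -> `|b| <= d -> A (x + a *: v + b *: w)) ->
  continuous (fun q : R * R => on_square g x d q.1 q.2).
Proof.
move=> cg d0 dA q.
apply: (@continuous_comp _ _ _
  (fun q : R * R => x + clampd d q.1 *: v + clampd d q.2 *: w) g); last first.
  by apply: cg; apply: dA; exact: clampd_le.
have c1 : continuous (fun q : R * R => clampd d q.1).
  by apply: (continuous_comp1 (@continuous_clampd d)); cont.
have c2 : continuous (fun q : R * R => clampd d q.2).
  by apply: (continuous_comp1 (@continuous_clampd d)); cont.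
apply: cvgD; first apply: cvgD; first exact: cvg_cst.
  by apply: cvgZl; exact: c1.
by apply: cvgZl; exact: c2.
Qed.

Lemma increment_v g gv x d a b :
  (forall x, A x -> is_derive x v g (gv x)) -> (forall x, A x -> {for x, continuous gv}) ->
  0 <= d -> (forall a b : R, `|a| <= d -> `|b| <= d -> A (x + a *: v + b *: w)) ->
  `|a| <= d -> `|b| <= d ->
  g (x + a *: v + b *: w) - g (x + b *: w) =
  intg 0 a (fun s => on_square gv x d s b).
Proof.
move=> dg cg d0 dA ad bd.
pose F s := g (x + b *: w + s *: v).
have -> : g (x + a *: v + b *: w) = F a by rewrite /F addrAC.
have -> : g (x + b *: w) = F 0 by rewrite /F scale0r addr0.
have sa t : 0 <= t <= 1 -> `|0 + (a - 0) * t| <= d.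
  move=> /andP[t0 t1]; rewrite add0r subr0 normrM (ger0_norm t0).
  by apply: le_trans ad; rewrite ler_piMr.
have dF s : `|s| <= d -> is_derive s 1 F (on_square gv x d s b).
  move=> sd; apply: is_derive_line.
  rewrite /on_square !clampd_id// [x + s *: v + _]addrAC; apply: dg.
  by rewrite addrAC; exact: dA.
apply/esym/int_FTC2_aux.
- by apply: (continuous_comp2 (continuous_on_square cg d0 dA)); cont.
- by move=> t t01; apply: is_derive_continuous; apply: dF; exact: sa.
- by move=> t /andP[t0 t1]; apply: dF; apply: sa; rewrite !ltW.
Qed.

End TwoDirections.

Section MixedDerivatives.
Context {R : realType} {V : normedModType R}.
Variables (A : set V) (v w : V).
Hypothesis openA : open A.
Implicit Types (f g : V -> R) (x : V).

Lemma increment_w g gw x d a b :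
  (forall x, A x -> is_derive x w g (gw x)) -> (forall x, A x -> {for x, continuous gw}) ->
  0 <= d -> (forall a b : R, `|a| <= d -> `|b| <= d -> A (x + a *: v + b *: w)) ->
  `|a| <= d -> `|b| <= d ->
  g (x + a *: v + b *: w) - g (x + a *: v) =
  intg 0 b (fun t => on_square v w gw x d a t).
Proof.
move=> dg cg d0 dA ad bd.
have dA' (b' a' : R) : `|b'| <= d -> `|a'| <= d -> A (x + b' *: w + a' *: v).
  by move=> b'd a'd; rewrite addrAC; exact: dA.
rewrite addrAC (increment_v dg cg d0 dA' bd ad).
by congr (intg _ _ _); apply/funext => t; rewrite /on_square addrAC.
Qed.

Lemma on_square0 g x d : 0 <= d -> on_square v w g x d 0 0 = g x.
Proof. by move=> d0; rewrite /on_square !clampd_id ?normr0// !scale0r !addr0. Qed.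

Lemma second_difference f fv fvw x d a b :
  (forall x, A x -> is_derive x v f (fv x)) ->
  (forall x, A x -> is_derive x w fv (fvw x)) ->
  (forall x, A x -> {for x, continuous fv}) ->
  (forall x, A x -> {for x, continuous fvw}) ->
  0 <= d -> (forall a b : R, `|a| <= d -> `|b| <= d -> A (x + a *: v + b *: w)) ->
  `|a| <= d -> `|b| <= d ->
  f (x + a *: v + b *: w) - f (x + b *: w) - (f (x + a *: v) - f x) =
  intg 0 a (fun s => intg 0 b (fun t => on_square v w fvw x d s t)).
Proof.
move=> dfv dfvw cv cvw d0 dA ad bd.
have cV := continuous_on_square cv d0 dA.
have n0 : `|0 : R| <= d by rewrite normr0.
have h0 : f (x + a *: v) - f x = intg 0 a (fun s => on_square v w fv x d s 0).
  by have := increment_v dfv cv d0 dA ad n0; rewrite !scale0r !addr0.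
have cVb t : continuous (fun s => on_square v w fv x d s t).
  by apply: (continuous_comp2 cV); cont.
rewrite (increment_v dfv cv d0 dA ad bd) h0 -(intB 0 a (cVb b) (cVb 0)).
congr (intg _ _ _); apply/funext => s; have sd := clampd_le s d0.
have := increment_w dfvw cvw d0 dA sd bd.
rewrite {2 3}/on_square (clampd_id bd) (clampd_id n0) scale0r addr0 => ->.
congr (intg _ _ _); apply/funext => t.
by rewrite /on_square (clampd_id sd).
Qed.

End MixedDerivatives.

Section Clairaut.
Context {R : realType}.

Lemma eq_int_near0 (h k : R -> R) (d : R) : 0 < d -> continuous h -> continuous k ->
  (forall a, `|a| <= d -> intg 0 a h = intg 0 a k) -> h 0 = k 0.
Proof.
move=> d0 ch ck hk; have dh := int_FTC1 0 0 ch; have dk := int_FTC1 0 0 ck.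
suff dh' : is_derive (0 : R) 1 (fun x => intg 0 x h) (k 0) by exact: is_derive_unique dh dh'.
apply: (near_eq_is_derive (f := fun x => intg 0 x k)).
near=> x; rewrite hk//; near: x; exact: nbhs0_le.
Unshelve. all: by end_near.
Qed.

(** Clairaut's theorem: on a small square both iterated integrals equal the same
    second difference; differentiate them once in each variable. *)
Lemma mixed_derivatives (V : normedModType R) (A : set V) (v w : V)
    (f fv fw fvw fwv : V -> R) x : open A -> A x ->
  (forall x, A x -> is_derive x v f (fv x)) ->
  (forall x, A x -> is_derive x w f (fw x)) ->
  (forall x, A x -> is_derive x w fv (fvw x)) ->
  (forall x, A x -> is_derive x v fw (fwv x)) ->
  (forall x, A x -> {for x, continuous fv}) ->
  (forall x, A x -> {for x, continuous fw}) ->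
  (forall x, A x -> {for x, continuous fvw}) ->
  (forall x, A x -> {for x, continuous fwv}) -> fvw x = fwv x.
Proof.
move=> oA Ax dfv dfw dfvw dfwv cv cw cvw cwv.
have [d d0 dA] := square_in_open v w oA Ax; have d0' := ltW d0.
have dA' (b' a' : R) : `|b'| <= d -> `|a'| <= d -> A (x + b' *: w + a' *: v).
  by move=> b'd a'd; rewrite addrAC; exact: dA.
have c1 := continuous_on_square cvw d0' dA.
have c2' := continuous_on_square cwv d0' dA'.
have c2 : continuous (fun q : R * R => on_square w v fwv x d q.2 q.1).
  by apply: (continuous_comp2 c2'); cont.
rewrite -(on_square0 v w fvw x d0') -(on_square0 w v fwv x d0').
have c10 : continuous (on_square v w fvw x d 0) by apply: (continuous_comp2 c1); cont.
have c20 : continuous (fun t => on_square w v fwv x d t 0).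
  by apply: (continuous_comp2 c2'); cont.
apply: (eq_int_near0 d0 c10 c20) => b bd.
have i1 : continuous (fun s => intg 0 b (on_square v w fvw x d s)).
  by apply: (continuous_int (f := on_square v w fvw x d)) => //; exact: continuous_cst.
have i2 : continuous (fun s => intg 0 b (fun t => on_square w v fwv x d t s)).
  by apply: (continuous_int (f := fun s t => on_square w v fwv x d t s)) => //;
    exact: continuous_cst.
apply: (eq_int_near0 d0 i1 i2) => a ad.
rewrite (int_swap (f := fun s t => on_square w v fwv x d t s) 0 a 0 b c2).
rewrite -(second_difference dfv dfvw cv cvw d0' dA ad bd).
rewrite -(second_difference dfw dfwv cw cwv d0' dA' bd ad).
by rewrite [x + b *: w + a *: v]addrAC; ring.
Qed.

(** Chain rule along a curve in the plane spanned by [v] and [w], when only the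
    two partial derivatives are known to exist and to be continuous: the increment
    is split along the sides of a rectangle, each side being an integral. *)
Lemma chain_rule2 (V : normedModType R) (A : set V) (v w : V)
    (f fv fw : V -> R) x (al be : R -> R) (s0 al' be' : R) : open A -> A x ->
  (forall x, A x -> is_derive x v f (fv x)) ->
  (forall x, A x -> is_derive x w f (fw x)) ->
  (forall x, A x -> {for x, continuous fv}) ->
  (forall x, A x -> {for x, continuous fw}) ->
  continuous al -> continuous be -> al s0 = 0 -> be s0 = 0 ->
  is_derive s0 1 al al' -> is_derive s0 1 be be' ->
  is_derive s0 1 (fun s => f (x + al s *: v + be s *: w)) (fv x * al' + fw x * be').
Proof.
move=> oA Ax dfv dfw cv cw cal cbe al0 be0 dal dbe.
have [d d0 dA] := square_in_open v w oA Ax; have d0' := ltW d0.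
have c1 := continuous_on_square cv d0' dA.
have c2 := continuous_on_square cw d0' dA.
have [ga [gaE gac ga0]] := (is_derive1_caratheodory _ _ _).1 dal.
have [gb [gbE gbc gb0]] := (is_derive1_caratheodory _ _ _).1 dbe.
pose P s := int01 (fun t => on_square v w fv x d (0 + (al s - 0) * t) (be s)).
pose Q s := int01 (fun t => on_square v w fw x d 0 (0 + (be s - 0) * t)).
have cP : continuous P.
  apply: (continuous_int01
    (f := fun s t => on_square v w fv x d (0 + (al s - 0) * t) (be s))).
  have ca1 : continuous (fun q : R * R => al q.1) by apply: continuous_comp1; cont.
  have cb1 : continuous (fun q : R * R => be q.1) by apply: continuous_comp1; cont.
  by apply: (continuous_comp2 c1); cont.
have cQ : continuous Q.
  apply: (continuous_int01
    (f := fun s t => on_square v w fw x d 0 (0 + (be s - 0) * t))).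
  have cb1 : continuous (fun q : R * R => be q.1) by apply: continuous_comp1; cont.
  by apply: (continuous_comp2 c2); cont.
have P0 : P s0 = fv x.
  rewrite /P al0 be0 -(on_square0 v w fv x d0').
  exact: (int01_pt (fun x _ => on_square v w fv _ d x 0) 0 tt).
have Q0 : Q s0 = fw x.
  rewrite /Q be0 -(on_square0 v w fw x d0').
  exact: (int01_pt (fun y _ => on_square v w fw _ d 0 y) 0 tt).
apply: (near_eq_is_derive (f := fun s => f x + (al s * P s + be s * Q s))).
  near=> s.
  have ad : `|al s| <= d.
    near: s; have := cal s0; rewrite /continuous_at al0 => /cvgr0Pnorm_le; exact.
  have bd : `|be s| <= d.
    near: s; have := cbe s0; rewrite /continuous_at be0 => /cvgr0Pnorm_le; exact.
  have n0 : `|0 : R| <= d by rewrite normr0.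
  have h1 := increment_v dfv cv d0' dA ad bd.
  have := increment_w dfw cw d0' dA n0 bd; rewrite scale0r !addr0 => h2.
  rewrite -(subrK (f (x + be s *: w)) (f (x + al s *: v + _))) h1.
  rewrite -(subrK (f x) (f (x + be s *: w))) h2 (int_affine 0 (al s)) (int_affine 0 (be s)) -!int01E.
  by rewrite -/(P s) -/(Q s); ring.
apply/is_derive1_caratheodory; exists (fun s => ga s * P s + gb s * Q s); split.
- move=> z; have := gaE z; have := gbE z; rewrite al0 be0 !subr0 => -> ->; ring.
- apply: cvgD; apply: cvgM; [exact: gac|exact: cP|exact: gbc|exact: cQ].
- by rewrite ga0 gb0 P0 Q0; ring.
Unshelve. all: by end_near.
Qed.

End Clairaut.

(** * From Cartesian fields to fields in polar coordinates *)

Section PolarMap.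
Context {R : realType}.
Notation tau := (2 * pi : R).
Implicit Types (a b c r t z : R) (x : 'R3[R]) (g : 'R3[R] -> R).

Lemma vec3E a b c : [/\ vec3 a b c 0 0 = a, vec3 a b c 0 1 = b & vec3 a b c 0 2 = c].
Proof. by rewrite /vec3 !mxE. Qed.

Lemma vec3_eta x : x = vec3 (x 0 0) (x 0 1) (x 0 2).
Proof.
apply/rowP => i; rewrite /vec3 mxE.
by case: i => [[|[|[|//]]]] H /=; congr (x 0 _); apply/val_inj.
Qed.

Lemma vec3_lin a b c a' b' c' k :
  vec3 a b c + k *: vec3 a' b' c' = vec3 (a + k * a') (b + k * b') (c + k * c').
Proof.
by apply/rowP => i; rewrite /vec3 !mxE; case: i => [[|[|[|//]]]].
Qed.

Lemma delta_vec3 : [/\ delta_mx 0 0 = vec3 1 0 0 :> 'R3[R],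
  delta_mx 0 1 = vec3 0 1 0 :> 'R3[R] & delta_mx 0 2 = vec3 0 0 1 :> 'R3[R]].
Proof.
by split; apply/rowP => i; rewrite /vec3 !mxE;
  case: i => [[|[|[|//]]]].
Qed.

Lemma continuous_vec3 (S : topologicalType) (f g h : S -> R) :
  continuous f -> continuous g -> continuous h ->
  continuous (fun s => vec3 (f s) (g s) (h s)).
Proof.
move=> cf cg ch.
rewrite (_ : (fun s => _) = fun s => f s *: vec3 1 0 0 + g s *: vec3 0 1 0
   + h s *: vec3 0 0 1); last first.
  apply/funext => s; apply/rowP => i; rewrite /vec3 !mxE.
  by case: i => [[|[|[|//]]]] ? /=; ring.
move=> s; apply: cvgD; first apply: cvgD.
- by apply: cvgZl; exact: cf.
- by apply: cvgZl; exact: cg.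
- by apply: cvgZl; exact: ch.
Qed.

Lemma continuous_radius2 : continuous (fun x : 'R3[R] => x 0 0 ^+ 2 + x 0 1 ^+ 2).
Proof.
by apply: continuous_add; apply: continuous_exp; exact: coord_continuous.
Qed.

Lemma open_cylinder : open (@cylinder R).
Proof.
rewrite (_ : @cylinder R = (fun x : 'R3[R] => x 0 0 ^+ 2 + x 0 1 ^+ 2) @^-1` [set y | y < 1])//.
apply: open_comp; last exact: open_lt.
by move=> x _; exact: continuous_radius2.
Qed.

Lemma cylinder_vec3 a b c : cylinder (vec3 a b c) <-> a ^+ 2 + b ^+ 2 < 1.
Proof. by rewrite /cylinder/=; have [-> -> _] := vec3E a b c. Qed.

(** Boundary points are limits of their contractions towards the axis. *)
Lemma closed_cylinder_vec3 a b c : a ^+ 2 + b ^+ 2 <= 1 ->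
  closure (@cylinder R) (vec3 a b c).
Proof.
move=> ab1 B Bx.
pose f s := vec3 (s * a) (s * b) c.
have cf : continuous f.
  by apply: continuous_vec3; [cont|cont|exact: continuous_cst].
have f1 : f 1 = vec3 a b c by rewrite /f !mul1r.
have : \forall s \near (1 : R)^'-, B (f s).
  by apply: cvg_at_left_filter (cf 1) _ _; rewrite f1.
move=> BF; have : \forall s \near (1 : R)^'-, B (f s) /\ 0 < s /\ s < 1.
  near=> s; split; first by near: s.
  split; last by near: s; exact: nbhs_left_lt.
  by near: s; exact: nbhs_left_gt.
move=> /filter_ex[s [Bs [s0 s1]]]; exists (f s); split=> //.
apply/cylinder_vec3; rewrite !exprMn -mulrDr.
have : s ^+ 2 < 1 by rewrite expr_lt1// ltW.
have := sqr_ge0 a; have := sqr_ge0 b; have := sqr_ge0 s; nra.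
Unshelve. all: by end_near. Qed.

Lemma closure_cylinder_le x : closure (@cylinder R) x -> x 0 0 ^+ 2 + x 0 1 ^+ 2 <= 1.
Proof.
pose N (x : 'R3[R]) := x 0 0 ^+ 2 + x 0 1 ^+ 2.
have cN : continuous N by exact: continuous_radius2.
have cl : closed (N @^-1` [set y | y <= 1]).
  by apply: closed_comp; [move=> y _; exact: cN|exact: closed_le].
move=> clx; rewrite closure_id in cl; have : (N @^-1` [set y | y <= 1]) x; last by [].
by rewrite cl; apply: closure_subset clx => y; exact: ltW.
Qed.

Definition polar r t z : 'R3[R] := vec3 (clamp01 r * cos t) (clamp01 r * sin t) z.
Definition pullback g r t z := g (polar r t z).

Lemma polar_sqr r t : (clamp01 r * cos t) ^+ 2 + (clamp01 r * sin t) ^+ 2 = clamp01 r ^+ 2.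
Proof. by rewrite !exprMn -mulrDr cos2Dsin2 mulr1. Qed.

Lemma polar_closure r t z : closure (@cylinder R) (polar r t z).
Proof.
apply: closed_cylinder_vec3; rewrite polar_sqr.
by have /andP[c0 c1] := clamp01_itv r; rewrite expr_le1.
Qed.

Lemma polar_cylinder r t z : r < 1 -> cylinder (polar r t z).
Proof.
move=> r1; apply/cylinder_vec3; rewrite polar_sqr.
have /andP[c0 c1] := clamp01_itv r; rewrite expr_lt1//.
by rewrite /clamp01 gt_max ltr01 gt_min r1.
Qed.

Lemma continuous_polar : continuous (fun q : R * R * R => polar q.1.1 q.1.2 q.2).
Proof.
have cc : continuous (fun q : R * R * R => clamp01 q.1.1).
  by apply: (continuous_comp1 continuous_clamp01); cont.
have ccos : continuous (fun q : R * R * R => cos q.1.2).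
  by apply: (continuous_comp1 (@continuous_cos R)); cont.
have csin : continuous (fun q : R * R * R => sin q.1.2).
  by apply: (continuous_comp1 (@continuous_sin R)); cont.
by apply: continuous_vec3; cont.
Qed.

Lemma C0_pullback g : {within closure (@cylinder R), continuous g} -> C0 (pullback g).
Proof.
move=> /subspace_continuousP cg q.
have Hx := cg _ (@polar_closure q.1.1 q.1.2 q.2).
move=> U gU.
have H : \forall q' \near q, closure (@cylinder R) (polar q'.1.1 q'.1.2 q'.2) ->
    U (pullback g q'.1.1 q'.1.2 q'.2) by exact: (continuous_polar (Hx U gU)).
apply: filterS H => q' Uq'; exact: (Uq' (@polar_closure _ _ _)).
Qed.

Lemma le_closed_itv (f : R -> R) a b k : a < b -> continuous f ->
  (forall s, a < s < b -> f s <= k) -> forall s, a <= s <= b -> f s <= k.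
Proof.
move=> ab cf fk s /andP[as_ sb].
have lim (F : set_system R) : ProperFilter F -> F --> s ->
    (\forall x \near F, a < x < b) -> f s <= k.
  move=> PF Fs Fab.
  have cF : f x @[x --> F] --> f s by apply: cvg_trans (cf s); exact: cvg_app.
  rewrite -(cvg_lim _ cF)//; apply: limr_le; first by apply/cvg_ex; exists (f s).
  by apply: filterS Fab => x; exact: fk.
have [sltb|bs] := ltP s b.
  apply: (lim (s^'+)); first exact: cvg_at_right_filter.
  near=> x; apply/andP; split; near: x; last exact: nbhs_right_lt.
  by near=> x; apply: le_lt_trans as_ _; near: x; exact: nbhs_right_gt.
apply: (lim (s^'-)); first exact: cvg_at_left_filter.
near=> x; apply/andP; split; near: x.
  by apply: nbhs_left_gt; exact: lt_le_trans ab bs.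
by near=> x; apply: lt_le_trans sb; near: x; exact: nbhs_left_lt.
Unshelve. all: by end_near. Qed.

Lemma C0_eq_boundary (F G : R -> R -> R -> R) : C0 F -> C0 G ->
  (forall r t z, 0 < r < 1 -> F r t z = G r t z) ->
  forall r t z, 0 <= r <= 1 -> F r t z = G r t z.
Proof.
have le (X Y : R -> R -> R -> R) : C0 X -> C0 Y -> (forall r t z, 0 < r < 1 -> X r t z = Y r t z) ->
    forall r t z, 0 <= r <= 1 -> X r t z - Y r t z <= 0.
  move=> cX cY XY r t z r01; have cD : C0 (fun r t z => X r t z - Y r t z) by c0.
  apply: (le_closed_itv (f := fun r => X r t z - Y r t z) ltr01 _ _ r01) => [|x x01].
    exact: (@C0_r _ _ t z cD).
  by rewrite XY// subrr.
move=> cF cG FG r t z r01.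
have GF r' t' z' (r'01 : 0 < r' < 1) : G r' t' z' = F r' t' z' by rewrite FG.
have h1 := le _ _ cF cG FG r t z r01; have h2 := le _ _ cG cF GF r t z r01.
by apply/eqP; rewrite eq_le -subr_le0 h1 -subr_le0 h2.
Qed.

End PolarMap.

Section PullbackC1.
Context {R : realType}.
Notation tau := (2 * pi : R).
Notation cyl := (@cylinder R).
Implicit Types (a b c r t z : R) (x : 'R3[R]) (f g : 'R3[R] -> R).

Lemma continuous_in_cylinder g x : {within closure cyl, continuous g} ->
  cyl x -> {for x, continuous g}.
Proof.
move=> cg cx; have co := @open_cylinder R.
have : {within cyl, continuous g}.
  by apply: continuous_subspaceW cg; exact: subset_closure.
by rewrite continuous_open_subspace// => /(_ x); apply; rewrite inE.
Qed.

Lemma is_derive_of_int (F : R -> R) (k : R -> R) t : continuous k ->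
  (forall s, F s - F 0 = intg 0 s k) -> is_derive t 1 F (k t).
Proof.
move=> ck H; rewrite (_ : F = fun s => F 0 + intg 0 s k).
  by have d := int_FTC1 0 t ck; deriv.
by apply/funext => s; rewrite -H addrC subrK.
Qed.

(** Inside the cylinder this is the chain rule; the derivatives along the wall
    follow because the identities [F t - F 0 = int k] pass to the boundary. *)
Lemma C1_pullback f f0 f1 f2 :
  {within closure cyl, continuous f} -> {within closure cyl, continuous f0} ->
  {within closure cyl, continuous f1} -> {within closure cyl, continuous f2} ->
  (forall x, cyl x -> is_derive x (delta_mx 0 0) f (f0 x)) ->
  (forall x, cyl x -> is_derive x (delta_mx 0 1) f (f1 x)) ->
  (forall x, cyl x -> is_derive x (delta_mx 0 2) f (f2 x)) ->
  C1 (pullback f) (pullback f0) (pullback f1) (pullback f2).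
Proof.
move=> cf cf0 cf1 cf2 d0 d1 d2.
have [[pf pf0] [pf1 pf2]] := ((C0_pullback cf, C0_pullback cf0),
  (C0_pullback cf1, C0_pullback cf2)).
have oc := @open_cylinder R.
have i0 x : cyl x -> {for x, continuous f0} by exact: continuous_in_cylinder.
have i1 x : cyl x -> {for x, continuous f1} by exact: continuous_in_cylinder.
have [e0 e1 e2] := @delta_vec3 R.
have chain r t z (al be : R -> R) (s0 al' be' : R) : cyl (polar r t z) ->
    continuous al -> continuous be -> al s0 = 0 -> be s0 = 0 ->
    is_derive s0 1 al al' -> is_derive s0 1 be be' ->
    is_derive s0 1 (fun s => f (vec3 (clamp01 r * cos t + al s)
      (clamp01 r * sin t + be s) z)) (pullback f0 r t z * al' + pullback f1 r t z * be').
  move=> cp ca cb a0 b0 da db.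
  have := chain_rule2 oc cp d0 d1 i0 i1 ca cb a0 b0 da db.
  rewrite e0 e1; congr (is_derive _ _ _ _); apply/funext => s.
  by rewrite /polar !vec3_lin !mulr0 !mulr1 !addr0.
pose k r t z := clamp01 r * (cos t * pullback f1 r t z - sin t * pullback f0 r t z).
have ck : C0 k by rewrite /k; c0.
have dt_in r t z : r < 1 -> is_derive t 1 (fun t => pullback f r t z) (k r t z).
  move=> r1; have cp := @polar_cylinder _ r t z r1.
  have := chain r t z (fun s => clamp01 r * (cos s - cos t))
    (fun s => clamp01 r * (sin s - sin t)) t (- clamp01 r * sin t) (clamp01 r * cos t) cp.
  rewrite !subrr !mulr0.
  have ca : continuous (fun s => clamp01 r * (cos s - cos t)).
    by apply: continuous_mul; [cont|apply: continuous_add; [exact: continuous_cos|cont]].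
  have cb : continuous (fun s => clamp01 r * (sin s - sin t)).
    by apply: continuous_mul; [cont|apply: continuous_add; [exact: continuous_sin|cont]].
  have da : is_derive t 1 (fun s => clamp01 r * (cos s - cos t)) (- clamp01 r * sin t).
    by deriv.
  have db : is_derive t 1 (fun s => clamp01 r * (sin s - sin t)) (clamp01 r * cos t).
    by deriv.
  move=> /(_ ca cb erefl erefl da db).
  rewrite (_ : pullback f0 r t z * _ + _ = k r t z); last by rewrite /k; ring.
  congr (is_derive _ _ _ _); apply/funext => s; rewrite /pullback /polar.
  by congr (f (vec3 _ _ _)); ring.
have dz_in r t z : r < 1 -> is_derive z 1 (pullback f r t) (pullback f2 r t z).
  move=> r1.
  have E s : polar r t s = polar r t 0 + s *: delta_mx 0 2.
    by rewrite /polar e2 vec3_lin !mulr0 !addr0 mulr1 add0r.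
  rewrite (_ : pullback f r t = fun s => f (polar r t 0 + s *: delta_mx 0 2)).
    by apply: is_derive_line; rewrite -E; apply: d2; exact: polar_cylinder.
  by apply/funext => s; rewrite /pullback E.
have ge1 g r t z : 1 <= r -> pullback g r t z = pullback g 1 t z.
  by move=> r1; rewrite /pullback /polar !clamp01_ge1.
have int_t r t z : 0 <= r <= 1 -> pullback f r t z - pullback f r 0 z =
    intg 0 t (fun s => k r s z).
  apply: (C0_eq_boundary (F := fun r t z => pullback f r t z - pullback f r 0 z)
    (G := fun r t z => intg 0 t (fun s => k r s z))).
  - by apply: continuous_add; [exact: pf|apply: continuous_opp; apply: (C0_comp pf); cont].
  - apply: (continuous_int (f := fun (q : R * R * R) s => k q.1.1 s q.2)).
    + by apply: (C0_comp ck); cont.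
    + exact: continuous_cst.
    + by cont.
  - move=> {}r {}t {}z /andP[_ r1].
    apply/esym/(@int_FTC2T _ 0 t _ (fun t => pullback f r t z)).
      exact: C0_t.
    by move=> s; exact: dt_in.
have int_z r t z : 0 <= r <= 1 -> pullback f r t z - pullback f r t 0 =
    intg 0 z (pullback f2 r t).
  apply: (C0_eq_boundary (F := fun r t z => pullback f r t z - pullback f r t 0)
    (G := fun r t z => intg 0 z (pullback f2 r t))).
  - by apply: continuous_add; [exact: pf|apply: continuous_opp; apply: (C0_comp pf); cont].
  - apply: (continuous_int (f := fun (q : R * R * R) s => pullback f2 q.1.1 q.1.2 s)).
    + by apply: (C0_comp pf2); cont.
    + exact: continuous_cst.
    + by cont.
  - move=> {}r {}t {}z /andP[_ r1].
    apply/esym/(@int_FTC2T _ 0 z _ (pullback f r t)); first exact: (@C0_z _ _ r t pf2).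
    by move=> s; exact: dz_in.
have one01 : 0 <= (1 : R) <= 1 by rewrite ler01 lexx.
split=> //.
- move=> r t z r01; have /andP[r0 r1] := r01; have cp := @polar_cylinder _ r t z r1.
  have dc := is_derive_clamp01 r01.
  have cc := @continuous_clamp01 R.
  have := chain r t z (fun s => (clamp01 s - clamp01 r) * cos t)
    (fun s => (clamp01 s - clamp01 r) * sin t) r (cos t) (sin t) cp.
  rewrite !subrr !mul0r.
  have ca : continuous (fun s => (clamp01 s - clamp01 r) * cos t).
    by apply: continuous_mul; [apply: continuous_add; [exact: cc|cont]|cont].
  have cb : continuous (fun s => (clamp01 s - clamp01 r) * sin t).
    by apply: continuous_mul; [apply: continuous_add; [exact: cc|cont]|cont].
  have da : is_derive r 1 (fun s => (clamp01 s - clamp01 r) * cos t) (cos t).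
    by deriv.
  have db : is_derive r 1 (fun s => (clamp01 s - clamp01 r) * sin t) (sin t).
    by deriv.
  move=> /(_ ca cb erefl erefl da db).
  rewrite [pullback f0 r t z * _]mulrC [pullback f1 r t z * _]mulrC.
  congr (is_derive _ _ _ _); apply/funext => s; rewrite /pullback /polar.
  by congr (f (vec3 _ _ _)); ring.
- move=> r t z; have [r1|r1] := ltP r 1; first exact: dt_in.
  rewrite (_ : (fun t => _) = fun t => pullback f 1 t z); last first.
    by apply/funext => s; exact: ge1.
  rewrite (_ : _ * _ = k 1 t z); last by rewrite /k !ge1// !clamp01_ge1.
  apply: (is_derive_of_int (k := fun t => k 1 t z)) => [|s]; first exact: C0_t.
  exact: int_t.
- move=> r t z; have [r1|r1] := ltP r 1; first exact: dz_in.
  rewrite (_ : pullback f r t = pullback f 1 t); last first.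
    by apply/funext => s; exact: ge1.
  rewrite ge1//; apply: (is_derive_of_int (k := pullback f2 1 t)) => [|s].
    exact: (@C0_z _ _ 1 t pf2).
  exact: int_z.
- by move=> r z; rewrite /pullback /polar mulr_natl cos2pi sin2pi cos0 sin0.
Qed.

End PullbackC1.

(** * The equations in polar coordinates *)

Section Extension.
Context {R : realType}.
Notation cyl := (@cylinder R).
Implicit Types (f : 'R3[R] -> R) (s : seq 'I_3) (i j k : 'I_3).

(** One family for the iterated derivatives of all orders, so that an identity
    proved inside extends to the wall by continuity of its terms. The empty
    sequence gives [f] itself, on the wall included. *)
Record extension f (E : seq 'I_3 -> 'R3[R] -> R) : Prop := {
  ext_nil : E [::] = f ;
  ext_continuous : forall s, {within closure cyl, continuous (E s)} ;
  ext_partial : forall s x, cyl x -> E s x = iter_partial s f x ;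
  ext_derive : forall s i x, cyl x ->
    is_derive x (delta_mx 0 i) (E s) (E (i :: s) x) }.

Lemma extension_exists f : smooth_up_to_boundary cyl f -> exists E, extension f E.
Proof.
move=> [cf hf]; pose G s := projT1 (cid2 (hf s).2).
have cG s : {within closure cyl, continuous (G s)}.
  by rewrite /G; case: cid2.
have GE s x : cyl x -> G s x = iter_partial s f x.
  by rewrite /G; case: cid2 => g /= _; exact.
pose E s := if s is [::] then f else G s.
have Ep s x : cyl x -> E s x = iter_partial s f x by case: s => [//|i s]; exact: GE.
have cE s : {within closure cyl, continuous (E s)}.
  by case: s => [|i s]; [exact: cf|exact: (cG (i :: s))].
exists E; split=> // s i x cx.
apply: (@near_eq_is_derive _ _ _ (iter_partial s f) (E s)).
  have : nbhs x cyl by apply: open_nbhs_nbhs; split=> //; exact: open_cylinder.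
  by apply: filterS => y cy; rewrite Ep.
rewrite Ep//=; apply: derivableP; exact: (hf s).1.
Qed.

Lemma extension_C1 f E s : extension f E ->
  C1 (pullback (E s)) (pullback (E (0 :: s))) (pullback (E (1 :: s)))
     (pullback (E (2 :: s))).
Proof.
by move=> [_ cE _ dE]; apply: C1_pullback => // x cx; exact: dE.
Qed.

Lemma extension_mixed f E i j x : extension f E -> cyl x ->
  E [:: j; i] x = E [:: i; j] x.
Proof.
move=> [_ cE _ dE] cx.
have cc s x' : cyl x' -> {for x', continuous (E s)}.
  by move=> cx'; exact: continuous_in_cylinder.
apply: (mixed_derivatives (v := delta_mx 0 i) (w := delta_mx 0 j) (f := E [::])
  (fv := E [:: i]) (fw := E [:: j]) (@open_cylinder R) cx) => y cy;
  first [exact: dE|exact: cc].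
Qed.

Lemma sum_ord3 (F : 'I_3 -> R) : \sum_(i < 3) F i = F 0 + F 1 + F 2.
Proof.
rewrite !big_ord_recl big_ord0 addr0 addrA.
by congr (F _ + F _ + F _); apply/val_inj.
Qed.

Lemma cross0E (v w : 'R3[R]) :
  cross v w 0 0 = v 0 1 * w 0 2 - v 0 2 * w 0 1.
Proof. by rewrite mxE; congr (v 0 _ * w 0 _ - v 0 _ * w 0 _); apply/val_inj. Qed.

Lemma cross1E (v w : 'R3[R]) :
  cross v w 0 1 = v 0 2 * w 0 0 - v 0 0 * w 0 2.
Proof. by rewrite mxE; congr (v 0 _ * w 0 _ - v 0 _ * w 0 _); apply/val_inj. Qed.

Lemma cross2E (v w : 'R3[R]) :
  cross v w 0 2 = v 0 0 * w 0 1 - v 0 1 * w 0 0.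
Proof. by rewrite mxE; congr (v 0 _ * w 0 _ - v 0 _ * w 0 _); apply/val_inj. Qed.

Lemma curlE (u : 'R3[R] -> 'R3[R]) x i j k : i + 1 = j -> i + 2 = k ->
  curl u x 0 i = partial j (component u k) x - partial k (component u j) x.
Proof. by move=> <- <-; rewrite mxE. Qed.

Lemma curl0E (u : 'R3[R] -> 'R3[R]) x :
  curl u x 0 0 = partial 1 (component u 2) x - partial 2 (component u 1) x.
Proof. by apply: curlE; apply/val_inj. Qed.

Lemma curl1E (u : 'R3[R] -> 'R3[R]) x :
  curl u x 0 1 = partial 2 (component u 0) x - partial 0 (component u 2) x.
Proof. by apply: curlE; apply/val_inj. Qed.

Lemma curl2E (u : 'R3[R] -> 'R3[R]) x :
  curl u x 0 2 = partial 0 (component u 1) x - partial 1 (component u 0) x.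
Proof. by apply: curlE; apply/val_inj. Qed.

End Extension.

Section Assembly.
Context {R : realType}.
Notation cyl := (@cylinder R).
Notation tau := (2 * pi : R).
Variables (u : 'R3[R] -> 'R3[R]) (p : 'R3[R] -> R).
Variables (E : 'I_3 -> seq 'I_3 -> 'R3[R] -> R) (P : seq 'I_3 -> 'R3[R] -> R).
Hypothesis extE : forall i, extension (component u i) (E i).
Hypothesis extP : extension p P.
Hypothesis NS : stationary_NS cyl u p.
Hypothesis NHL : navier_hodge_lions u.

Notation V i s := (pullback (E i s)).

Let CV i s : C1 (V i s) (V i (0 :: s)) (V i (1 :: s)) (V i (2 :: s)) :=
  extension_C1 s (extE i).
Let cV i s : C0 (V i s) := C1_C0 (CV i s).
Let cP s : C0 (pullback (P s)) := C1_C0 (extension_C1 s extP).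

Lemma divergence_free x : cyl x -> E 0 [:: 0] x + E 1 [:: 1] x + E 2 [:: 2] x = 0.
Proof.
move=> cx; have e i : E i [:: i] x = partial i (component u i) x.
  by rewrite (ext_partial (extE i) [:: i] cx).
by have [_] := NS cx; rewrite /divergence sum_ord3 !e.
Qed.

(** The index [j] is innermost: this is the order in which the second derivatives
    enter the energy identity, and it differs from differentiating the previous
    lemma by an exchange of derivatives. *)
Lemma divergence_free_derive j x : cyl x ->
  E 0 [:: 0; j] x + E 1 [:: 1; j] x + E 2 [:: 2; j] x = 0.
Proof.
move=> cx; rewrite (extension_mixed j 0 (extE 0) cx).
rewrite (extension_mixed j 1 (extE 1) cx) (extension_mixed j 2 (extE 2) cx).
have d1 := ext_derive (extE 0) [:: 0] j cx.
have d2 := ext_derive (extE 1) [:: 1] j cx.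
have d3 := ext_derive (extE 2) [:: 2] j cx.
have d : is_derive x (delta_mx 0 j) (E 0 [:: 0] + E 1 [:: 1] + E 2 [:: 2])
  (E 0 [:: j; 0] x + E 1 [:: j; 1] x + E 2 [:: j; 2] x).
  by apply: is_deriveD d3; apply: is_deriveD d1 d2.
have d0 : is_derive x (delta_mx 0 j) (E 0 [:: 0] + E 1 [:: 1] + E 2 [:: 2]) (0 : R).
  apply: (near_eq_is_derive (f := cst 0)).
  have : nbhs x cyl by apply: open_nbhs_nbhs; split=> //; exact: open_cylinder.
  by apply: filterS => y cy; rewrite /= -[LHS](divergence_free cy).
by rewrite -(@derive_val _ _ _ _ _ _ _ d) (@derive_val _ _ _ _ _ _ _ d0).
Qed.

Lemma momentum i x : cyl x ->
  u x 0 0 * E i [:: 0] x + u x 0 1 * E i [:: 1] x + u x 0 2 * E i [:: 2] x +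
  P [:: i] x = E i [:: 0; 0] x + E i [:: 1; 1] x + E i [:: 2; 2] x.
Proof.
move=> cx; have [ns _] := NS cx.
have /(congr1 (fun w : 'R3[R] => w 0 i)) := ns.
rewrite /convection /vlaplacian /grad !mxE !sum_ord3 /laplacian sum_ord3.
rewrite !(ext_partial (extE _))// (ext_partial extP)//= => /eqP.
by rewrite subr_eq0 => /eqP.
Qed.

Let on_closed (F G : 'R3[R] -> R) : C0 (pullback F) -> C0 (pullback G) ->
  (forall x, cyl x -> F x = G x) ->
  forall r t z, 0 <= r <= 1 -> pullback F r t z = pullback G r t z.
Proof.
move=> cF cG FG; apply: C0_eq_boundary => // r t z /andP[_ r1].
by apply: FG; exact: polar_cylinder.
Qed.

Lemma polar_divergence r t z : 0 <= r <= 1 ->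
  V 0 [:: 0] r t z + V 1 [:: 1] r t z + V 2 [:: 2] r t z = 0.
Proof.
apply: (on_closed (F := fun x => E 0 [:: 0] x + E 1 [:: 1] x + E 2 [:: 2] x)
  (G := fun=> 0)).
- by rewrite /pullback; c0; exact: cV.
- exact: C0_cst.
- exact: divergence_free.
Qed.

Lemma polar_divergence_derive j r t z : 0 <= r <= 1 ->
  V 0 [:: 0; j] r t z + V 1 [:: 1; j] r t z + V 2 [:: 2; j] r t z = 0.
Proof.
apply: (on_closed (F := fun x => E 0 [:: 0; j] x + E 1 [:: 1; j] x + E 2 [:: 2; j] x)
  (G := fun=> 0)).
- by rewrite /pullback; c0; exact: cV.
- exact: C0_cst.
- exact: divergence_free_derive.
Qed.

Lemma polar_momentum i r t z : 0 <= r <= 1 ->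
  V 0 [::] r t z * V i [:: 0] r t z + V 1 [::] r t z * V i [:: 1] r t z +
  V 2 [::] r t z * V i [:: 2] r t z + pullback (P [:: i]) r t z =
  V i [:: 0; 0] r t z + V i [:: 1; 1] r t z + V i [:: 2; 2] r t z.
Proof.
apply: (on_closed (F := fun x => E 0 [::] x * E i [:: 0] x + E 1 [::] x * E i [:: 1] x +
    E 2 [::] x * E i [:: 2] x + P [:: i] x)
  (G := fun x => E i [:: 0; 0] x + E i [:: 1; 1] x + E i [:: 2; 2] x)).
- by rewrite /pullback; c0; first [exact: cV|exact: cP].
- by rewrite /pullback; c0; exact: cV.
- by move=> x cx; rewrite !(ext_nil (extE _)); exact: momentum.
Qed.

Lemma boundary_polar t z : @cylinder_boundary R (polar 1 t z).
Proof.
rewrite /cylinder_boundary/= /polar; have [-> -> _] := vec3E (clamp01 1 * cos t) (clamp01 1 * sin t) z.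
by rewrite polar_sqr clamp01_ge1// expr1n.
Qed.

Lemma normal_polar t z : outer_normal (polar 1 t z) = vec3 (cos t) (sin t) (0 : R).
Proof.
rewrite /outer_normal /polar.
have [-> -> _] := vec3E (clamp01 1 * cos t) (clamp01 1 * sin t) z.
by rewrite clamp01_ge1// !mul1r.
Qed.

Lemma polar_impermeable t z :
  cos t * V 0 [::] 1 t z + sin t * V 1 [::] 1 t z = 0.
Proof.
have [_] := NHL (boundary_polar t z); rewrite /dot sum_ord3 normal_polar.
have [-> -> ->] := vec3E (cos t) (sin t) (0 : R).
by rewrite mulr0 addr0 /pullback !(ext_nil (extE _)) /component mulrC [X in _ + X]mulrC.
Qed.

(** The boundary condition on the vorticity is a limit from inside; approach the
    wall along a radius. *)
Lemma polar_curl_limit i t z (w : R -> R) : continuous w ->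
  (forall r, 0 < r < 1 -> cross (curl u (polar r t z)) (outer_normal (polar 1 t z)) 0 i = w r) ->
  w 1 = 0.
Proof.
move=> cw wE; have [lim0 _] := NHL (boundary_polar t z).
have e1 : lim (w r @[r --> (1 : R)^'-]) = w 1.
  by apply/cvg_lim => //; apply: cvg_at_left_filter; exact: cw.
have e2 : lim (w r @[r --> (1 : R)^'-]) = 0.
  apply/cvg_lim => //.
  have h : polar r t z @[r --> (1 : R)^'-] --> within cyl (nbhs (polar 1 t z)).
    have cp : {for 1, continuous (fun r : R => polar r t z)}.
      apply: (@continuous_comp _ _ _ (fun r : R => (r, t, z))
        (fun q : R * R * R => polar q.1.1 q.1.2 q.2)); last exact: continuous_polar.
      by apply: continuous_pair; cont.
    move=> U; rewrite /within/= => HU.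
    have := cvg_at_left_filter cp HU; rewrite /= !nbhs_simpl/= => HU'.
    near=> r; have : cyl (polar r t z) -> U (polar r t z) by near: r.
    by apply; apply: polar_cylinder; near: r; exact: nbhs_left_lt.
  have l2 := cvg_comp _ _ h lim0.
  have l3 := cvg_comp _ _ l2 (@coord_continuous _ _ _ 0 i (0 : 'R3[R])).
  have : cross (curl u (polar r t z)) (outer_normal (polar 1 t z)) 0 i
      @[r --> (1 : R)^'-] --> (0 : R) by move: l3; rewrite mxE.
  apply: cvg_trans; apply: near_eq_cvg; near=> r; rewrite wE//; apply/andP; split.
    by near: r; exact: nbhs_left_gt.
  by near: r; exact: nbhs_left_lt.
by rewrite -e1 e2.
Unshelve. all: by end_near. Qed.

(** Two components of the condition give [om_3 sin t = om_3 cos t = 0], the third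
    one the relation between [om_1] and [om_2]. *)
Lemma polar_curl t z : V 1 [:: 0] 1 t z = V 0 [:: 1] 1 t z /\
  (V 2 [:: 1] 1 t z - V 1 [:: 2] 1 t z) * sin t =
  (V 0 [:: 2] 1 t z - V 2 [:: 0] 1 t z) * cos t.
Proof.
have cr i s : continuous (fun r => V i s r t z) by exact: C0_r.
have [n0 n1 n2] := vec3E (cos t) (sin t) (0 : R).
have inner r i j : 0 < r < 1 ->
    partial j (component u i) (polar r t z) = V i [:: j] r t z.
  move=> /andP[_ r1]; rewrite /pullback (ext_partial (extE i) [:: j])//.
  exact: polar_cylinder.
have h0 : - ((V 1 [:: 0] 1 t z - V 0 [:: 1] 1 t z) * sin t) = 0.
  apply: (@polar_curl_limit 0 t z
    (fun r => - ((V 1 [:: 0] r t z - V 0 [:: 1] r t z) * sin t))).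
    by apply: continuous_opp; apply: continuous_mul; [apply: continuous_add; [exact: cr|apply: continuous_opp; exact: cr]|cont].
  by move=> r r01; rewrite normal_polar cross0E curl1E curl2E n1 n2 !inner// mulr0 add0r.
have h1 : (V 1 [:: 0] 1 t z - V 0 [:: 1] 1 t z) * cos t = 0.
  apply: (@polar_curl_limit 1 t z
    (fun r => (V 1 [:: 0] r t z - V 0 [:: 1] r t z) * cos t)).
    by apply: continuous_mul; [apply: continuous_add; [exact: cr|apply: continuous_opp; exact: cr]|cont].
  by move=> r r01; rewrite normal_polar cross1E curl2E curl0E n0 n2 !inner// mulr0 subr0.
have h2 : (V 2 [:: 1] 1 t z - V 1 [:: 2] 1 t z) * sin t -
   (V 0 [:: 2] 1 t z - V 2 [:: 0] 1 t z) * cos t = 0.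
  apply: (@polar_curl_limit 2 t z
    (fun r => (V 2 [:: 1] r t z - V 1 [:: 2] r t z) * sin t -
      (V 0 [:: 2] r t z - V 2 [:: 0] r t z) * cos t)).
    by apply: continuous_add; last apply: continuous_opp;
     (apply: continuous_mul; [apply: continuous_add; [exact: cr|apply: continuous_opp; exact: cr]|cont]).
  by move=> r r01; rewrite normal_polar cross2E curl0E curl1E n0 n1 !inner.
split; last by apply/eqP; rewrite -subr_eq0 h2.
apply/eqP; rewrite -subr_eq0; apply/eqP.
move/eqP: h0; rewrite oppr_eq0 => /eqP h0; move: h0 h1.
move: (_ - _) => d h0 h1; rewrite -[LHS]mulr1 -(cos2Dsin2 t).
by rewrite mulrDr !expr2 !mulrA h1 h0 !mul0r addr0.
Qed.

End Assembly.

(** * Constancy of the velocity *)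

Section Rigidity.
Context {R : realType}.
Notation cyl := (@cylinder R).
Notation tau := (2 * pi : R).
Implicit Types (r t z : R).

(** Compare with [Z = Z^beta Z^(1 - beta)], whose second factor is unbounded. *)
Lemma powR_sublinear (C M0 beta e : R) : 0 < C -> 0 <= M0 -> beta < 1 -> 0 < e ->
  exists2 Z0, 1 <= Z0 & forall Z, Z0 <= Z -> M0 + C * Z `^ beta <= e * Z.
Proof.
move=> C0 M00 b1 e0.
pose q := 2 * C / e; pose k := q `^ (1 - beta)^-1.
have q0 : 0 < q by rewrite /q divr_gt0 ?mulr_gt0.
have k0 : 0 <= k by exact: powR_ge0.
have m0 : 0 <= 2 * M0 / e by rewrite divr_ge0 ?mulr_ge0// ltW.
have b0 : 0 < 1 - beta by rewrite subr_gt0.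
exists (1 + k + 2 * M0 / e) => [|Z ZZ0]; first by lra.
have Z0 : 0 < Z by lra.
have kZ : k <= Z by lra.
have h1 : q <= Z `^ (1 - beta).
  rewrite (_ : q = k `^ (1 - beta)); first by apply: ge0_ler_powR => //;
    [exact: ltW|rewrite nnegrE ltW].
  by rewrite /k -powRrM mulVf ?gt_eqF// powRr1// ltW.
have ZE : Z = Z `^ beta * Z `^ (1 - beta).
  by rewrite -powRD ?gt_eqF ?implybT// (_ : beta + _ = 1) ?powRr1 ?ltW//; ring.
have h2 : C * Z `^ beta <= e / 2 * Z.
  have h := ler_wpM2l (powR_ge0 Z beta) h1; rewrite -ZE in h.
  rewrite (_ : C * _ = e / 2 * (Z `^ beta * q)) ?ler_pM2l ?divr_gt0//.
  by rewrite /q; field; rewrite gt_eqF.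
have h3 : M0 <= e / 2 * Z.
  rewrite (_ : M0 = e / 2 * (2 * M0 / e)); first by rewrite ler_pM2l ?divr_gt0//; lra.
  by field; rewrite gt_eqF.
by lra.
Qed.

Lemma grad2E (W : 'I_3 -> 'I_3 -> R -> R -> R -> R) r t z :
  grad2 (W 0 0) (W 0 1) (W 0 2) (W 1 0) (W 1 1) (W 1 2) (W 2 0) (W 2 1) (W 2 2) r t z =
  \sum_(i < 3) \sum_(j < 3) W i j r t z ^+ 2.
Proof. by rewrite !sum_ord3 !addrA. Qed.

(** The bound is stated as a square to be combined with the growth condition,
    which says nothing for [|z| < 1]. *)
Lemma compact_bound (f : R -> R -> R -> R) : C0 f ->
  exists2 B, 0 <= B & forall r t z, 0 <= r <= 1 -> 0 <= t <= tau -> -1 <= z <= 1 ->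
    f r t z <= B ^+ 2.
Proof.
move=> cf.
pose A := (`[0, 1]%classic `*` `[0, tau]%classic) `*` `[-1, 1]%classic : set (R * R * R).
have A0 : A !=set0.
  by exists (0, 0, 0); do 2?split; rewrite /= in_itv/= ?lexx ?ler01 ?tau_ge0//; lra.
have cA : compact A by do 2?apply: compact_setX; exact: segment_compact.
have [|c _ cmax] := @compact_EVT_max _ R (fun q : R * R * R => f q.1.1 q.1.2 q.2) A A0 cA.
  by apply: continuous_subspaceT; exact: cf.
set M := f _ _ _ in cmax.
exists (1 + `|M|) => [|r t z r01 t01 z01]; first by rewrite addr_ge0.
apply: (@le_trans _ _ M).
  have -> : f r t z = (fun q : R * R * R => f q.1.1 q.1.2 q.2) (r, t, z) by [].
  by apply: cmax; rewrite inE; do 2?split; rewrite /= in_itv.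
by have := ler_norm M; have := normr_ge0 M; nra.
Qed.

Lemma polar_surjective (x : 'R3[R]) : closure cyl x ->
  exists r t, [/\ 0 <= r <= 1, 0 <= t <= tau & x = polar r t (x 0 2)].
Proof.
move=> /closure_cylinder_le; set a := x 0 0; set b := x 0 1 => ab1.
have s0 : 0 <= a ^+ 2 + b ^+ 2 by rewrite addr_ge0// sqr_ge0.
pose r := Num.sqrt (a ^+ 2 + b ^+ 2).
have r2 : r ^+ 2 = a ^+ 2 + b ^+ 2 by rewrite sqr_sqrtr.
have r0 : 0 <= r by exact: sqrtr_ge0.
have r01 : 0 <= r <= 1 by rewrite r0/= -(@expr_le1 _ 2)// r2.
have [t [t01 at_ bt]] : exists t, [/\ 0 <= t <= tau, a = r * cos t & b = r * sin t].
  have [r00|rN0] := eqVneq r 0.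
    exists 0; rewrite lexx tau_ge0 r00 !mul0r; move: r2.
    rewrite r00 expr0n/= => /esym/eqP; rewrite paddr_eq0 ?sqr_ge0// !sqrf_eq0.
    by move=> /andP[/eqP -> /eqP ->].
  have rp : 0 < r by rewrite lt_def rN0.
  have ar : -1 <= a / r <= 1.
    rewrite -ler_norml normrM normfV (ger0_norm r0) ler_pdivrMr// mul1r.
    by rewrite -(@ler_pXn2r _ 2)// ?nnegrE// real_normK ?num_real// r2 lerDl sqr_ge0.
  pose w := acos (a / r).
  have cw : r * cos w = a by rewrite /w acosK// mulrC divfK.
  have w0 : 0 <= w by exact: acos_ge0.
  have wpi : w <= pi by exact: acos_lepi.
  have sw : (r * sin w) ^+ 2 = b ^+ 2.
    rewrite exprMn sin2cos2 mulrBr mulr1 -exprMn cw r2; ring.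
  have sw0 : 0 <= sin w by rewrite sin_ge0_pi// w0 wpi.
  have rsw : r * sin w = `|b|.
    apply/eqP; rewrite -(@eqrXn2 _ 2)// ?mulr_ge0// sw real_normK ?num_real//.
  have pi0 := @pi_gt0 R.
  have [b0|b0] := leP 0 b.
    exists w; rewrite cw rsw ger0_norm//; split=> //; apply/andP; split=> //; lra.
  exists (2 * pi - w); rewrite cosB sinB mulr_natl cos2pi sin2pi; split.
  - by apply/andP; split; lra.
  - by rewrite -cw; ring.
  - by rewrite mul0r mul1r sub0r mulrN rsw ltr0_norm// opprK.
exists r, t; split=> //; rewrite [LHS]vec3_eta /polar clamp01_id//.
by rewrite -/a -/b at_ bt.
Qed.

End Rigidity.


Section Liouville.
Context {R : realType}.
Notation cyl := (@cylinder R).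
Notation tau := (2 * pi : R).
Implicit Types (r t z : R).
Variables (u : 'R3[R] -> 'R3[R]) (p : 'R3[R] -> R).
Variables (E : 'I_3 -> seq 'I_3 -> 'R3[R] -> R) (P : seq 'I_3 -> 'R3[R] -> R).
Hypothesis extE : forall i, extension (component u i) (E i).
Hypothesis extP : extension p P.
Hypothesis NS : stationary_NS cyl u p.
Hypothesis NHL : navier_hodge_lions u.
Variables C beta : R.
Hypotheses (C0_gt0 : 0 < C) (beta0 : 0 < beta) (beta1 : beta < 1).
Hypothesis growth : forall x : 'R3[R], cyl x -> 1 <= `|x 0 2| ->
  grad_norm u x <= C * `|x 0 2| `^ beta.

Notation V i s := (pullback (E i s)).

Let CV i s : C1 (V i s) (V i (0 :: s)) (V i (1 :: s)) (V i (2 :: s)) :=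
  extension_C1 s (extE i).
Let cV i s : C0 (V i s) := C1_C0 (CV i s).

Definition mean_axial z := slice (fun r t z => r * V 2 [::] r t z) z / pi.

(** The flux through a cross-section does not depend on the section: its
    derivative is minus the flux of the horizontal velocity through the wall. *)
Lemma mean_axial_cst z : mean_axial z = mean_axial 0.
Proof.
have c1 : C0 (fun r t z => r * V 2 [::] r t z) by c0; exact: cV.
have c2 : C0 (fun r t z => r * V 2 [:: 2] r t z) by c0; exact: cV.
have dS (y : R) : is_derive y 1 (slice (fun r t z => r * V 2 [::] r t z))
    (slice (fun r t z => r * V 2 [:: 2] r t z) y).
  apply: (@is_derive_int R (fun r z => intg 0 tau (fun t => r * V 2 [::] r t z))
    (fun r z => intg 0 tau (fun t => r * V 2 [:: 2] r t z))).
  - exact: (continuous_ring c1).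
  - exact: (continuous_ring c2).
  - move=> r {}y; apply: (@is_derive_int R (fun t z => r * V 2 [::] r t z)
      (fun t z => r * V 2 [:: 2] r t z)).
    + by apply: (C0_comp c1); cont.
    + by apply: (C0_comp c2); cont.
    + by move=> t s; have d := C1_z (CV 2 [::]) r t s; deriv.
have dS0 (y : R) : is_derive y 1 (slice (fun r t z => r * V 2 [::] r t z)) 0.
  suff <- : slice (fun r t z => r * V 2 [:: 2] r t z) y = 0 by exact: dS.
  have c3 : C0 (fun r t z => r * (V 0 [:: 0] r t z + V 1 [:: 1] r t z)).
    by c0; exact: cV.
  rewrite (@eq_slice _ _ (fun r t z => -1 * (r * (V 0 [:: 0] r t z + V 1 [:: 1] r t z)))).
    rewrite sliceZ// (slice_div y (CV 0 [::]) (CV 1 [::])).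
    rewrite (_ : (fun t => _) = fun=> 0); first by rewrite int_cst !mulr0.
    by apply/funext => t; exact: (polar_impermeable extE NHL).
  move=> r t r01 _; have h := polar_divergence extE NS t y r01.
  rewrite (_ : V 2 [:: 2] r t y = (V 0 [:: 0] r t y + V 1 [:: 1] r t y + V 2 [:: 2] r t y)
    - (V 0 [:: 0] r t y + V 1 [:: 1] r t y)); last by ring.
  by rewrite h; ring.
have cc : continuous (fun _ : R => 0 : R) by exact: continuous_cst.
have := int_FTC2T 0 z cc dS0; rewrite int_cst mulr0 => /esym/eqP.
by rewrite subr_eq0 /mean_axial => /eqP ->.
Qed.

Let a := mean_axial 0.
Let v3 r t z := V 2 [::] r t z - a.
Let G r t z := grad2 (V 0 [:: 0]) (V 0 [:: 1]) (V 0 [:: 2]) (V 1 [:: 0]) (V 1 [:: 1])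
  (V 1 [:: 2]) (V 2 [:: 0]) (V 2 [:: 1]) (V 2 [:: 2]) r t z.

Let C0_G : C0 G.
Proof. by rewrite /G /grad2; c0; exact: cV. Qed.

(** The growth condition is assumed inside only; continuity carries it to the wall. *)
Lemma grad2_growth r t z : 0 <= r <= 1 -> 1 <= `|z| ->
  G r t z <= (C * `|z| `^ beta) ^+ 2.
Proof.
move=> r01 z1.
have c : continuous (fun r => G r t z) by exact: (@C0_r _ G t z C0_G).
apply: (le_closed_itv ltr01 c _ r01) => {r01}r /andP[_ r1].
have cx := @polar_cylinder _ r t z r1.
have zE : (polar r t z) 0 2 = z.
  by have [_ _] := vec3E (clamp01 r * cos t) (clamp01 r * sin t) z.
have := growth cx; rewrite zE => /(_ z1).
have S0 : 0 <= \sum_(i < 3) \sum_(j < 3) partial j (component u i) (polar r t z) ^+ 2.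
  by apply: sumr_ge0 => i _; apply: sumr_ge0 => j _; exact: sqr_ge0.
rewrite /grad_norm -(@ler_pXn2r _ 2)// ?nnegrE ?sqrtr_ge0//; last first.
  by rewrite mulr_ge0 ?powR_ge0// ltW.
rewrite sqr_sqrtr//; apply: le_trans.
have := lexx (G r t z); rewrite {2}/G (@grad2E _ (fun i j => V i [:: j])).
congr (_ <= _); apply: eq_bigr => i _; apply: eq_bigr => j _; congr (_ ^+ 2).
exact: (ext_partial (extE i) [:: j] cx).
Qed.

Lemma gradient_vanishes i j r t z : 0 <= r <= 1 -> 0 <= t <= tau ->
  V i [:: j] r t z = 0.
Proof.
move: r t z; have [M0 M00 HM0] := compact_bound C0_G.
pose m Z := M0 + C * Z `^ beta.
have m0 Z : 0 <= m Z by rewrite addr_ge0// mulr_ge0 ?powR_ge0// ltW.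
have gm Z r t z : 1 <= Z -> 0 <= r <= 1 -> 0 <= t <= tau -> - Z <= z <= Z ->
    G r t z <= m Z ^+ 2.
  move=> Z1 r01 t01 zZ; have Cz : 0 <= C * Z `^ beta by rewrite mulr_ge0 ?powR_ge0// ltW.
  have [z1|z1] := leP 1 `|z|.
    apply: (le_trans (grad2_growth t r01 z1)).
    have Cz1 : 0 <= C * `|z| `^ beta by rewrite mulr_ge0 ?powR_ge0// ltW.
    have le1 : `|z| `^ beta <= Z `^ beta.
      apply: ge0_ler_powR; [exact: ltW|exact: normr_ge0| |by rewrite ler_norml].
      exact: le_trans ler01 Z1.
    rewrite ler_pXn2r ?nnegrE ?m0// /m.
    by apply: (@le_trans _ _ (C * Z `^ beta)); [rewrite ler_pM2l|rewrite lerDr].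
  apply: (le_trans (HM0 r t z r01 t01 _)); first by rewrite -ler_norml ltW.
  by rewrite ler_pXn2r ?nnegrE// /m lerDl.
have Cv3 : C1 v3 (V 2 [:: 0]) (V 2 [:: 1]) (V 2 [:: 2]).
  by apply: (C1_eq (C1_add (CV 2 [::]) (C1_opp (C1_cst a)))) => x y w; ring.
have ns k x y w : 0 <= x <= 1 ->
    V 0 [::] x y w * V k [:: 0] x y w + V 1 [::] x y w * V k [:: 1] x y w +
    v3 x y w * V k [:: 2] x y w + a * V k [:: 2] x y w + pullback (P [:: k]) x y w =
    V k [:: 0; 0] x y w + V k [:: 1; 1] x y w + V k [:: 2; 2] x y w.
  by move=> x01; rewrite -(polar_momentum extE extP NS)// /v3; ring.
have [cu1 cu2] := ((fun t z => (polar_curl extE NHL t z).1),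
  (fun t z => (polar_curl extE NHL t z).2)).
have flux0 w : slice (fun r t z => r * v3 r t z) w = 0.
  have c1 : C0 (fun r t z => r * V 2 [::] r t z) by c0; exact: cV.
  have c2 : C0 (fun r _ _ : R => - a * r) by c0.
  rewrite (@eq_slice _ _ (fun r t z => r * V 2 [::] r t z + - a * r)); last first.
    by move=> x y _ _; rewrite /v3; ring.
  rewrite sliceD// sliceZ; last by c0.
  rewrite (_ : slice (fun r _ _ => r) w = pi); last first.
    rewrite /slice (_ : (fun r => _) = fun r => tau * r).
      rewrite intZ ?int_id01; first by field.
      by cont.
    by apply/funext => x; rewrite int_cst subr0.
  have pi0 := @pi_gt0 R.
  rewrite /a -(mean_axial_cst w) /mean_axial mulNr divfK ?subrr// gt_eqF//.
have V0 := @sublinear_gradient_vanishes R (V 0 [::]) (V 1 [::]) v3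
  _ _ _ _ _ _ _ _ _ _ _ _ _ _ _ _ _ _ _ _ _ _ _ _ _ _ _ _ _ _ _ _ _ _ _ _
  (pullback (P [::])) _ _ _ a (CV 0 [::]) (CV 1 [::]) Cv3 (extension_C1 [::] extP)
  (CV 0 [:: 0]) (CV 0 [:: 1]) (CV 0 [:: 2]) (CV 1 [:: 0]) (CV 1 [:: 1]) (CV 1 [:: 2])
  (CV 2 [:: 0]) (CV 2 [:: 1]) (CV 2 [:: 2])
  (polar_divergence extE NS) (polar_divergence_derive extE NS 0)
  (polar_divergence_derive extE NS 1) (ns 0) (ns 1) (ns 2)
  (polar_impermeable extE NHL) cu1 cu2 flux0 m (fun Z _ => m0 Z) gm
  (fun e => powR_sublinear C0_gt0 M00 beta1).
have G0 x y w : 0 <= x <= 1 -> 0 <= y <= tau -> G x y w <= 0.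
  move=> x01 y01.
  apply: (le_closed_itv ltr01 (@C0_r _ G y w C0_G) _ x01) => {x01}x x01.
  apply: (le_closed_itv tau_gt0 (@C0_t _ G x w C0_G) _ y01) => {y01}y y01.
  by rewrite /G V0.
move=> r t z r01 t01; have := G0 r t z r01 t01.
rewrite /G (@grad2E _ (fun i j => V i [:: j])) (bigD1 i)//= (bigD1 j)//= -addrA => h.
apply/eqP; rewrite -sqrf_eq0 eq_le sqr_ge0 andbT; apply: le_trans h.
rewrite lerDl addr_ge0// sumr_ge0// => k _; first exact: sqr_ge0.
by apply: sumr_ge0 => l _; exact: sqr_ge0.
Qed.

Lemma velocity_cst i r t z : 0 <= r <= 1 -> 0 <= t <= tau ->
  V i [::] r t z = V i [::] 0 0 0.
Proof.
move=> r01 t01; have z01 : 0 <= (0 : R) <= tau by rewrite lexx tau_ge0.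
have o01 : 0 <= (0 : R) <= 1 by rewrite lexx ler01.
have h y : 0 <= y <= tau -> forall x, 0 <= x <= 1 ->
    `|V i [:: 0] x y z| <= 0 /\ `|V i [:: 1] x y z| <= 0.
  by move=> y01 x x01; rewrite !gradient_vanishes// normr0.
have := oscillation (lexx 0) (CV i [::]) (h _ t01) (h _ z01) r01 o01.
rewrite mulr0 normr_le0 subr_eq0 => /eqP ->.
have cc : continuous (fun _ : R => 0 : R) by exact: continuous_cst.
have d (y : R) : is_derive y 1 (V i [::] 0 0) 0.
  by have := C1_z (CV i [::]) 0 0 y; rewrite gradient_vanishes.
have := int_FTC2T 0 z cc d; rewrite int_cst mulr0 => /esym/eqP.
by rewrite subr_eq0 => /eqP.
Qed.

(** A constant vector tangent to the wall at angles [0] and [pi/2] is axial. *)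
Lemma velocity_axial : exists k, forall x, closure cyl x -> u x = k *: e3 R.
Proof.
exists (V 2 [::] 0 0 0) => x cx.
have [r [t [r01 t01 ->]]] := polar_surjective cx.
have one01 : 0 <= (1 : R) <= 1 by rewrite ler01 lexx.
have pi0 := @pi_gt0 R.
have V0 : V 0 [::] 0 0 0 = 0.
  have := polar_impermeable extE NHL 0 0; rewrite cos0 sin0 mul1r mul0r addr0.
  by rewrite velocity_cst ?lexx ?ler01 ?tau_ge0.
have V1 : V 1 [::] 0 0 0 = 0.
  have := polar_impermeable extE NHL (pi / 2) 0; rewrite cos_pihalf sin_pihalf mul1r mul0r add0r.
  by rewrite velocity_cst//; apply/andP; split; lra.
have uE i : u (polar r t (x 0 2)) 0 i = V i [::] 0 0 0.
  by rewrite -(@velocity_cst i r t (x 0 2))// /pullback (ext_nil (extE i)).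
by rewrite [LHS]vec3_eta !uE V0 V1 -[RHS]add0r (_ : 0 = vec3 0 0 0) ?vec3_lin ?mulr0 ?mulr1 ?add0r//;
  apply/rowP => i; rewrite /vec3 !mxE; case: i => [[|[|[|//]]]].
Qed.

End Liouville.

(** * The flux of a constant axial field *)

Section Disk.
Context {R : realType}.
Notation mu := (@lebesgue_measure R).

(** Substitute [x = sin t]; the primitive of [cos t ^ 2] is
    [(t + sin t cos t) / 2]. *)
Lemma int_half_chord : (\int[mu]_(x in `[(-1)%R, 1%R]) (Num.sqrt (1 - x ^+ 2))%:E = (pi / 2)%:E)%E.
Proof.
have pi0 := @pi_gt0 R.
have ab : - (pi / 2) < pi / 2 :> R by lra.
have csin : continuous (@sin R) by exact: continuous_sin.
have ccos : continuous (@cos R) by exact: continuous_cos.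
have dsin : ((@sin R)^`() = cos)%classic.
  by apply/funext => t; rewrite derive1E; apply: derive_val.
have -> : (\int[mu]_(x in `[(-1)%R, 1%R]) (Num.sqrt (1 - x ^+ 2))%:E =
    \int[mu]_(x in `[sin (- (pi / 2)), sin (pi / 2)]) (Num.sqrt (1 - x ^+ 2))%:E)%E.
  by rewrite sinN sin_pihalf.
rewrite (@integration_by_substitution_increasing R sin (fun x => Num.sqrt (1 - x ^+ 2)))//.
- rewrite dsin.
  pose F t : R := (t + sin t * cos t) / 2.
  transitivity (\int[mu]_(t in `[(- (pi / 2))%R, (pi / 2)%R]) (cos t ^+ 2)%:E)%E.
    apply: eq_integral => t; rewrite inE/= in_itv/= => /andP[t0 t1].
    congr (_%:E); rewrite /GRing.mul/= -cos2sin2 sqrtr_sqr ger0_norm ?expr2//.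
    by rewrite cos_ge0_pihalf// t0 t1.
  have dF (t : R) : is_derive t 1 F (cos t ^+ 2).
    have e := cos2Dsin2 t.
    rewrite /F; apply: derive_eq; rewrite /GRing.scale/=; move: e.
    by move: (sin t) (cos t) => s c; nra.
  rewrite (@continuous_FTC2 R (fun t => cos t ^+ 2) F).
  + rewrite /F cosN cos_pihalf !mulr0 !addr0 -EFinB; congr (_%:E); by field.
  + exact: ab.
  + by apply: continuous_subspaceT; cont.
  + split.
    * by move=> t _; apply: ex_derive.
    * by apply: cvg_at_right_filter; apply: (@differentiable_continuous _ R^o R^o); apply/derivable1_diffP; apply: ex_derive.
    * by apply: cvg_at_left_filter; apply: (@differentiable_continuous _ R^o R^o); apply/derivable1_diffP; apply: ex_derive.
  + by move=> t _; rewrite derive1E; apply: derive_val.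
- exact: ltW.
- by move=> x y; rewrite !in_itv/= => xi yi; rewrite ltr_sin.
- by move=> t _; rewrite dsin; exact: ccos.
- by rewrite dsin; apply/cvg_ex; eexists; apply: cvg_at_right_filter; exact: ccos.
- by rewrite dsin; apply/cvg_ex; eexists; apply: cvg_at_left_filter; exact: ccos.
- split; first by move=> t _; apply: ex_derive.
  + by apply: cvg_at_right_filter; exact: csin.
  + by apply: cvg_at_left_filter; exact: csin.
- apply: continuous_subspaceT; apply: (continuous_comp1 (@sqrt_continuous R)).
  by cont.
Qed.

Lemma measurable_unit_disk : measurable (@unit_disk R).
Proof.
rewrite (_ : @unit_disk R = [set: R * R] `&`
    (fun q => q.1 ^+ 2 + q.2 ^+ 2) @^-1` [set` `]-oo, (1 : R)[]); last first.
  by rewrite setTI; apply/seteqP; split=> q /=; rewrite /unit_disk/= in_itv.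
have m : measurable_fun [set: R * R] (fun q : R * R => q.1 ^+ 2 + q.2 ^+ 2).
  by apply: measurable_funD; apply: measurable_funX;
    [exact: measurable_fst|exact: measurable_snd].
by apply: m => //; exact: measurable_itv.
Qed.

(** The chord of the disk above [x] has half-length [sqrt (1 - x^2)], which the
    convention [sqrt y = 0] for [y < 0] makes correct also when the chord is
    empty. *)
Lemma area_unit_disk : ((mu \x mu) (@unit_disk R) = pi%:E)%E.
Proof.
pose s x : R := Num.sqrt (1 - x ^+ 2).
have s0 x : 0 <= s x by exact: sqrtr_ge0.
have chord x : mu (xsection (@unit_disk R) x) = (2 * s x)%:E.
  have -> : xsection (@unit_disk R) x = [set` `](- s x), s x[].
    apply/seteqP; split=> y /=; rewrite /xsection/= inE /unit_disk/= in_itv/= => h.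
      have h' : y ^+ 2 < 1 - x ^+ 2 by rewrite ltrBrDl.
      rewrite -ltr_norml -(@ltr_pXn2r _ 2)// ?nnegrE// real_normK ?num_real//.
      by rewrite /s sqr_sqrtr//; apply: le_trans (ltW h'); exact: sqr_ge0.
    move: h; rewrite -ltr_norml -(@ltr_pXn2r _ 2)// ?nnegrE// real_normK ?num_real//.
    have [le0|gt0] := leP (1 - x ^+ 2) 0.
      by rewrite /s ler0_sqrtr// expr0n/= ltNge sqr_ge0.
    by rewrite /s sqr_sqrtr ?ltW// ltrBrDl.
  rewrite lebesgue_measure_itv/= lte_fin; case: ltP => h.
    by rewrite -EFinB; congr (_%:E); ring.
  have -> : s x = 0 by apply/eqP; rewrite eq_le s0; lra.
  by rewrite mulr0.
transitivity (\int[mu]_x (2 * s x)%:E)%E.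
  by apply: eq_integral => x _; rewrite /= chord.
have -> : (\int[mu]_x (2 * s x)%:E = \int[mu]_(x in `[(-1)%R, 1%R]) (2 * s x)%:E)%E.
  rewrite [RHS]integral_mkcond; apply: eq_integral => x _; rewrite patchE.
  case: ifPn => //; rewrite notin_setE/= in_itv/= => /negP.
  rewrite -ler_norml -ltNge => x1; rewrite /s ler0_sqrtr ?mulr0// subr_le0.
  by rewrite -(real_normK (num_real x)) expr_ge1// ltW.
have cs : continuous s.
  by apply: (continuous_comp1 (@sqrt_continuous R)); cont.
under eq_integral do rewrite EFinM.
rewrite ge0_integralZl//.
- by rewrite int_half_chord -EFinM; congr (_%:E); field.
- apply/measurable_EFinP; apply: subspace_continuous_measurable_fun => //.
  exact: continuous_subspaceT.
- by move=> x _; rewrite lee_fin.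
Qed.

Lemma flux_cst (u : 'R3[R] -> 'R3[R]) k z : (forall x, closure (@cylinder R) x -> u x = k *: e3 R) ->
  flux u z = k * pi.
Proof.
move=> uk; rewrite /flux (eq_Rintegral _ (g := fun=> k)); last first.
  move=> q; rewrite inE /unit_disk/= => q1; rewrite uk; last first.
    by apply: subset_closure; apply/cylinder_vec3.
  by rewrite /dot sum_ord3 !mxE/= !mulr0 !add0r !mulr1.
rewrite Rintegral_cst; last exact: measurable_unit_disk.
exact: (congr1 (fun v => k * fine v) area_unit_disk).
Qed.

End Disk.

Theorem theorem1p5 (R : realType) (u : 'R3[R] -> 'R3[R]) (p : 'R3[R] -> R)
    (C beta : R)
    (u_smooth : vsmooth_up_to_boundary (@cylinder R) u)
    (p_smooth : smooth_up_to_boundary (@cylinder R) p)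
    (NS : stationary_NS (@cylinder R) u p)
    (NHL : navier_hodge_lions u)
    (C_gt0 : 0 < C)
    (beta_gt0 : 0 < beta) (beta_lt1 : beta < 1)
    (growth : forall x : 'R3[R], cylinder x -> 1 <= `|x 0 2| ->
       grad_norm u x <= C * `|x 0 2| `^ beta) :
  forall z : R, forall x : 'R3[R], closure (@cylinder R) x ->
    u x = (flux u z / pi) *: e3 R.
Proof.
have [E extE] : exists E, forall i, extension (component u i) (E i).
  pose e i := cid (extension_exists (u_smooth i)).
  by exists (fun i => projT1 (e i)) => i; exact: (projT2 (e i)).
have [P extP] := extension_exists p_smooth.
have [k uk] := velocity_axial extE extP NS NHL C_gt0 beta_gt0 beta_lt1 growth.
move=> z x cx; rewrite (flux_cst z uk) mulfK ?uk//.
by rewrite gt_eqF// pi_gt0.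
Qed.
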